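(* Let $S$ be a Polish space and let $\mu$ be a solution of the recursive distributional equation $X \overset{d}{=} g(\xi;(X_j : 1\le j\le^* N))$ on $S$. Consider an invariant recursive tree process (RTP) $(X_{\mathbf i})_{\mathbf i\in\mathcal V}$ with marginal distribution $\mu$. (a) If the RTP has trivial tail, then the bivariate uniqueness property of the second kind holds. (b) Suppose the bivariate uniqueness property of the second kind holds. If also $T\otimes T$ is continuous with respect to weak convergence on the set of bivariate distributions (probability measures on $S^2$) with both marginals equal to $\mu$, then the tail of the RTP is trivial. (c) The RTP has a trivial tail if and only if $(T\otimes T)^n(\mu^{\nearrow})$ converges weakly to $\mu\otimes\mu$ as $n\to\infty$, where $\mu^{\nearrow}$ is the diagonal measure with marginal $\mu$, that is, if $(X,Y)\sim\mu^{\nearrow}$ then $\mathbf P(X=Y)=1$ and $X,Y\sim\mu$.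
   Context: Recursive distributional equation (RDE). Let $\mathcal P(S)$ be the set of probability measures on $S$. Let $(\xi,N)$ be a random pair with known law, where $\xi$ takes values in some measurable space and $N$ takes values in $\{0,1,2,\dots\}\cup\{\infty\}$; let $g$ be a given measurable $S$-valued function. The notation $1\le j\le^* N$ means $1\le j\le N$ if $N<\infty$, and $1\le j<\infty$ if $N=\infty$. The RDE is $$X\overset{d}{=} g(\xi;(X_j:1\le j\le^* N)),$$ where $(X_j)_{j\ge1}$ are i.i.d. with the same law as $X$ and independent of $(\xi,N)$. The induced operator $T:\mathcal P\to\mathcal P(S)$, defined on some $\mathcal P\subseteq\mathcal P(S)$, sends $\mu\in\mathcal P$ to the law of $g(\xi;(X_j:1\le j\le^* N))$ when $(X_j)_{j\ge1}$ are i.i.d. with law $\mu$ and independent of $(\xi,N)$. A solution of the RDE is a $\mu\in\mathcal P$ with $T(\mu)=\mu$. Recursive tree process. Let $\mathcal V=\{\emptyset\}\cup\bigcup_{d\ge1}\mathbb N^d$ (finite words over $\mathbb N=\{1,2,\dots\}$), with $|\mathbf i|$ the length of the word $\mathbf i$, and $\mathbf i j$ the word obtained by appending $j$ to $\mathbf i$ ($\emptyset j=j$). Let $(\xi_{\mathbf i},N_{\mathbf i})_{\mathbf i\in\mathcal V}$ be i.i.d. copies of $(\xi,N)$ (the innovation process). Given a solution $\mu$, an invariant RTP with marginal $\mu$ is a process $(X_{\mathbf i})_{\mathbf i\in\mathcal V}$ of $S$-valued random variables, defined jointly with the innovation process, such that: (i) $X_{\mathbf i}\sim\mu$ for all $\mathbf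 i\in\mathcal V$; (ii) for each $d\ge0$ the variables $(X_{\mathbf i})_{|\mathbf i|=d}$ are independent; (iii) $X_{\mathbf i}=g(\xi_{\mathbf i};(X_{\mathbf i j}:1\le j\le^* N_{\mathbf i}))$ almost surely for all $\mathbf i\in\mathcal V$; (iv) for each $d\ge0$ the family $(X_{\mathbf i})_{|\mathbf i|=d}$ is independent of $\{(\xi_{\mathbf i'},N_{\mathbf i'}):|\mathbf i'|<d\}$. Tail. Let $\mathcal H_n=\sigma(\{X_{\mathbf i}:|\mathbf i|\ge n\})$ and $\mathcal H=\bigcap_{n\ge0}\mathcal H_n$. The RTP has trivial tail if $\mathcal H$ is trivial, i.e. every event in $\mathcal H$ has probability $0$ or $1$. Bivariate operator. Let $\mathcal P^{(2)}$ be the set of probability measures on $S^2=S\times S$ with both marginals in $\mathcal P$. Define $T\otimes T:\mathcal P^{(2)}\to\mathcal P(S^2)$ by letting $(T\otimes T)(\mu^{(2)})$ be the joint law of $$\bigl(g(\xi;(X^{(1)}_j:1\le j\le^* N)),\ g(\eta;(X^{(2)}_j:1\le j\le^* M))\bigr),$$ where the pairs $(X^{(1)}_j,X^{(2)}_j)_{j\ge1}$ are i.i.d. with law $\mu^{(2)}$ on $S^2$, $(\xi,N)$ and $(\eta,M)$ are i.i.d. (both with the given law of the innovation pair), and the family of pairs $(X^{(1)}_j,X^{(2)}_j)_{j\ge 1}$ is independent of the innovations $(\xi,N),(\eta,M)$. An invariant RTP with marginal $\mu$ has the bivariate uniqueness property of the second kind if the product measure $\mu\otimes\mu$ is the unique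 fixed point of $T\otimes T$ having both marginals equal to $\mu$. *)

(* Defs.v *)
From HB Require Import structures.
From mathcomp Require Import all_boot all_order all_algebra finmap.
From mathcomp Require Import all_classical all_reals all_analysis giry.

Set Implicit Arguments.
Unset Strict Implicit.
Unset Printing Implicit Defensive.

Import Order.TTheory GRing.Theory Num.Theory.
Import numFieldNormedType.Exports.

Local Open Scope classical_set_scope.
Local Open Scope ring_scope.

Section polish.
Context (R : realType) (S : topologicalType).

Definition separable_space := exists2 D : set S, countable D & dense D.

Definition is_metric (dist : S -> S -> R) :=
  [/\ forall x y, 0 <= dist x y,
      forall x y, dist x y = 0 <-> x = y,
      forall x y, dist x y = dist y x &
      forall x y z, dist x z <= dist x y + dist y z].

Definition metric_induces_topology (dist : S -> S -> R) :=
  forall (x : S) (A : set S),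
    nbhs x A <-> exists2 e, 0 < e & [set y | dist x y < e] `<=` A.

Definition metric_complete (dist : S -> S -> R) :=
  forall u : nat -> S,
    (forall e : R, 0 < e -> exists N, forall m n,
       (N <= m)%N -> (N <= n)%N -> dist (u m) (u n) < e) ->
    exists l : S, u @ \oo --> l.

Definition polish_space :=
  separable_space /\
  exists dist, [/\ is_metric dist, metric_induces_topology dist &
                   metric_complete dist].

End polish.

Notation borel S := (g_sigma_algebraType (@open S)).

(* [None] stands for the value oo *)
Definition enat := option nat.
HB.instance Definition _ := Pointed.on enat.
HB.instance Definition _ := @isMeasurable.Build default_measure_display
  enat discrete_measurable discrete_measurable0
  discrete_measurableC discrete_measurableU.

(* The index set {j : 1 <= j <=* N}, where j >= 1 is represented by j - 1. *)
Definition child_index (n : enat) : Type := if n is Some m then 'I_m else nat.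

Definition child_rank (n : enat) : child_index n -> nat :=
  match n with Some m => @nat_of_ord m | None => id end.

(* The disjoint union of the powers S^n, 0 <= n <= oo, with the sigma-algebra
   whose trace on each S^n is the product sigma-algebra. *)
Definition families (S : Type) : Type := {n : enat & child_index n -> S}.

Definition families_display : measure_display -> measure_display.
Proof. exact. Qed.

Section families.
Context d (S : measurableType d).

Definition product_sigma_algebra (I : Type) : set_system (I -> S) :=
  <<s \bigcup_(i in [set: I])
        preimage_set_system setT (fun x : I -> S => x i) measurable >>.

Definition families_measurable : set_system (families S) :=
  [set A | forall n : enat, @product_sigma_algebra (child_index n)
     [set x | A (existT (fun n => child_index n -> S) n x)]].

Let families_measurable0 : families_measurable set0.
Proof. by move=> n; exact: sigma_algebra0. Qed.

Let families_measurableC A :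
  families_measurable A -> families_measurable (~` A).
Proof. by move=> mA n; apply: sigma_algebraC; exact: mA. Qed.

Let families_measurable_bigcup (F : (set (families S))^nat) :
  (forall i, families_measurable (F i)) ->
  families_measurable (\bigcup_i F i).
Proof.
by move=> mF n; rewrite -preimage_bigcup;
  apply: sigma_algebra_bigcup => i; exact: mF.
Qed.

HB.instance Definition _ := gen_eqMixin (families S).
HB.instance Definition _ := gen_choiceMixin (families S).
HB.instance Definition _ := isPointed.Build (families S)
  (existT (fun n => child_index n -> S) None (fun=> point)).
HB.instance Definition _ := @isMeasurable.Build (families_display d)
  (families S) families_measurable families_measurable0 families_measurableC
  families_measurable_bigcup.

End families.

(* (x_j : 1 <= j <=* n) *)
Definition family_upto (S : Type) (n : enat) (x : nat -> S) : families S :=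
  existT (fun n => child_index n -> S) n (fun j => x (child_rank j)).

Section independence.
Context d (Omega : measurableType d) (R : realType) (P : probability Omega R).

Definition has_law d' (T : measurableType d') (X : Omega -> T)
    (nu : set T -> \bar R) : Prop :=
  forall A, measurable A -> P (X @^-1` A) = nu A.

(* sigma(X i : i in D) *)
Definition sigma_of I d' (T : measurableType d') (D : set I)
    (X : I -> Omega -> T) : set_system Omega :=
  <<s \bigcup_(i in D) preimage_set_system setT (X i) measurable >>.

Definition indep_sigma (F G : set_system Omega) :=
  forall A B, F A -> G B -> P (A `&` B) = (P A * P B)%E.

Definition mutually_indep (I : choiceType) d' (T : measurableType d')
    (D : set I) (X : I -> Omega -> T) :=
  forall (J : {fset I}) (B : I -> set T), [set` J] `<=` D ->
    (forall i, measurable (B i)) ->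
    P (\bigcap_(i in [set` J]) X i @^-1` B i) =
    (\prod_(i <- J) P (X i @^-1` B i))%E.

End independence.

Section rde.
Context (R : realType) (S : ptopologicalType).
Context dT (Theta : measurableType dT).
(* the law of the pair (xi, N) *)
Variable rho : probability (Theta * enat)%type R.
Variable g : {mfun (Theta * families (borel S))%type >-> borel S}.

(* g (xi; (x_j : 1 <= j <=* N)) *)
Definition rde_map (i : Theta * enat) (x : nat -> borel S) : borel S :=
  g (i.1, family_upto i.2 x).

Definition rde_image (mu nu : probability (borel S) R) : Prop :=
  exists d (Omega : measurableType d) (P : probability Omega R)
    (I : {RV P >-> (Theta * enat)%type}) (X : nat -> {RV P >-> borel S}),
  [/\ has_law P I rho,
      forall j, has_law P (X j) mu,
      mutually_indep P setT X,
      indep_sigma P (sigma_of setT X) (sigma_of setT (fun _ : unit => I)) &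
      has_law P (fun w => rde_map (I w) (X^~ w)) nu].

(* Any mu has an image, unique on measurable sets: i.i.d. sequences with law mu
   exist. The default value of [get] is thus never used. *)
Definition rde_op (mu : probability (borel S) R) : probability (borel S) R :=
  get (rde_image mu).

(* [≡μ] is equality on measurable sets: a measure is otherwise an arbitrary
   function on the non-measurable sets. *)
Definition rde_solution (mu : probability (borel S) R) := rde_op mu ≡μ mu.

Definition rde_image2 (mu2 nu2 : probability (borel S * borel S)%type R) :=
  exists d (Omega : measurableType d) (P : probability Omega R)
    (I : bool -> {RV P >-> (Theta * enat)%type})
    (X : nat -> {RV P >-> (borel S * borel S)%type}),
  [/\ (forall b, has_law P (I b) rho) /\ mutually_indep P setT I,
      forall j, has_law P (X j) mu2,
      mutually_indep P setT X,
      indep_sigma P (sigma_of setT X) (sigma_of setT I) &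
      has_law P (fun w => (rde_map (I false w) (fun j => (X j w).1),
                           rde_map (I true w) (fun j => (X j w).2))) nu2].

(* T (x) T; same remark as for [rde_op] *)
Definition rde_op2 (mu2 : probability (borel S * borel S)%type R) :
    probability (borel S * borel S)%type R :=
  get (rde_image2 mu2).

Definition both_marginals (mu : probability (borel S) R)
    (nu : probability (borel S * borel S)%type R) :=
  has_law nu fst mu /\ has_law nu snd mu.

Definition bivariate_uniqueness2 (mu : probability (borel S) R) :=
  rde_op2 (mu \x mu)%E ≡μ (mu \x mu)%E /\
  forall nu, both_marginals mu nu -> rde_op2 nu ≡μ nu -> nu ≡μ (mu \x mu)%E.

Definition weak_cvg2 (nu_ : nat -> probability (borel S * borel S)%type R)
    (nu : probability (borel S * borel S)%type R) :=
  forall f : S * S -> R, continuous f -> bounded_fun f ->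
    \int[nu_ n]_z f z @[n --> \oo] --> \int[nu]_z f z.

(* The weak topology on the laws on a Polish space is metrizable: sequences
   suffice. *)
Definition rde_op2_continuous (mu : probability (borel S) R) :=
  forall nu_ nu, (forall n, both_marginals mu (nu_ n)) ->
    both_marginals mu nu ->
    weak_cvg2 nu_ nu -> weak_cvg2 (fun n => rde_op2 (nu_ n)) (rde_op2 nu).

Definition diag (x : borel S) : borel S * borel S := (x, x).

Let measurable_diag : measurable_fun setT diag.
Proof. by apply: measurable_fun_pair; exact: measurable_id. Qed.

HB.instance Definition _ := isMeasurableFun.Build _ _ _ _ diag measurable_diag.

Definition diag_law (mu : probability (borel S) R) :
    probability (borel S * borel S)%type R :=
  distribution mu diag.

(* Vertices of the tree are words over nat, the letter j >= 1 being represented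
   by j - 1. *)
Record invariant_rtp (mu : probability (borel S) R)
    d (Omega : measurableType d) (P : probability Omega R)
    (I : seq nat -> {RV P >-> (Theta * enat)%type})
    (X : seq nat -> {RV P >-> borel S}) : Prop := {
  innovation_law : forall i, has_law P (I i) rho ;
  innovation_indep : mutually_indep P setT I ;
  rtp_law : forall i, has_law P (X i) mu ;
  rtp_indep : forall n, mutually_indep P [set i | size i = n] X ;
  rtp_rec : forall i,
    {ae P, forall w, X i w = rde_map (I i w) (fun j => X (rcons i j) w)} ;
  rtp_indep_innovation : forall n,
    indep_sigma P (sigma_of [set i | size i = n] X)
                  (sigma_of [set i | (size i < n)%N] I)
}.

End rde.

Definition tail_sigma d (Omega : measurableType d) dS (S : measurableType dS)
    (X : seq nat -> Omega -> S) : set_system Omega :=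
  \bigcap_(n in [set: nat]) sigma_of [set i | (n <= size i)%N] X.

Definition trivial_tail d (Omega : measurableType d) (R : realType)
    (P : probability Omega R) dS (S : measurableType dS)
    (X : seq nat -> Omega -> S) :=
  forall A, tail_sigma X A -> P A = 0%E \/ P A = 1%E.

(* Main.v *)
Require Import Defs.
From HB Require Import structures.
From mathcomp Require Import all_boot all_order all_algebra finmap.
From mathcomp Require Import all_classical all_reals all_analysis giry measurable_realfun.
From mathcomp Require Import ring lra zify.

Set Implicit Arguments.
Unset Strict Implicit.
Unset Printing Implicit Defensive.

Import Order.TTheory GRing.Theory Num.Theory.
Import numFieldNormedType.Exports.

Local Open Scope classical_set_scope.
Local Open Scope ring_scope.

(** Let [phi n A x] be the probability that the root of the tree lies in [A]
    when generation [n] has the values [x] and the innovations above it are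
    drawn at random: along the recursive tree process this is the conditional
    probability of the event [X [::] \in A] given the generations from [n] on.
    Starting from a coupling [nu] of [mu] with itself, [n] steps of T (x) T give
    the rectangle [A `*` C] the mean of [phi n A (fst \o x) * phi n C (snd \o
    x)] over i.i.d. pairs [x] with law [nu], since the two trees use independent
    innovations ([iter_rde_op2E]). Everything thus depends on how far [phi n A]
    is from its mean, the number [mu A]. Its second moment [energy A n]
    decreases with [n] and is the mass of [A `*` A] after [n] steps from the
    diagonal law ([energy_diag]); it tends to [mu A ^+ 2] if and only if [phi n
    A] tends to [mu A] in mean.

    The tail is trivial if and only if this holds for all [A]. In one direction
    ([trivial_tail_energy]), the energies converge, so [phi n A] is Cauchy in
    mean square; along a fast subsequence the event that it exceeds [mu A +
    delta] infinitely often is in the tail, and conditioning on it shows that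
    its probability is 0; a variable that hardly ever exceeds its mean is close
    to it. In the other ([energy_trivial_tail]), the root of any subtree is
    independent of a tail event C, hence so are all vertices of one generation
    and, with the innovations before it, the whole process, of which C is a
    function: C is independent of itself.

    This gives (a): from any coupling, the mass of a rectangle after [n] steps
    differs from the product by at most the mean of [`|phi n A - mu A|]
    ([iter_rde_op2_product_bound]), so a fixed point is the product, which is
    one in any case ([rde_op2_product]). For (c), it remains to see that weak
    convergence is convergence on rectangles as soon as both marginals are
    prescribed ([weak_cvg_rectangle], [rectangle_weak_cvg]): measurable sets of
    a Polish space are approximated by continuous functions in the mean of [mu],
    and countably many open rectangles form a base.

    For (b), the iterates from the diagonal law converge on rectangles, because
    [phi n A] converges in mean; the limit is a coupling by tightness of [mu]
    ([coupling_limit]). Continuity makes it a fixed point of T (x) T, uniqueness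
    makes it the product, and the energies tend to [mu A ^+ 2]. *)

(** * Families, laws and independence *)

Lemma measurable_preimage d1 d2 (T1 : measurableType d1)
    (T2 : measurableType d2) (f : T1 -> T2) (A : set T2) :
  measurable_fun setT f -> measurable A -> measurable (f @^-1` A).
Proof. by move=> mf mA; rewrite -[X in measurable X]setTI; exact: mf. Qed.

(** The function type under another name, to carry the product sigma-algebra. *)
Definition fam (I T : Type) := I -> T.

Definition fam_display : measure_display -> measure_display.
Proof. exact. Qed.

Section fam_measurable.
Context (I : Type) d (T : measurableType d).

Let gens : set_system (I -> T) := \bigcup_(i in [set: I])
  preimage_set_system setT (fun x : I -> T => x i) measurable.

HB.instance Definition _ := gen_eqMixin (fam I T).
HB.instance Definition _ := gen_choiceMixin (fam I T).
HB.instance Definition _ := isPointed.Build (fam I T) (fun=> point).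
HB.instance Definition _ := @isMeasurable.Build (fam_display d)
  (fam I T) (@product_sigma_algebra d T I) (@sigma_algebra0 _ setT gens)
  (@sigma_algebraC _ gens) (@sigma_algebra_bigcup _ setT gens).

Lemma measurable_coord (i : I) : measurable_fun setT (fun x : fam I T => x i).
Proof.
move=> _ A mA; rewrite setTI; apply: sub_sigma_algebra.
by exists i => //; exists A => //; rewrite setTI.
Qed.

Lemma measurable_fam d' (U : measurableType d') (f : U -> fam I T) :
  (forall i, measurable_fun setT (fun u => f u i)) -> measurable_fun setT f.
Proof.
move=> mf; apply: (measurability (gens : set (set (fam I T)))) => //.
move=> _ [_ [i _ [B mB <-]] <-]; rewrite !setTI.
exact: (measurable_preimage (mf i) mB).
Qed.

End fam_measurable.

Definition pi_generates d (T : measurableType d) (G : set_system T) :=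
  [/\ measurable = <<s G >>, setI_closed G & G setT].

Section cylinders.
Context (I : choiceType) d (T : measurableType d).

Definition cyl (J : {fset I}) (B : I -> set T) : set (fam I T) :=
  \bigcap_(i in [set` J]) [set x | B i (x i)].

Definition cylinders : set_system (fam I T) :=
  [set A | exists J B, (forall i, measurable (B i)) /\ A = cyl J B].

Lemma measurable_cyl J B : (forall i, measurable (B i)) -> measurable (cyl J B).
Proof.
move=> mB; apply: fin_bigcap_measurable => [|i _]; first exact: finite_fset.
by have := measurable_coord i measurableT (mB i); rewrite setTI.
Qed.

Lemma cylinders_generate : measurable = <<s cylinders >>.
Proof.
apply/seteqP; split.
  apply: smallest_sub; first exact: smallest_sigma_algebra.
  move=> _ [i _ [B mB <-]]; rewrite setTI; apply: sub_sigma_algebra.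
  exists [fset i]%fset, (fun=> B); split=> //.
  apply/seteqP; split=> x; rewrite /cyl /=.
    by move=> Bx j /=; rewrite inE => /eqP ->.
  by move=> /(_ i); apply; rewrite /= inE.
apply: smallest_sub; first exact: sigma_algebra_measurable.
by move=> _ [J [B [mB ->]]]; exact: measurable_cyl.
Qed.

Lemma cylinders_setI : setI_closed cylinders.
Proof.
move=> _ _ [J [B [mB ->]]] [K [C [mC ->]]].
exists (J `|` K)%fset, (fun i => (if i \in J then B i else setT) `&`
  (if i \in K then C i else setT)); split.
  by move=> i; apply: measurableI; case: ifP.
apply/seteqP; split=> [x [xB xC] i /=|x xBC].
  rewrite inE => iJK; split; case: ifPn => // ij; [exact: xB|exact: xC].
split=> i /= iJ; have [] := xBC i; rewrite /= ?inE ?iJ ?orbT//.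
Qed.

Lemma cylinders_setT : cylinders setT.
Proof.
by exists fset0, (fun=> setT); split=> //; apply/seteqP; split=> x // _ i.
Qed.

Lemma cylinders_pi : pi_generates cylinders.
Proof.
by split; [exact: cylinders_generate|exact: cylinders_setI|exact: cylinders_setT].
Qed.

End cylinders.

Section prob_unique.
Context (R : realType) d (T : measurableType d).

Lemma finite_measure_unique (G : set_system T) (m1 m2 : {measure set T -> \bar R}) :
  pi_generates G ->
  (m1 setT < +oo)%E -> (forall A, G A -> m1 A = m2 A) ->
  forall A, measurable A -> m1 A = m2 A.
Proof.
move=> [mG GI GT] m1T m12 A mA.
apply: (@measure_unique _ _ _ G (fun=> setT)) => //.
by apply/seteqP; split=> // x _; exists 0%N.
Qed.

End prob_unique.

Section laws.
Context (R : realType).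

Definition same_law d1 (O1 : measurableType d1) d2 (O2 : measurableType d2)
  d (T : measurableType d) (P1 : probability O1 R) (f1 : O1 -> T)
  (P2 : probability O2 R) (f2 : O2 -> T) :=
  forall A, measurable A -> P1 (f1 @^-1` A) = P2 (f2 @^-1` A).

Definition indep2 d0 (O : measurableType d0) (P : probability O R)
    d1 (T1 : measurableType d1) d2 (T2 : measurableType d2)
    (f : O -> T1) (g : O -> T2) :=
  forall A B, measurable A -> measurable B ->
  P (f @^-1` A `&` g @^-1` B) = (P (f @^-1` A) * P (g @^-1` B))%E.

Section law_unique.
Context d1 (O1 : measurableType d1) d2 (O2 : measurableType d2)
  d (T : measurableType d) (P1 : probability O1 R) (f1 : O1 -> T)
  (P2 : probability O2 R) (f2 : O2 -> T).
Hypotheses (mf1 : measurable_fun setT f1) (mf2 : measurable_fun setT f2).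

Lemma same_law_generated (G : set_system T) :
  pi_generates G ->
  (forall A, G A -> P1 (f1 @^-1` A) = P2 (f2 @^-1` A)) -> same_law P1 f1 P2 f2.
Proof.
move=> mG H A mA.
apply: (@finite_measure_unique _ _ _ G (pushforward P1 f1)
  (pushforward P2 f2)) => //.
by rewrite /= /pushforward preimage_setT probability_setT ltry.
Qed.
End law_unique.

(** Both sides are finite measures in [A], hence equal as soon as they agree on a
    pi-system. Independence of sigma-algebras follows by fixing one event at a
    time. *)
Lemma indep_set_generated d0 (O : measurableType d0) (P : probability O R)
    d (T : measurableType d) (f : O -> T) (G : set_system T) (C : set O) :
  measurable_fun setT f -> measurable C ->
  pi_generates G ->
  (forall A, G A -> P (C `&` f @^-1` A) = (P C * P (f @^-1` A))%E) ->
  forall A, measurable A -> P (C `&` f @^-1` A) = (P C * P (f @^-1` A))%E.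
Proof.
move=> mf mC mG H A mA.
have PC : fine (P C) >= 0 by exact: fine_ge0.
have PCfin : P C \is a fin_num by exact: fin_num_measure.
have := @finite_measure_unique _ _ _ G
  (pushforward (mrestr P mC) f)
  (mscale (NngNum PC) (pushforward P f)) mG.
rewrite /= /pushforward /mrestr /mscale /= fineK// preimage_setT setTI.
rewrite setIC => ->//.
  by rewrite (le_lt_trans (probability_le1 _ _))// ltry.
by move=> D GD; rewrite setIC H.
Qed.

Section indep2_theory.
Context d0 (O : measurableType d0) (P : probability O R)
    d1 (T1 : measurableType d1) d2 (T2 : measurableType d2)
    (f : O -> T1) (g : O -> T2).

Lemma indep2_ext f' g' : indep2 P f g -> f =1 f' -> g =1 g' -> indep2 P f' g'.
Proof. by move=> fg /funext <- /funext <-. Qed.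

Lemma indep2_comp d1' (U1 : measurableType d1') d2' (U2 : measurableType d2')
  (u : T1 -> U1) (v : T2 -> U2) :
  measurable_fun setT u -> measurable_fun setT v ->
  indep2 P f g -> indep2 P (u \o f) (v \o g).
Proof.
move=> mu mv fg A B mA mB.
by apply: (fg (u @^-1` A) (v @^-1` B)); exact: measurable_preimage.
Qed.

Lemma indep2_generated_l (G : set_system T1) :
  measurable_fun setT f -> measurable_fun setT g ->
  pi_generates G ->
  (forall A B, G A -> measurable B ->
    P (f @^-1` A `&` g @^-1` B) = (P (f @^-1` A) * P (g @^-1` B))%E) ->
  indep2 P f g.
Proof.
move=> mf mg mG H A B mA mB.
rewrite setIC muleC; apply: (indep_set_generated mf _ mG) => //.
  exact: measurable_preimage.
by move=> C GC; rewrite setIC muleC; exact: H.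
Qed.

End indep2_theory.

End laws.

Section families_laws.
Context (R : realType) (I : choiceType) d (T : measurableType d).

(** The values outside of [D] are replaced by a default point, so that the
    restrictions of a family to the various index sets have the same type. *)
Definition mask (D : set I) (x : fam I T) : fam I T :=
  fun i => if i \in D then x i else point.

Lemma measurable_mask D : measurable_fun setT (mask D).
Proof.
apply: measurable_fam => i; rewrite /mask; case: (i \in D).
  exact: measurable_coord.
exact: measurable_cst.
Qed.

Lemma mask_mask D E x : D `<=` E -> mask D (mask E x) = mask D x.
Proof.
move=> DE; apply/funext => i; rewrite /mask; case: ifPn => // /set_mem Di.
by rewrite mem_set//; exact: DE.
Qed.

Lemma mask_setT O (f : O -> fam I T) : mask setT \o f = f.
Proof. by apply/funext => w; apply/funext => i; rewrite /= /mask in_setT. Qed.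

Definition tuple_of (O : Type) (X : I -> O -> T) (w : O) : fam I T :=
  fun i => X i w.

Section one_space.
Context d0 (O : measurableType d0) (P : probability O R) (X : I -> O -> T).
Hypothesis mX : forall i, measurable_fun setT (X i).

Lemma measurable_tuple_of : measurable_fun setT (tuple_of X).
Proof. exact: measurable_fam. Qed.

Lemma measurable_mask_tuple D : measurable_fun setT (mask D \o tuple_of X).
Proof.
apply: measurableT_comp; [exact: measurable_mask|exact: measurable_tuple_of].
Qed.

(** The sigma-algebra of a subfamily is that of one random element, so that its
    events are preimages. *)
Lemma sigma_of_mask D : sigma_of D X =
  preimage_set_system setT (mask D \o tuple_of X) measurable.
Proof.
apply/seteqP; split.
  apply: smallest_sub.
    split.
    - by exists set0 => //; rewrite preimage_set0 setI0.
    - move=> _ [A mA <-]; exists (~` A); first exact: measurableC.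
      by rewrite !setTI setTD preimage_setC.
    - move=> F mF.
      have /choice[B HB] : forall n, exists A, measurable A /\
          F n = (mask D \o tuple_of X) @^-1` A.
        by move=> n; have [A mA <-] := mF n; exists A; rewrite setTI.
      exists (\bigcup_n B n).
        by apply: bigcupT_measurable => n; have [] := HB n.
      rewrite setTI preimage_bigcup; apply: eq_bigcupr => n _.
      by have [_ ->] := HB n.
  move=> _ [i Di [A mA <-]].
  exists ((fun x : fam I T => x i) @^-1` A).
    exact: (measurable_preimage (measurable_coord i) mA).
  by rewrite !setTI; apply/seteqP; split => w; rewrite /= /mask mem_set.
pose TO := g_sigma_algebraType (\bigcup_(i in D)
  preimage_set_system setT (X i) measurable).
have mm : measurable_fun (setT : set TO) (mask D \o tuple_of X).
  apply: measurable_fam => i; rewrite /comp /mask.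
  have [iD|iD] := boolP (i \in D); last exact: measurable_cst.
  move=> _ A mA; rewrite setTI; apply: sub_sigma_algebra.
  by exists i; [exact/set_mem|exists A => //; rewrite setTI].
move=> _ [A mA <-]; exact: (mm measurableT A mA).
Qed.

Lemma mutually_indep_sub D E : D `<=` E ->
  mutually_indep P E X -> mutually_indep P D X.
Proof. by move=> DE H J B JD; apply: H; exact: subset_trans JD DE. Qed.

Lemma mutually_indep_reindex (I' : choiceType) (h : I' -> I) (h' : I -> I') D :
  cancel h h' -> mutually_indep P D X ->
  mutually_indep P (h @^-1` D) (fun i => X (h i)).
Proof.
move=> hK H J B JD mB.
have hJD : [set` [fset h i | i in J]%fset] `<=` D.
  by move=> _ /= /imfsetP[j /= jJ ->]; exact: JD.
have := H [fset h i | i in J]%fset (fun i => B (h' i)) hJD (fun i => mB (h' i)).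
rewrite big_imfset/=; last by move=> x y _ _; exact: (can_inj hK).
under eq_bigr do rewrite hK.
move=> <-; congr (P _); apply/seteqP; split => w Hw i /=.
  by move=> /imfsetP[j /= jJ ->]; rewrite hK; exact: Hw.
by move=> iJ; have /= := Hw (h i); rewrite hK; apply; exact: in_imfset.
Qed.

Lemma mutually_indep_comp d' (U : measurableType d') (u : T -> U) D :
  measurable_fun setT u -> mutually_indep P D X ->
  mutually_indep P D (fun i => u \o X i).
Proof.
move=> mu H J B JD mB.
exact: (H J (fun i => u @^-1` B i) JD (fun i => measurable_preimage mu (mB i))).
Qed.

End one_space.

(** The constraints on masked coordinates either hold for the default point or
    exclude everything. *)
Lemma mask_cyl D J B :
  mask D @^-1` cyl J B = set0 \/
  mask D @^-1` cyl J B =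
    cyl [fset i in J | i \in D]%fset B :> set (fam I T).
Proof.
have [al|] := pselect (forall i, i \in J -> i \notin D -> B i point).
  right; apply/seteqP; split => x Hx i /=.
    rewrite !inE => /andP[iJ iD]; have := Hx i iJ.
    by rewrite /= /mask iD.
  move=> iJ; rewrite /mask; case: ifPn => [iD|/al]; last exact.
  by apply: (Hx i); rewrite /= !inE iJ.
move=> /existsNP[i /not_implyP[iJ /not_implyP[iD nB]]].
left; apply/seteqP; split => // x /(_ i iJ) /=.
by rewrite /mask (negbTE iD).
Qed.

Section two_families.
Context d1 (O1 : measurableType d1) d2 (O2 : measurableType d2)
  (P1 : probability O1 R) (X1 : I -> O1 -> T)
  (P2 : probability O2 R) (X2 : I -> O2 -> T).
Hypotheses (m1 : forall i, measurable_fun setT (X1 i))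
  (m2 : forall i, measurable_fun setT (X2 i)).

Lemma same_law_masks D :
  mutually_indep P1 D X1 -> mutually_indep P2 D X2 ->
  (forall i, D i -> same_law P1 (X1 i) P2 (X2 i)) ->
  same_law P1 (mask D \o tuple_of X1) P2 (mask D \o tuple_of X2).
Proof.
move=> i1 i2 e; apply: (same_law_generated _ _ (@cylinders_pi I d T)).
- exact: measurable_mask_tuple.
- exact: measurable_mask_tuple.
move=> _ [J [B [mB ->]]]; rewrite !comp_preimage.
have [->|->] := mask_cyl D J B; first by rewrite !preimage_set0 !measure0.
set K := [fset i in J | i \in D]%fset.
have KD : [set` K] `<=` D by move=> i /=; rewrite !inE => /andP[_ /set_mem].
rewrite /cyl !preimage_bigcap (i1 K B KD mB) (i2 K B KD mB).
by apply: eq_big_seq => i iK; apply: e => //; exact: KD.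
Qed.

Lemma same_law_tuple :
  mutually_indep P1 setT X1 -> mutually_indep P2 setT X2 ->
  (forall i, same_law P1 (X1 i) P2 (X2 i)) ->
  same_law P1 (tuple_of X1) P2 (tuple_of X2).
Proof.
move=> i1 i2 e A mA; have := same_law_masks i1 i2 (fun i _ => e i) mA.
by rewrite !mask_setT.
Qed.

End two_families.

End families_laws.

Section product_rectangles.
Context d1 (T1 : measurableType d1) d2 (T2 : measurableType d2).

Definition rectangles : set_system (T1 * T2) :=
  [set A `*` B | A in measurable & B in measurable].

Lemma rectangles_setI : setI_closed rectangles.
Proof.
move=> _ _ [A mA [B mB <-]] [C mC [D mD <-]]; rewrite -setXI.
by exists (A `&` C); [exact: measurableI|exists (B `&` D) => //; exact: measurableI].
Qed.

Lemma rectangles_setT : rectangles setT.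
Proof. by exists setT => //; exists setT => //; rewrite setXTT. Qed.

Lemma rectangles_measurable E : rectangles E -> measurable E.
Proof. by move=> [A mA [B mB <-]]; exact: measurableX. Qed.

Lemma setXT_fst (A : set T1) : A `*` [set: T2] = fst @^-1` A.
Proof. by apply/seteqP; split => z //= []. Qed.

Lemma setTX_snd (A : set T2) : [set: T1] `*` A = snd @^-1` A.
Proof. by apply/seteqP; split => z //= []. Qed.

Lemma rectangles_pi : pi_generates rectangles.
Proof.
split; first exact: measurable_prod_measurableType.
  exact: rectangles_setI.
exact: rectangles_setT.
Qed.

End product_rectangles.

Section pairing.
Context (R : realType) d0 (O : measurableType d0) (P : probability O R)
  d1 (T1 : measurableType d1) d2 (T2 : measurableType d2)
  d3 (T3 : measurableType d3) (f : O -> T1) (g : O -> T2) (h : O -> T3).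
Hypotheses (mf : measurable_fun setT f) (mg : measurable_fun setT g)
  (mh : measurable_fun setT h).

Lemma indep2_generated (G1 : set_system T1) (G2 : set_system T2) :
  pi_generates G1 ->
  pi_generates G2 ->
  (forall A B, G1 A -> G2 B ->
    P (f @^-1` A `&` g @^-1` B) = (P (f @^-1` A) * P (g @^-1` B))%E) ->
  indep2 P f g.
Proof.
move=> m1 m2 H.
apply: (indep2_generated_l mf mg m1) => A B GA mB.
have mA : measurable A by have [-> _ _] := m1; exact: sub_sigma_algebra.
apply: (indep_set_generated mg _ m2) mB; first exact: measurable_preimage.
by move=> C; exact: H.
Qed.

Lemma indep2_pairA :
  indep2 P f (fun w => (g w, h w)) -> indep2 P g h ->
  indep2 P (fun w => (f w, g w)) h.
Proof.
move=> fgh gh.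
apply: (@indep2_generated_l _ _ _ _ _ _ _ _ _ _ (@rectangles _ T1 _ T2)).
- exact: measurable_fun_pair.
- exact: mh.
- exact: rectangles_pi.
move=> _ C [A mA [B mB <-]] mC.
have e1 : (fun w => (f w, g w)) @^-1` (A `*` B) `&` h @^-1` C =
    f @^-1` A `&` (fun w => (g w, h w)) @^-1` (B `*` C).
  by apply/seteqP; split => w /= [] => [[? ?] ?|? [? ?]].
have e2 : (fun w => (f w, g w)) @^-1` (A `*` B) =
    f @^-1` A `&` (fun w => (g w, h w)) @^-1` (B `*` setT).
  by apply/seteqP; split => w /= [] => [? ?|? [? ?]].
rewrite e1 e2 !fgh//; [|exact: measurableX|exact: measurableX].
have -> : (fun w => (g w, h w)) @^-1` (B `*` C) = g @^-1` B `&` h @^-1` C by [].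
rewrite gh// muleA; congr (_ * P _ * _)%E.
by apply/seteqP; split => w //= [].
Qed.

End pairing.

Section two_spaces.
Context (R : realType) d1 (O1 : measurableType d1) d2 (O2 : measurableType d2)
  (P1 : probability O1 R) (P2 : probability O2 R)
  d3 (T : measurableType d3) d4 (U : measurableType d4).

Lemma same_law_pair (f1 : O1 -> T) (g1 : O1 -> U) (f2 : O2 -> T) (g2 : O2 -> U) :
  measurable_fun setT f1 -> measurable_fun setT g1 ->
  measurable_fun setT f2 -> measurable_fun setT g2 ->
  indep2 P1 f1 g1 -> indep2 P2 f2 g2 ->
  same_law P1 f1 P2 f2 -> same_law P1 g1 P2 g2 ->
  same_law P1 (fun w => (f1 w, g1 w)) P2 (fun w => (f2 w, g2 w)).
Proof.
move=> mf1 mg1 mf2 mg2 i1 i2 ef eg.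
apply: (@same_law_generated _ _ _ _ _ _ _ _ _ _ _ _ _ (@rectangles _ T _ U)).
- exact: measurable_fun_pair.
- exact: measurable_fun_pair.
- exact: rectangles_pi.
move=> _ [A mA [B mB <-]].
have e (O : Type) (f : O -> T) (g : O -> U) :
  (fun w => (f w, g w)) @^-1` (A `*` B) = f @^-1` A `&` g @^-1` B by [].
by rewrite !e i1// i2// ef// eg.
Qed.

Lemma same_law_comp (f1 : O1 -> T) (f2 : O2 -> T) (u : T -> U) :
  measurable_fun setT u -> same_law P1 f1 P2 f2 ->
  same_law P1 (u \o f1) P2 (u \o f2).
Proof.
by move=> mu e A mA; apply: (e (u @^-1` A)); exact: measurable_preimage.
Qed.

End two_spaces.

Section product_space.
Context (R : realType) d1 (O1 : measurableType d1) d2 (O2 : measurableType d2)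
  (P1 : probability O1 R) (P2 : probability O2 R).
Local Notation PP := ((P1 \x P2)%E : probability (O1 * O2)%type R).

Lemma prod_probE A B : measurable A -> measurable B ->
  PP (A `*` B) = (P1 A * P2 B)%E.
Proof. by move=> mA mB; exact: product_measure1E. Qed.

Lemma same_law_fst d (T : measurableType d) (f : O1 -> T) :
  measurable_fun setT f -> same_law PP (f \o fst) P1 f.
Proof.
move=> mf A mA.
rewrite comp_preimage -setXT_fst.
by rewrite prod_probE ?probability_setT ?mule1//; exact: measurable_preimage.
Qed.

Lemma same_law_snd d (T : measurableType d) (f : O2 -> T) :
  measurable_fun setT f -> same_law PP (f \o snd) P2 f.
Proof.
move=> mf A mA.
rewrite comp_preimage -setTX_snd.
by rewrite prod_probE ?probability_setT ?mul1e//; exact: measurable_preimage.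
Qed.

Lemma indep2_fst_snd d (T : measurableType d) d' (U : measurableType d')
  (f : O1 -> T) (g : O2 -> U) :
  measurable_fun setT f -> measurable_fun setT g ->
  indep2 PP (f \o fst) (g \o snd).
Proof.
move=> mf mg A B mA mB.
rewrite (same_law_fst mf)// (same_law_snd mg)//.
by rewrite -prod_probE//; exact: measurable_preimage.
Qed.

Lemma indep2_prod d3 (T : measurableType d3) d4 (T' : measurableType d4)
  d5 (U : measurableType d5) d6 (U' : measurableType d6)
  (f : O1 -> T) (f' : O1 -> T') (g : O2 -> U) (g' : O2 -> U') :
  measurable_fun setT f -> measurable_fun setT g ->
  measurable_fun setT f' -> measurable_fun setT g' ->
  indep2 P1 f f' -> indep2 P2 g g' ->
  indep2 PP (fun w => (f w.1, g w.2)) (fun w => (f' w.1, g' w.2)).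
Proof.
move=> mf mg mf' mg' i1 i2.
have mm d (V : measurableType d) d' (V' : measurableType d') (u : O1 -> V)
    (v : O2 -> V') : measurable_fun setT u -> measurable_fun setT v ->
    measurable_fun setT (fun w : O1 * O2 => (u w.1, v w.2)).
  move=> mu mv; apply: measurable_fun_pair.
    by apply: measurableT_comp => //; exact: measurable_fst.
  by apply: measurableT_comp => //; exact: measurable_snd.
apply: (@indep2_generated _ _ _ _ _ _ _ _ _ _ _ _
  (@rectangles _ T _ U) (@rectangles _ T' _ U')).
- exact: mm.
- exact: mm.
- exact: rectangles_pi.
- exact: rectangles_pi.
move=> _ _ [A mA [B mB <-]] [A' mA' [B' mB' <-]].
have e V V' (u : O1 -> V) (v : O2 -> V') C D :
  (fun w => (u w.1, v w.2)) @^-1` (C `*` D) = (u @^-1` C) `*` (v @^-1` D) by [].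
rewrite !e -setXI.
rewrite prod_probE; [|by apply: measurableI; exact: measurable_preimage..].
rewrite i1// i2// prod_probE; [|exact: measurable_preimage..].
rewrite prod_probE; [|exact: measurable_preimage..].
by rewrite muleACA.
Qed.

Lemma indep2_snd d3 (T : measurableType d3) d4 (U : measurableType d4)
  (f : O2 -> T) (g : O2 -> U) :
  measurable_fun setT f -> measurable_fun setT g -> indep2 P2 f g ->
  indep2 PP (f \o snd) (g \o snd).
Proof.
move=> mf mg fg A B mA mB.
rewrite (same_law_snd mf)// (same_law_snd mg)// -fg//.
have mfg : measurable_fun setT (fun w => (f w, g w)) by exact: measurable_fun_pair.
exact: (same_law_snd mfg (measurableX mA mB)).
Qed.

End product_space.

Lemma same_law_prod (R : realType) d1 (O1 : measurableType d1)
  d2 (O2 : measurableType d2) (P1 : probability O1 R) (P2 : probability O2 R)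
  d1' (O1' : measurableType d1') d2' (O2' : measurableType d2')
  (P1' : probability O1' R) (P2' : probability O2' R)
  d3 (T : measurableType d3) d4 (U : measurableType d4)
  (f : O1 -> T) (g : O2 -> U) (f' : O1' -> T) (g' : O2' -> U) :
  measurable_fun setT f -> measurable_fun setT g ->
  measurable_fun setT f' -> measurable_fun setT g' ->
  same_law P1 f P1' f' -> same_law P2 g P2' g' ->
  same_law ((P1 \x P2)%E : probability (O1 * O2)%type R)
    (fun w => (f w.1, g w.2))
    ((P1' \x P2')%E : probability (O1' * O2')%type R)
    (fun w => (f' w.1, g' w.2)).
Proof.
move=> mf mg mf' mg' ef eg.
apply: (@same_law_pair _ _ _ _ _ _ _ _ _ _ _ (f \o fst) (g \o snd)
  (f' \o fst) (g' \o snd)).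
- exact: (measurableT_comp mf measurable_fst).
- exact: (measurableT_comp mg measurable_snd).
- exact: (measurableT_comp mf' measurable_fst).
- exact: (measurableT_comp mg' measurable_snd).
- exact: indep2_fst_snd.
- exact: indep2_fst_snd.
- by move=> A mA; rewrite !same_law_fst// ef.
- by move=> A mA; rewrite !same_law_snd// eg.
Qed.

Section blocks.
Context (R : realType) (V : Type) d0 (O : measurableType d0)
  (P : probability O R) d (U : measurableType d).
Variables (M : set V -> O -> U) (restr : set V -> U -> U).
Hypotheses (mM : forall D, measurable_fun setT (M D))
  (mrestr : forall D, measurable_fun setT (restr D))
  (M_restr : forall D E w, D `<=` E -> M D w = restr D (M E w))
  (M_indep : forall D E, D `&` E = set0 -> indep2 P (M D) (M E)).

(** [M D] stands for the part in [D] of a family of which disjoint parts are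
    independent. The other blocks are merged into one, so that independence of
    two disjoint parts suffices. *)
Lemma block_indep (J : choiceType) (E_ : J -> set V) d' (T : measurableType d')
  (u : J -> U -> T) : (forall j, measurable_fun setT (u j)) ->
  (forall i j, i != j -> E_ i `&` E_ j = set0) ->
  mutually_indep P setT (fun j => u j \o M (E_ j)).
Proof.
move=> mu tE K B _ mB.
suff H (s : seq J) : uniq s ->
    P (\bigcap_(i in [set` s]) (u i \o M (E_ i)) @^-1` B i) =
    (\prod_(i <- s) P ((u i \o M (E_ i)) @^-1` B i))%E.
  exact: (H K (fset_uniq K)).
elim: s => [_|j s IH /= /andP[js us]].
  by rewrite set_nil bigcap_set0 big_nil probability_setT.
rewrite big_cons -IH//.
set D := \bigcup_(i in [set` s]) E_ i.
have jD : E_ j `&` D = set0.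
  apply/seteqP; split => // x [xj [i /= iS xi]].
  have ij : j != i by apply: contra js => /eqP ->.
  by have : (E_ j `&` E_ i) x by []; rewrite tE.
pose C := \bigcap_(i in [set` s]) (u i \o restr (E_ i)) @^-1` B i.
have mC : measurable C.
  apply: fin_bigcap_measurable => [|i _]; first exact: finite_seq.
  apply: measurable_preimage (mB i).
  by apply: measurableT_comp.
have -> : \bigcap_(i in [set` s]) (u i \o M (E_ i)) @^-1` B i = M D @^-1` C.
  apply/seteqP; split => w Hw i /= iS; have := Hw i iS; rewrite /= -M_restr//.
    by exact: bigcup_sup.
  by exact: bigcup_sup.
have muj : measurable (u j @^-1` B j) by exact: measurable_preimage.
rewrite -(M_indep jD muj mC); congr (P _).
apply/seteqP; split => w.
  move=> Hw; split; first by apply: (Hw j); rewrite /= mem_head.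
  move=> i /= iS; rewrite -M_restr; last exact: bigcup_sup.
  by apply: (Hw i); rewrite /= in_cons iS orbT.
move=> [wj wC] i /=; rewrite in_cons => /orP[/eqP ->//|iS].
by have := wC i iS; rewrite /= -M_restr//; exact: bigcup_sup.
Qed.

End blocks.

(** * Extension of a limit of probability measures *)

Section pack.
Context d (O : measurableType d) d' (T : measurableType d') (f : O -> T)
  (mf : measurable_fun setT f).
Definition pack_fun (_ : measurable_fun setT f) : O -> T := f.
HB.instance Definition _ := isMeasurableFun.Build _ _ _ _ (pack_fun mf) mf.
(** The structure of measurable function that a proof of measurability provides. *)
Definition pack : {mfun O >-> T} := pack_fun mf.
End pack.

Section law.
Context (R : realType) d (O : measurableType d) d' (T : measurableType d')
  (P : probability O R) (f : O -> T) (mf : measurable_fun setT f).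

Definition law : probability T R := distribution P (pack mf).

Lemma lawE A : law A = P (f @^-1` A). Proof. by []. Qed.

End law.

Section prob_of_measure.
Context (R : realType) d (T : measurableType d).
Variables (m : {measure set T -> \bar R}) (m1 : m setT = 1%E).

Definition measure_copy (_ : m setT = 1%E) : set T -> \bar R := m.

HB.instance Definition _ := Measure.on (measure_copy m1).

HB.instance Definition _ :=
  Measure_isProbability.Build _ _ _ (measure_copy m1) m1.

Lemma prob_of_measure :
  exists P : probability T R, forall A, P A = m A.
Proof. by exists (measure_copy m1 : probability T R). Qed.

End prob_of_measure.

Record is_semiring (T : Type) (G : set_system T) : Prop := {
  semiring0 : G set0 ;
  semiringI : setI_closed G ;
  semiringD : semi_setD_closed G }.

(** The extension theorem for measures reads the semiring off the type: this copy
    of [T] carries the chosen one. *)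
Definition semiring_type (T : Type) (G : set_system T) (_ : is_semiring G) := T.

Definition semiring_display (T : Type) : set_system T -> measure_display.
Proof. exact. Qed.

Section semiring_instance.
Context (T : pointedType) (G : set_system T) (HG : is_semiring G).
HB.instance Definition _ := Pointed.on (semiring_type HG).
HB.instance Definition _ := @isSemiRingOfSets.Build (semiring_display G)
  (semiring_type HG) G (semiring0 HG) (semiringI HG) (semiringD HG).
End semiring_instance.

Section limit_extension.
Context (R : realType) d (T : measurableType d) (G : set_system T).
Hypotheses (HG : is_semiring G) (GT : G setT) (mG : measurable = <<s G >>).
Variables (Pn : nat -> probability T R) (p : set T -> \bar R).
Hypothesis (p_ge0 : forall A, (0 <= p A)%E).
Hypothesis p_lim : forall A, G A -> Pn n A @[n --> \oo] --> p A.
Hypothesis p_sub : forall A F, G A -> (forall n, G (F n)) ->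
  A `<=` \bigcup_n F n -> (p A <= \sum_(n <oo) p (F n))%E.

Definition content : set (semiring_type HG) -> \bar R := p.

Let G_measurable A : G A -> measurable A.
Proof. by rewrite mG => GA; exact: sub_sigma_algebra. Qed.

Let content_additive : measure_function.semi_additive content.
Proof.
move=> F n mF tF mU.
have h1 := p_lim mU.
have h2 : (\sum_(i < n) Pn k (F i))%E @[k --> \oo] --> (\sum_(i < n) p (F i))%E.
  by apply: cvg_nnesum => i _; [near=> k|exact/p_lim/mF].
rewrite /content; apply: (cvg_unique _ h1) => //.
apply: cvg_trans h2; apply: near_eq_cvg; near=> k.
rewrite measure_semi_additive//.
  by move=> i; exact/G_measurable/mF.
exact/G_measurable.
Unshelve. all: by end_near. Qed.

HB.instance Definition _ := isContent.Build _ _ _ content p_ge0 content_additive.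

Let content_sub : measurable_subset_sigma_subadditive content.
Proof. by move=> A F mF mA AF; exact: p_sub. Qed.

HB.instance Definition _ := Content_SigmaSubAdditive_isMeasure.Build _ _ _
  content content_sub.

Let ext := measure_extension content.

Let mid : measurable_fun setT
  (id : g_sigma_algebraType (@measurable _ (semiring_type HG)) -> T).
Proof. by move=> _ A; rewrite setTI mG. Qed.

Let extT : pushforward ext (id : _ -> T) setT = 1%E.
Proof.
rewrite /pushforward preimage_setT /ext /measure_extension.
rewrite (@measurable_mu_extE _ _ (semiring_type HG) content setT)//.
apply: (cvg_unique _ (p_lim GT)) => //.
rewrite (_ : (fun n => Pn n setT) = cst 1%E); first exact: cvg_cst.
by apply/funext => n; exact: probability_setT.
Qed.

(** A pointwise limit of probabilities is additive, so that countable
    subadditivity on a semiring is all that its extension requires. *)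
Lemma limit_extension : exists P : probability T R, forall A, G A -> P A = p A.
Proof.
pose m : {measure set T -> \bar R} := pushforward ext (id : _ -> T).
have [P HP] := @prob_of_measure _ _ _ (m mid) extT.
exists P => A GA; rewrite HP.
rewrite /m /= /pushforward /ext /measure_extension.
by rewrite (@measurable_mu_extE _ _ (semiring_type HG) content).
Qed.

End limit_extension.

(** * Infinite products of a probability measure *)

Lemma fset_nat_bound (J : {fset nat}) : exists n, forall i, i \in J -> (i < n)%N.
Proof.
suff [n Hn] : exists n, forall i, i \in (enum_fset J) -> (i < n)%N by exists n.
elim: (enum_fset J) => [|j s [n IH]]; first by exists 0%N.
exists (maxn j.+1 n) => i; rewrite inE leq_max => /predU1P[->|/IH ->].
  by rewrite ltnSn.
by rewrite orbT.
Qed.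

Section iid.
Context (R : realType) d (T : measurableType d) (nu : probability T R).
Local Notation Om := (fam nat T).

Definition scons (t : T) (x : Om) : Om := fun n => if n is m.+1 then x m else t.

Lemma measurable_scons : measurable_fun setT (fun z : T * Om => scons z.1 z.2).
Proof.
apply: measurable_fam => -[|n] /=; first exact: measurable_fst.
exact: (measurableT_comp (measurable_coord n) (@measurable_snd _ _ T Om)).
Qed.

(** [n] independent draws followed by a constant sequence. The laws for larger [n]
    agree on the sets that depend on [n] coordinates only ([iidn_stable]). *)
Fixpoint iidn (n : nat) : probability Om R :=
  if n is m.+1 then law (nu \x iidn m : probability (T * Om)%type R)%E
    measurable_scons
  else (\d_(point : Om) : probability Om R).

Definition sec (t : T) (A : set Om) : set Om := [set x | A (scons t x)].

Lemma measurable_sec t A : measurable A -> measurable (sec t A).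
Proof.
move=> mA; have h : measurable_fun setT (scons t).
  by apply: measurable_fam => -[|n] /=; [exact: measurable_cst|exact: measurable_coord].
exact: (measurable_preimage h mA).
Qed.

Lemma iidnS n A : iidn n.+1 A = (\int[nu]_t iidn n (sec t A))%E.
Proof.
rewrite -[LHS]/(product_measure1 nu (iidn n)
  ((fun z : T * Om => scons z.1 z.2) @^-1` A)) /product_measure1; apply: eq_integral => t _ /=.
by congr (iidn n _); apply/seteqP; split=> y; rewrite /xsection/= inE.
Qed.

Lemma measurable_iidn_sec n A : measurable A ->
  measurable_fun setT (fun t => iidn n (sec t A)).
Proof.
move=> mA.
have := measurable_fun_xsection (iidn n) (measurable_preimage measurable_scons mA).
apply: eq_measurable_fun => t _; congr (iidn n _).
by apply/seteqP; split=> y; rewrite /xsection/= inE.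
Qed.

Definition depends_below n (A : set Om) :=
  forall x y, (forall i, (i < n)%N -> x i = y i) -> A x -> A y.

Definition base_sets : set_system Om :=
  [set A | measurable A /\ exists n, depends_below n A].

Lemma depends_belowW n m A : (n <= m)%N -> depends_below n A -> depends_below m A.
Proof.
by move=> nm H x y xy; apply: H => i ni; apply: xy; exact: leq_trans nm.
Qed.

Lemma depends_below_sec n t A : depends_below n.+1 A -> depends_below n (sec t A).
Proof. by move=> H x y xy; apply: H => -[|i] //=; rewrite ltnS; exact: xy. Qed.

Lemma base_sec t A : base_sets A -> base_sets (sec t A).
Proof.
move=> [mA [n dA]]; split; first exact: measurable_sec.
by exists n; apply: depends_below_sec; exact: depends_belowW dA.
Qed.

Lemma iidn_stable n m A : measurable A -> depends_below n A -> (n <= m)%N ->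
  iidn m A = iidn n A.
Proof.
elim: n m A => [|n IH] m A mA dA.
  move=> _; have [->|/set0P[x Ax]] := eqVneq A set0; first by rewrite !measure0.
  have -> : A = setT by apply/seteqP; split => // y _; exact: dA Ax.
  by rewrite !probability_setT.
case: m => // m; rewrite ltnS => nm; rewrite !iidnS; apply: eq_integral => t _.
by apply: IH => //; [exact: measurable_sec|exact: depends_below_sec].
Qed.

(** The limit is only meant for the sets of [base_sets]; the value 0 makes the
    function nonnegative everywhere. *)
Definition iid_content (A : set Om) : \bar R :=
  if `[< cvg (iidn n A @[n --> \oo]) >] then limn (fun n => iidn n A) else 0%E.

Lemma iid_content_ge0 A : (0 <= iid_content A)%E.
Proof.
rewrite /iid_content; case: asboolP => // h.
by apply: lime_ge => //; near=> n.
Unshelve. all: by end_near. Qed.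

Lemma iid_content_cvg A : base_sets A -> iidn n A @[n --> \oo] --> iid_content A.
Proof.
move=> [mA [n dA]].
have h : iidn m A @[m --> \oo] --> iidn n A.
  apply: cvg_near_cst; near=> m.
  by apply: iidn_stable => //; near: m; exact: nbhs_infty_ge.
rewrite /iid_content asboolT; last by apply/cvg_ex; exists (iidn n A).
by apply/cvg_ex; exists (iidn n A).
Unshelve. all: by end_near. Qed.

Lemma iid_contentE n A : measurable A -> depends_below n A ->
  iid_content A = iidn n A.
Proof.
move=> mA dA; apply: (cvg_unique _ (iid_content_cvg _)) => //.
  by split => //; exists n.
apply: cvg_near_cst; near=> m.
by apply: iidn_stable => //; near: m; exact: nbhs_infty_ge.
Unshelve. all: by end_near. Qed.

Lemma iid_content_sec A : base_sets A ->
  iid_content A = (\int[nu]_t iid_content (sec t A))%E /\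
  measurable_fun setT (fun t => iid_content (sec t A)).
Proof.
move=> [mA [n dA]]; have dA' := depends_belowW (leqnSn n) dA.
have e t : iid_content (sec t A) = iidn n (sec t A).
  by apply: iid_contentE; [exact: measurable_sec|exact: depends_below_sec].
split; last by rewrite (funext e); exact: measurable_iidn_sec.
by rewrite (iid_contentE mA dA') iidnS; apply: eq_integral => t _.
Qed.

Lemma iid_content_le A B : base_sets A -> base_sets B -> A `<=` B ->
  (iid_content A <= iid_content B)%E.
Proof.
move=> [mA [n dA]] [mB [m dB]] AB.
rewrite (iid_contentE mA (depends_belowW (leq_maxl n m) dA)).
rewrite (iid_contentE mB (depends_belowW (leq_maxr n m) dB)).
by apply: le_measure; rewrite ?inE.
Qed.

Lemma iid_content_le1 A : base_sets A -> (iid_content A <= 1)%E.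
Proof.
by move=> [mA [n dA]]; rewrite (iid_contentE mA dA); exact: probability_le1.
Qed.

(** Continuity at the empty set of the content amounts to a point in the
    intersection of the [A k]. Its coordinates are chosen one by one, so that the
    sections at the chosen points stay big, with half of the bound each time. *)
Definition big_sections (e : R) (A : nat -> set Om) :=
  [/\ forall k, base_sets (A k), forall k, A k.+1 `<=` A k &
      forall k, (e%:E <= iid_content (A k))%E].

(** Otherwise the sets of the [t] at which the section of [A k] has content at
    least [e / 2] decrease to the empty set, while each of them has measure at
    least [e / 2]. *)
Lemma big_section_point e A : 0 < e -> big_sections e A ->
  exists t, big_sections (e / 2) (fun k => sec t (A k)).
Proof.
move=> e0 [bA dA eA].
suff [t Ht] : exists t, forall k, ((e / 2)%:E <= iid_content (sec t (A k)))%E.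
  exists t; split => // k; first exact: base_sec.
  by move=> x; exact: dA.
apply: contrapT => /forallNP H.
pose B k := [set t | (e / 2)%:E <= iid_content (sec t (A k))]%E.
have mB k : measurable (B k).
  have [_ mf] := iid_content_sec (bA k).
  rewrite -[B k]setTI; exact: emeasurable_fun_c_infty.
have BS k : B k.+1 `<=` B k.
  move=> t /= /le_trans; apply; apply: iid_content_le.
  - exact: base_sec.
  - exact: base_sec.
  - by move=> x; exact: dA.
have cB : nu (B k) @[k --> \oo] --> nu (\bigcap_k B k).
  apply: nonincreasing_cvg_mu => //.
  - by rewrite (le_lt_trans (probability_le1 _ _))// ltry.
  - exact: bigcapT_measurable.
  - by apply/nonincreasing_seqP => n; apply/subsetPset.
have B0 : \bigcap_k B k = set0.
  apply/seteqP; split => // t Bt; apply: (H t) => k; exact: (Bt k I).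
rewrite B0 measure0 in cB.
(* the content of a section is at most 1 on [B k] and at most [e / 2] off it *)
have lb k : ((e / 2)%:E <= nu (B k))%E.
  have [h mf] := iid_content_sec (bA k).
  have hB : (nu (B k) + (e / 2)%:E = \int[nu]_t ((\1_(B k) t)%:E + (e / 2)%:E))%E.
    rewrite ge0_integralD//; last 2 first.
    - exact/measurable_EFinP/measurable_indic.
    - by move=> x _; rewrite lee_fin ltW// divr_gt0.
    rewrite integral_indic// setIT integral_cst//.
    congr (_ + _)%E; rewrite -[LHS]mule1; congr (_ * _)%E.
    exact/esym/probability_setT.
  rewrite -(@leeD2rE _ (e / 2)%:E)// -EFinD -splitr.
  rewrite (le_trans (eA k))// h hB.
  apply: ge0_le_integral => //.
  - by move=> t _; exact: iid_content_ge0.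
  - apply: emeasurable_funD => //; exact/measurable_EFinP/measurable_indic.
  move=> t _; have [Bt|nBt] := pselect (B k t).
    rewrite indicE mem_set//=.
    rewrite (le_trans (iid_content_le1 (base_sec t (bA k))))//.
    by rewrite leeDl// lee_fin ltW// divr_gt0.
  rewrite indicE memNset// add0e ltW//.
  by move: nBt => /negP; rewrite -ltNge.
have : ((e / 2)%:E <= (0 : \bar R))%E.
  rewrite -(cvg_lim _ cB)//; apply: lime_ge; first by apply: cvgP cB.
  exact: nearW.
by rewrite lee_fin leNgt divr_gt0.
Qed.

Definition next_point (e : R) (A : nat -> set Om) : T :=
  xget point [set t | big_sections (e / 2) (fun k => sec t (A k))].

Lemma next_pointP e A : 0 < e -> big_sections e A ->
  big_sections (e / 2) (fun k => sec (next_point e A) (A k)).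
Proof.
by move=> e0 /(big_section_point e0)[t Ht]; rewrite /next_point; case: xgetP => // /(_ t).
Qed.

Section continuity_at_empty.
Variables (e : R) (A : nat -> set Om).
Hypotheses (e0 : 0 < e) (HA : big_sections e A).

Fixpoint sections n : nat -> set Om :=
  if n is m.+1 then
    fun k => sec (next_point (e / 2 ^+ m) (sections m)) (sections m k)
  else A.

Definition point_of n := next_point (e / 2 ^+ n) (sections n).

Lemma big_sections_sections n : big_sections (e / 2 ^+ n) (sections n).
Proof.
elim: n => [|n IH]; first by rewrite expr0 divr1.
have -> : e / 2 ^+ n.+1 = e / 2 ^+ n / 2 by rewrite exprS invfM mulrCA mulrC.
by apply: next_pointP => //; rewrite divr_gt0// exprn_gt0.
Qed.

Lemma sectionsE n k y : sections n k y <->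
  A k (fun i => if (i < n)%N then point_of i else y (i - n)%N).
Proof.
elim: n y => [|n IH] y /=.
  by rewrite (_ : (fun i => _) = y)//; apply/funext => i; rewrite subn0.
rewrite /sec /= IH -/(point_of n).
rewrite (_ : (fun i => _) = (fun i => if (i < n.+1)%N then point_of i
  else y (i - n.+1)%N))//.
apply/funext => i; rewrite ltnS; case: ltngtP => [//|ni|->].
  by rewrite -[(i - n)%N]prednK ?subn_gt0//= subnS.
by rewrite subnn.
Qed.

(** [A k] depends on finitely many coordinates, and its section at as many chosen
    points is not empty. *)
Lemma big_sections_nonempty : \bigcap_k A k !=set0.
Proof.
exists point_of => k _.
have [bA _ _] := HA.
have [mA [n dA]] := bA k.
have [_ _ /(_ k) H] := big_sections_sections n.
have /set0P[y] : sections n k != set0.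
  apply/eqP => E; move: H; rewrite E (@iid_contentE 0)//.
  by rewrite measure0 lee_fin leNgt divr_gt0// exprn_gt0.
rewrite sectionsE; by apply: dA => i ni; rewrite ni.
Qed.

End continuity_at_empty.

Lemma depends_below_setD n m A B : depends_below n A -> depends_below m B ->
  depends_below (maxn n m) (A `\` B).
Proof.
move=> dA dB x y xy [Ax Bx]; split.
  by apply: (depends_belowW (leq_maxl n m) dA) Ax.
move=> By; apply: Bx.
by apply: (depends_belowW (leq_maxr n m) dB) By => i im; exact/esym/xy.
Qed.

Lemma base_setsD A B : base_sets A -> base_sets B -> base_sets (A `\` B).
Proof.
move=> [mA [n dA]] [mB [m dB]]; split; first exact: measurableD.
by exists (maxn n m); exact: depends_below_setD.
Qed.

Lemma base_setsT : base_sets setT.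
Proof. by split => //; exists 0%N. Qed.

Lemma base_sets_semiring : is_semiring base_sets.
Proof.
split.
- by split => //; exists 0%N.
- move=> A B bA bB; rewrite -(setDD A B).
  by apply: base_setsD => //; exact: base_setsD.
- by apply: setD_semi_setD_closed; exact: base_setsD.
Qed.

Lemma base_sets_cyl J B : (forall i, measurable (B i)) -> base_sets (cyl J B).
Proof.
move=> mB; split; first exact: measurable_cyl.
have [n Jn] := fset_nat_bound J.
by exists n => x y xy Hx i /= iJ; rewrite -xy; [exact: Hx|exact: Jn].
Qed.

Lemma base_sets_generate : measurable = <<s base_sets >>.
Proof.
apply/seteqP; split; last first.
  by apply: smallest_sub; [exact: sigma_algebra_measurable|move=> A []].
rewrite [X in X `<=` _](@cylinders_generate nat d T); apply: sub_sigma_algebra2.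
by move=> _ [J [B [mB ->]]]; exact: base_sets_cyl.
Qed.

Lemma iid_content_split A B : base_sets A -> base_sets B ->
  (iid_content A <= iid_content B + iid_content (A `\` B))%E.
Proof.
move=> [mA [n dA]] [mB [m dB]].
have dA' := depends_belowW (leq_maxl n m) dA.
have dB' := depends_belowW (leq_maxr n m) dB.
have mAB : measurable (A `\` B) by exact: measurableD.
have dAB := depends_below_setD dA dB.
rewrite (iid_contentE mA dA') (iid_contentE mB dB') (iid_contentE mAB dAB).
rewrite (le_trans _ (measureU2 _ mB mAB))// le_measure ?inE//.
  exact: measurableU.
by move=> x Ax; have [Bx|Bx] := pselect (B x); [left|right].
Qed.

(** What remains of [A] without [F 0], ..., [F (n - 1)] decreases to the empty
    set, hence its content is small for some [n]. *)
Lemma iid_content_sub A F : base_sets A -> (forall n, base_sets (F n)) ->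
  A `<=` \bigcup_n F n -> (iid_content A <= \sum_(n <oo) iid_content (F n))%E.
Proof.
move=> bA bF AF.
pose B := fix B n := if n is m.+1 then B m `\` F m else A.
have bB n : base_sets (B n) by elim: n => //= n IH; exact: base_setsD.
have subB n : (iid_content A <=
    \sum_(0 <= k < n) iid_content (F k) + iid_content (B n))%E.
  elim: n => [|n IH]; first by rewrite big_nil add0e.
  apply: (le_trans IH); rewrite big_nat_recr//= -addeA leeD2l//.
  exact: iid_content_split.
have BE n x : B n x -> A x /\ forall k, (k < n)%N -> ~ F k x.
  elim: n => [//|n IH] /= [/IH[Ax H] Fx]; split => // k.
  by rewrite ltnS leq_eqVlt => /predU1P[->//|]; exact: H.
apply/lee_addgt0Pr => e e0.
have [n Hn] : exists n, (iid_content (B n) < e%:E)%E.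
  apply: contrapT => /forallNP H.
  have [|x Bx] := @big_sections_nonempty e B e0.
    by split => // k; [by move=> x []|rewrite leNgt; exact/negP].
  have [Ax _] := BE 0%N x (Bx 0%N I).
  have [k _ Fk] := AF x Ax.
  by have [_ /(_ k (ltnSn k))] := BE k.+1 x (Bx k.+1 I).
apply: (le_trans (subB n)); apply: leeD; last exact: ltW.
by apply: nneseries_lim_ge => k _ _; exact: iid_content_ge0.
Qed.

Lemma iidn_box n (B : nat -> set T) : (forall i, measurable (B i)) ->
  iidn n [set x | forall i, (i < n)%N -> B i (x i)] =
  (\prod_(i < n) nu (B i))%E.
Proof.
elim: n B => [|n IH] B mB.
  rewrite big_ord0 (_ : [set _ | _] = setT) ?probability_setT//.
  by apply/seteqP; split.
rewrite iidnS big_ord_recl/=.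
pose C := [set x : Om | forall i, (i < n)%N -> B i.+1 (x i)].
have e t : iidn n (sec t [set x | forall i, (i < n.+1)%N -> B i (x i)]) =
    ((\1_(B 0%N) t)%:E * iidn n C)%E.
  have [Bt|Bt] := pselect (B 0%N t).
    rewrite indicE mem_set// mul1e; congr (iidn n _); apply/seteqP; split => x.
      by move=> H i ni; exact: (H i.+1).
    by move=> H [|i] //=; exact: H.
  rewrite indicE memNset// mul0e (_ : sec _ _ = set0) ?measure0//.
  by apply/seteqP; split => // x /(_ 0%N isT).
under eq_integral do rewrite e.
rewrite ge0_integralZr//; last exact/measurable_EFinP/measurable_indic.
rewrite integral_indic// setIT /C.
by rewrite (IH (fun i => B i.+1)).
Qed.

Theorem iid_sequence_exists : exists Q : probability Om R,
  (forall i : nat, same_law Q (fun x : Om => x i) nu id) /\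
  mutually_indep Q setT (fun (i : nat) (x : Om) => x i).
Proof.
have [Q HQ] := limit_extension base_sets_semiring base_setsT base_sets_generate
  iid_content_ge0 iid_content_cvg iid_content_sub.
have box (n : nat) (B : nat -> set T) : (forall i, measurable (B i)) ->
    Q [set x | forall i, (i < n)%N -> B i (x i)] = (\prod_(i < n) nu (B i))%E.
  move=> mB; rewrite -iidn_box//.
  have m : measurable [set x : Om | forall i, (i < n)%N -> B i (x i)].
    rewrite (_ : [set x | _] = \bigcap_(i < n) [set x | B i (x i)]) //.
    apply: fin_bigcap_measurable => // i _.
    exact: (measurable_preimage (measurable_coord i) (mB i)).
  have d' : depends_below n [set x : Om | forall i, (i < n)%N -> B i (x i)].
    by move=> x y xy H i ni /=; rewrite -xy//; exact: H.
  by rewrite HQ; [rewrite (iid_contentE m d')|split => //; exists n].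
have fin (J : {fset nat}) (B : nat -> set T) : (forall i, measurable (B i)) ->
    Q (\bigcap_(i in [set` J]) (fun x : Om => x i) @^-1` B i) =
    (\prod_(i <- J) nu (B i))%E.
  move=> mB; have [n Jn] := fset_nat_bound J.
  have := box n (fun i => if i \in J then B i else setT).
  rewrite (_ : [set x | _] = \bigcap_(i in [set` J]) (fun x : Om => x i) @^-1` B i).
    move=> ->; last by move=> i; case: ifP.
    rewrite -(big_mkord xpredT (fun i => nu (if i \in J then B i else setT))).
    rewrite (bigID (fun i => i \in J))/= [X in (_ * X)%E]big1 ?mule1; last first.
      by move=> i /negbTE ->; exact: probability_setT.
    rewrite -big_filter (perm_big J)/=.
      by apply: eq_big_seq => i ->.
    apply: uniq_perm; rewrite ?filter_uniq ?iota_uniq ?fset_uniq// => i.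
    rewrite mem_filter mem_index_iota /=.
    by have [/Jn ->|] := boolP (i \in J).
  apply/seteqP; split => x H i /=; last by case: ifPn => // iJ _; exact: H.
  by move=> iJ; have := H i (Jn i iJ); rewrite iJ.
have law i : same_law Q (fun x : Om => x i) nu id.
  move=> A mA; have := fin [fset i]%fset (fun=> A) (fun=> mA).
  rewrite big_seq_fset1 => <-; congr (Q _); apply/seteqP; split => x /=.
    by move=> Ax j /=; rewrite inE => /eqP ->.
  by apply; rewrite /= inE.
exists Q; split => // J B _ mB; rewrite fin//.
by apply: eq_bigr => i _; rewrite law.
Qed.

End iid.

Lemma iid_family_exists (R : realType) d (T : measurableType d)
    (nu : probability T R) (V : countType) :
  exists Q : probability (fam V T) R,
  (forall i : V, same_law Q (fun x : fam V T => x i) nu id) /\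
  mutually_indep Q setT (fun (i : V) (x : fam V T) => x i).
Proof.
have [Q [HQ iQ]] := iid_sequence_exists nu.
pose h (x : fam nat T) : fam V T := fun i => x (choice.pickle i).
have mh : measurable_fun setT h.
  by apply: measurable_fam => i; exact: measurable_coord.
exists (law Q mh); split; first by move=> i A mA; rewrite lawE; exact: (HQ (choice.pickle i)).
have [v0|V0] := pselect (inhabited V); last first.
  move=> J B _ mB; have -> : J = fset0.
    by apply/fsetP => v; case: V0.
  by rewrite set_fset0 bigcap_set0 probability_setT big_seq_fset0.
case: v0 => v.
have iQ' := @mutually_indep_reindex R _ _ _ _ _ Q (fun i (x : fam nat T) => x i)
  V (@choice.pickle V) (fun n => odflt v (choice.unpickle n)) setT (fun i => _) iQ.
move=> J B _ mB; rewrite lawE /= preimage_bigcap.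
by apply: iQ' => // i; rewrite choice.pickleK.
Qed.

(** * Evaluating the tree *)

Notation vertex := (seq nat).
Definition level n : set vertex := [set i | size i = n].
Definition below n : set vertex := [set i | (size i < n)%N].

Definition shift (T : Type) (v : vertex) (x : fam vertex T) : fam vertex T :=
  fun i => x (v ++ i).

Lemma shift_cat T (v u : vertex) (x : fam vertex T) :
  shift u (shift v x) = shift (v ++ u) x.
Proof. by apply/funext => i; rewrite /shift catA. Qed.

Lemma measurable_shift d (T : measurableType d) (v : vertex) :
  measurable_fun setT (@shift T v).
Proof. by apply: measurable_fam => i; exact: measurable_coord. Qed.

Lemma measurable_comp2 d (U : measurableType d) d1 (T1 : measurableType d1)
    d2 (T2 : measurableType d2) d3 (T3 : measurableType d3)
    (F : T1 -> T2 -> T3) (f : U -> T1) (h : U -> T2) :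
  measurable_fun setT (fun z : T1 * T2 => F z.1 z.2) ->
  measurable_fun setT f -> measurable_fun setT h ->
  measurable_fun setT (fun w => F (f w) (h w)).
Proof.
move=> mF mf mh; exact: (measurableT_comp mF (measurable_fun_pair mf mh)).
Qed.

Section evaluation.
Context (S : ptopologicalType) dT (Theta : measurableType dT).
Variable g : {mfun (Theta * families (borel S))%type >-> borel S}.
Local Notation Inn := (Theta * enat)%type.

(** There are countably many values of [N], and for each of them the disjoint
    union carries a product sigma-algebra. *)
Lemma measurable_family_upto d (U : measurableType d) :
  measurable_fun setT (fun z : enat * fam nat U => family_upto z.1 z.2).
Proof.
move=> _ A mA; rewrite setTI.
pose B (n : enat) := [set x : fam nat U | A (family_upto n x)].
have mB n : measurable (B n).
  pose r (x : fam nat U) : fam (child_index n) U := fun j => x (child_rank j).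
  have mr : measurable_fun setT r.
    by apply: measurable_fam => j; exact: measurable_coord.
  exact: (measurable_preimage mr (mA n)).
have -> : (fun z : enat * fam nat U => family_upto z.1 z.2) @^-1` A =
    ([set None] `*` B None) `|` \bigcup_k ([set Some k] `*` B (Some k)).
  apply/seteqP; split => [[[n|] x] /= Ax|].
  - by right; exists n.
  - by left.
  - by move=> [n x] [[/= -> //]|[k _ [/= -> //]]].
apply: measurableU; first exact: measurableX.
by apply: bigcupT_measurable => k; exact: measurableX.
Qed.

Lemma measurable_rde_map :
  measurable_fun setT (fun z : Inn * fam nat (borel S) => rde_map g z.1 z.2).
Proof.
have m1 : measurable_fun setT (fun z : Inn * fam nat (borel S) => z.1.1).
  exact: (measurableT_comp measurable_fst measurable_fst).
have m2 : measurable_fun setT (fun z : Inn * fam nat (borel S) => z.1.2).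
  exact: (measurableT_comp measurable_snd measurable_fst).
have m3 := measurable_comp2 (@measurable_family_upto _ (borel S)) m2
  (@measurable_snd _ _ Inn (fam nat (borel S))).
exact: (measurableT_comp (measurable_funPT g) (measurable_fun_pair m1 m3)).
Qed.

(** Reads the innovations of the generations before [n] and the values of
    generation [n] only ([tree_eval_local]); families over all vertices avoid a
    type for each [n]. *)
Fixpoint tree_eval n (xi : fam vertex Inn) (x : fam vertex (borel S)) : borel S :=
  if n is m.+1 then
    rde_map g (xi [::]) (fun j => tree_eval m (shift [:: j] xi) (shift [:: j] x))
  else x [::].

Lemma measurable_tree_eval n : measurable_fun setT
  (fun z : fam vertex Inn * fam vertex (borel S) => tree_eval n z.1 z.2).
Proof.
elim: n => [|n IH] /=.
  exact: (measurableT_comp (measurable_coord _) measurable_snd).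
apply: (measurable_comp2 measurable_rde_map).
  exact: (measurableT_comp (measurable_coord _) measurable_fst).
apply: measurable_fam => j.
apply: (measurable_comp2 IH).
  exact: (measurableT_comp (measurable_shift _) measurable_fst).
exact: (measurableT_comp (measurable_shift _) measurable_snd).
Qed.

Lemma measurable_tree_eval_comp n d (U : measurableType d)
    (f : U -> fam vertex Inn) (h : U -> fam vertex (borel S)) :
  measurable_fun setT f -> measurable_fun setT h ->
  measurable_fun setT (fun w => tree_eval n (f w) (h w)).
Proof.
exact: (measurable_comp2 (measurable_tree_eval n)).
Qed.

Lemma tree_eval_local n xi xi' x x' :
  (forall i, (size i < n)%N -> xi i = xi' i) ->
  (forall i, size i = n -> x i = x' i) ->
  tree_eval n xi x = tree_eval n xi' x'.
Proof.
elim: n xi xi' x x' => [|n IH] xi xi' x x' Hxi Hx /=; first exact: Hx.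
rewrite Hxi//; congr (rde_map g _ _); apply/funext => j.
by apply: IH => i si; [apply: Hxi|apply: Hx; rewrite /= si].
Qed.

End evaluation.

(** * Independent blocks *)

Section masks.
Context (R : realType) (I : choiceType) d (T : measurableType d)
  d0 (O : measurableType d0) (P : probability O R) (X : I -> O -> T).
Hypothesis mX : forall i, measurable_fun setT (X i).

Lemma mutually_indep_disjoint (J K : {fset I}) B C :
  mutually_indep P setT X -> [disjoint J & K]%fset ->
  (forall i, measurable (B i)) -> (forall i, measurable (C i)) ->
  P (tuple_of X @^-1` cyl J B `&` tuple_of X @^-1` cyl K C) =
  (P (tuple_of X @^-1` cyl J B) * P (tuple_of X @^-1` cyl K C))%E.
Proof.
move=> iX JK mB mC.
have e L A : tuple_of X @^-1` cyl L A = \bigcap_(i in [set` L]) X i @^-1` A i.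
  by rewrite /cyl preimage_bigcap.
pose A i := if i \in J then B i else C i.
have -> : tuple_of X @^-1` cyl J B `&` tuple_of X @^-1` cyl K C =
    tuple_of X @^-1` cyl (J `|` K)%fset A.
  apply/seteqP; split => [w [HJ HK] i /=|w H].
    rewrite inE /A; case: ifPn => [iJ _|iJ /= iK]; first exact: HJ.
    exact: HK.
  split => i /= iL; have := H i; rewrite /= inE iL ?orbT /A.
    by rewrite iL; apply.
  by rewrite ifN; [apply|apply: contraL iL => iJ; exact: (fdisjointP JK)].
rewrite !e !iX//; last by move=> i; rewrite /A; case: ifP.
rewrite (perm_big (J ++ K))/=; last first.
  apply: uniq_perm => [||i]; rewrite ?cat_uniq ?fset_uniq//=; last first.
    by rewrite mem_cat !inE.
  rewrite andbT; apply/hasPn => i /= iK.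
  by apply: contraL iK => iJ; exact: (fdisjointP JK).
rewrite big_cat/=; congr (_ * _)%E; apply: eq_big_seq => i iL.
  by rewrite /A iL.
by rewrite /A ifN//; apply: contraL iL => iJ; exact: (fdisjointP JK).
Qed.

Lemma indep2_masks D E : mutually_indep P setT X -> D `&` E = set0 ->
  indep2 P (mask D \o tuple_of X) (mask E \o tuple_of X).
Proof.
move=> iX DE.
apply: (@indep2_generated _ _ _ _ _ _ _ _ _ _ _ _
  (@cylinders I d T) (@cylinders I d T)).
- exact: measurable_mask_tuple.
- exact: measurable_mask_tuple.
- exact: cylinders_pi.
- exact: cylinders_pi.
move=> _ _ [J [B [mB ->]]] [K [C [mC ->]]].
rewrite !comp_preimage.
have [->|->] := mask_cyl D J B.
  by rewrite preimage_set0 set0I !measure0 mul0e.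
have [->|->] := mask_cyl E K C.
  by rewrite preimage_set0 setI0 !measure0 mule0.
apply: mutually_indep_disjoint => //.
apply/fdisjointP => i; rewrite !inE => /andP[_ iD].
apply/negP => /andP[_ iE].
by have : (D `&` E) i; [split; exact/set_mem|rewrite DE].
Qed.

End masks.

Section sigma_indep.
Context (R : realType) d0 (O : measurableType d0) (P : probability O R)
  (I J : choiceType) d1 (T : measurableType d1) d2 (U : measurableType d2)
  (X : I -> O -> T) (Y : J -> O -> U).
Hypotheses (mX : forall i, measurable_fun setT (X i))
  (mY : forall i, measurable_fun setT (Y i)).

Lemma indep_sigma_masks D E :
  indep_sigma P (sigma_of D X) (sigma_of E Y) ->
  indep2 P (mask D \o tuple_of X) (mask E \o tuple_of Y).
Proof.
move=> iXY A B mA mB; apply: iXY; rewrite sigma_of_mask//.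
  by exists A => //; rewrite setTI.
by exists B => //; rewrite setTI.
Qed.

Lemma indep2_indep_sigma : indep2 P (tuple_of X) (tuple_of Y) ->
  indep_sigma P (sigma_of setT X) (sigma_of setT Y).
Proof.
move=> iXY A B; rewrite !sigma_of_mask// => -[A' mA' <-] [B' mB' <-].
by rewrite !setTI !mask_setT; exact: iXY.
Qed.

End sigma_indep.

Lemma mutually_indep_bool (R : realType) d0 (O : measurableType d0)
    (P : probability O R) d (T : measurableType d) (Y : bool -> O -> T) :
  indep2 P (Y false) (Y true) -> mutually_indep P setT Y.
Proof.
move=> iY J B _ mB.
pose C i := if i \in J then B i else setT.
have mC i : measurable (C i) by rewrite /C; case: ifP.
have -> : \bigcap_(i in [set` J]) Y i @^-1` B i =
    Y false @^-1` C false `&` Y true @^-1` C true.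
  apply/seteqP; split => [w H|w [H0 H1] [] /= iJ].
  - by split; rewrite /= /C; case: ifPn => // iJ; exact: H.
  - by move: H1; rewrite /= /C iJ.
  - by move: H0; rewrite /= /C iJ.
rewrite iY//.
pose s := (if false \in J then [:: false] else [::]) ++
  (if true \in J then [:: true] else [::]).
rewrite (perm_big s) /s/=; last first.
  apply: uniq_perm; first exact: fset_uniq.
    by case: (false \in J); case: (true \in J).
  by move=> b; case ef: (false \in J); case et: (true \in J); case: b;
    rewrite ?ef ?et.
rewrite /C; case: (false \in J); case: (true \in J);
  by rewrite /= ?big_cons ?big_nil ?preimage_setT ?probability_setT ?mule1 ?mul1e.
Qed.

(** * The iterated bivariate operator as the law of two roots *)

Section operator.
Context (R : realType) (S : ptopologicalType) dT (Theta : measurableType dT).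
Variable rho : probability (Theta * enat)%type R.
Variable g : {mfun (Theta * families (borel S))%type >-> borel S}.
Local Notation Inn := (Theta * enat)%type.
Local Notation SS := (borel S * borel S)%type.

Definition step2 (z : fam nat SS * fam bool Inn) : SS :=
  (rde_map g (z.2 false) (fun j => (z.1 j).1),
   rde_map g (z.2 true) (fun j => (z.1 j).2)).

Lemma measurable_step2 : measurable_fun setT step2.
Proof.
apply: measurable_fun_pair; apply: (measurable_comp2 (measurable_rde_map g)).
- exact: (measurableT_comp (measurable_coord _) measurable_snd).
- apply: measurable_fam => j.
  apply: (measurableT_comp measurable_fst).
  exact: (measurableT_comp (measurable_coord _) measurable_fst).
- exact: (measurableT_comp (measurable_coord _) measurable_snd).
- apply: measurable_fam => j.
  apply: (measurableT_comp measurable_snd).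
  exact: (measurableT_comp (measurable_coord _) measurable_fst).
Qed.

(** Hence the choice that the bivariate operator makes among the possible images
    is irrelevant on measurable sets. *)
Lemma rde_image2_unique m m' nu nu' :
  rde_image2 rho g m nu -> rde_image2 rho g m' nu' -> m ≡μ m' -> nu ≡μ nu'.
Proof.
move=> [d1 [W1 [P1 [I1 [X1 [[lI1 iI1] lX1 iX1 XI1 o1]]]]]].
move=> [d2 [W2 [P2 [I2 [X2 [[lI2 iI2] lX2 iX2 XI2 o2]]]]]] mm.
have e1 : same_law P1 (tuple_of X1) P2 (tuple_of X2).
  apply: same_law_tuple => // j A mA.
  by rewrite (lX1 j)// (lX2 j)// mm.
have e2 : same_law P1 (tuple_of I1) P2 (tuple_of I2).
  apply: same_law_tuple => // b A mA.
  by rewrite (lI1 b)// (lI2 b).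
have := indep_sigma_masks XI1; rewrite !mask_setT => i1.
have := indep_sigma_masks XI2; rewrite !mask_setT => i2.
have e := same_law_comp measurable_step2 (same_law_pair _ _ _ _ i1 i2 e1 e2).
move=> A mA; refine (etrans (esym (o1 A mA)) (etrans (e _ _ _ _ A mA) (o2 A mA)));
  exact: measurable_tuple_of.
Qed.

Section bivariate_tree.
Context d0 (O : measurableType d0) (P : probability O R)
  (I : vertex -> O -> Inn) (nu : probability SS R).
Hypotheses (mI : forall i, measurable_fun setT (I i))
  (lI : forall i, has_law P (I i) rho) (iI : mutually_indep P setT I).
Variable Pnu : probability (fam vertex SS) R.
Hypotheses (lnu : forall i : vertex, same_law Pnu (fun x : fam vertex SS => x i) nu id)
  (inu : mutually_indep Pnu setT (fun (i : vertex) (x : fam vertex SS) => x i)).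

Local Notation Q := ((Pnu \x (P \x P))%E :
  probability (fam vertex SS * (O * O))%type R).
Local Notation W := (fam vertex SS * (O * O))%type.
Local Notation U := (fam vertex SS * (fam vertex Inn * fam vertex Inn))%type.

(** i.i.d. pairs on the vertices, and two independent copies of the innovations,
    one for each tree *)
Definition zeta (w : W) : U := (w.1, (tuple_of I w.2.1, tuple_of I w.2.2)).

(** The masks and shifts of the three families at once, which are independent:
    what holds for blocks of one family then holds for blocks of the sample. *)
Definition mapU (h : forall d (T : measurableType d), fam vertex T -> fam vertex T)
  (u : U) : U := (h _ _ u.1, (h _ _ u.2.1, h _ _ u.2.2)).

Lemma measurable_mapU h :
  (forall d (T : measurableType d), measurable_fun setT (h d T)) ->
  measurable_fun setT (mapU h).
Proof.
move=> mh; apply: measurable_fun_pair.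
  exact: (measurableT_comp (mh _ _) measurable_fst).
have m2 : measurable_fun setT (snd : U -> _) by exact: measurable_snd.
apply: measurable_fun_pair.
  exact: (measurableT_comp (mh _ _) (measurableT_comp measurable_fst m2)).
exact: (measurableT_comp (mh _ _) (measurableT_comp measurable_snd m2)).
Qed.

Lemma measurable_zeta : measurable_fun setT zeta.
Proof.
have m2 : measurable_fun setT (snd : W -> _) by exact: measurable_snd.
have mt := measurable_tuple_of mI.
apply: measurable_fun_pair; first exact: measurable_fst.
apply: measurable_fun_pair.
  exact: (measurableT_comp mt (measurableT_comp measurable_fst m2)).
exact: (measurableT_comp mt (measurableT_comp measurable_snd m2)).
Qed.

Let maskU D := mapU (fun d T => @mask vertex d T D).
Let shiftU v := mapU (fun d T => @shift T v).

Lemma zeta_indep D E : D `&` E = set0 ->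
  indep2 Q (maskU D \o zeta) (maskU E \o zeta).
Proof.
move=> DE.
have mm K d (T : measurableType d) (V : measurableType K) (h : V -> fam vertex T) F :
    measurable_fun setT h -> measurable_fun setT (mask F \o h).
  by move=> mh; apply: measurableT_comp mh; exact: measurable_mask.
have mt := measurable_tuple_of mI.
have iP := indep2_masks mI iI DE.
have iN := @indep2_masks _ _ _ _ _ _ Pnu _ (fun i => measurable_coord i) D E inu DE.
have mid : measurable_fun setT (tuple_of (fun (i : vertex) (x : fam vertex SS) => x i)).
  by apply: measurable_tuple_of => i; exact: measurable_coord.
have iPP := indep2_prod (mm _ _ _ _ _ _ mt) (mm _ _ _ _ _ _ mt) (mm _ _ _ _ _ _ mt) (mm _ _ _ _ _ _ mt) iP iP.
have mp F : measurable_fun setT (fun w : O * O =>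
    ((mask F \o tuple_of I) w.1, (mask F \o tuple_of I) w.2)).
  apply: measurable_fun_pair.
    exact: (measurableT_comp (mm _ _ _ _ _ _ mt) measurable_fst).
  exact: (measurableT_comp (mm _ _ _ _ _ _ mt) measurable_snd).
exact: (indep2_prod (mm _ _ _ _ _ _ mid) (mp D) (mm _ _ _ _ _ _ mid) (mp E) iN iPP).
Qed.

Lemma zeta_shift v : same_law Q (shiftU v \o zeta) Q zeta.
Proof.
have ms d (T : measurableType d) : measurable_fun setT (@shift T v) by exact: measurable_shift.
have mt := measurable_tuple_of mI.
have sP : same_law P (shift v \o tuple_of I) P (tuple_of I).
  apply: (same_law_tuple (X1 := fun i => I (v ++ i))) => //.
    apply: (@mutually_indep_reindex _ _ _ _ _ _ P I vertex (cat v) (drop (size v))) iI.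
    by move=> i; rewrite drop_size_cat.
  by move=> i A mA; rewrite (lI (v ++ i))// (lI i).
have mst : measurable_fun setT (shift v \o tuple_of I).
  exact: (measurableT_comp (ms _ _) mt).
have sN : same_law Pnu (@shift SS v) Pnu id.
  apply: (same_law_tuple (X1 := fun i (x : fam vertex SS) => x (v ++ i))
    (X2 := fun i (x : fam vertex SS) => x i)).
  - by move=> i; exact: measurable_coord.
  - by move=> i; exact: measurable_coord.
  - apply: (@mutually_indep_reindex _ _ _ _ _ _ Pnu
      (fun i (x : fam vertex SS) => x i) vertex (cat v) (drop (size v))) inu.
    by move=> i; rewrite drop_size_cat.
  - exact: inu.
  - by move=> i A mA; rewrite (lnu (v ++ i) mA) (lnu i mA).
have sPP := same_law_prod mst mst mt mt sP sP.
have mp (h : O -> fam vertex Inn) : measurable_fun setT h ->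
    measurable_fun setT (fun w : O * O => (h w.1, h w.2)).
  move=> mh; apply: measurable_fun_pair.
    exact: (measurableT_comp mh measurable_fst).
  exact: (measurableT_comp mh measurable_snd).
exact: (same_law_prod (ms _ _) (mp _ mst) (@measurable_id _ _ setT) (mp _ mt) sN sPP).
Qed.

(** The roots of the two trees, grown from the two components of the same pairs
    with separate innovations. *)
Definition outU n (u : U) : SS :=
  (tree_eval g n u.2.1 (fst \o u.1), tree_eval g n u.2.2 (snd \o u.1)).

Lemma measurable_outU n : measurable_fun setT (outU n).
Proof.
have m2 : measurable_fun setT (snd : U -> _) by exact: measurable_snd.
have m1 : measurable_fun setT (fst : U -> _) by exact: measurable_fst.
apply: measurable_fun_pair; apply: measurable_tree_eval_comp.
- exact: (measurableT_comp measurable_fst m2).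
- apply: measurable_fam => i.
  exact: (measurableT_comp measurable_fst (measurableT_comp (measurable_coord i) m1)).
- exact: (measurableT_comp measurable_snd m2).
- apply: measurable_fam => i.
  exact: (measurableT_comp measurable_snd (measurableT_comp (measurable_coord i) m1)).
Qed.

Let rootI (b : bool) (u : U) : Inn := if b then u.2.2 [::] else u.2.1 [::].

Let measurable_rootI b : measurable_fun setT (rootI b).
Proof.
have m2 : measurable_fun setT (snd : U -> _) by exact: measurable_snd.
case: b.
  exact: (measurableT_comp (measurable_coord _) (measurableT_comp measurable_snd m2)).
exact: (measurableT_comp (measurable_coord _) (measurableT_comp measurable_fst m2)).
Qed.

Let child (j : nat) : set vertex := [set i | exists u, i = j :: u].
Let nonroot : set vertex := [set i | i != [::]].

Let measurable_maskU D : measurable_fun setT (maskU D).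
Proof. by apply: measurable_mapU => d T; exact: measurable_mask. Qed.

Let measurable_shiftU v : measurable_fun setT (shiftU v).
Proof. by apply: measurable_mapU => d T; exact: measurable_shift. Qed.

Let shift_mask j D d (T : measurableType d) (x : fam vertex T) :
  child j `<=` D -> shift [:: j] (mask D x) = shift [:: j] x.
Proof.
move=> jD; apply/funext => i; rewrite /shift /mask mem_set//.
by apply: jD; exists i.
Qed.

Let shiftU_maskU j D u : child j `<=` D ->
  shiftU [:: j] (maskU D u) = shiftU [:: j] u.
Proof. by move=> jD; rewrite /shiftU /maskU /mapU /= !shift_mask. Qed.

Let Xc n j (w : W) : SS := outU n (shiftU [:: j] (zeta w)).
Let Ic b (w : W) : Inn := rootI b (zeta w).

Let mXc n j : measurable_fun setT (Xc n j).
Proof.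
exact: (measurableT_comp (measurable_outU n)
  (measurableT_comp (measurable_shiftU _) measurable_zeta)).
Qed.

Let mIc b : measurable_fun setT (Ic b).
Proof. exact: (measurableT_comp (measurable_rootI b) measurable_zeta). Qed.

Let mout n : measurable_fun setT (outU n \o zeta).
Proof. exact: (measurableT_comp (measurable_outU n) measurable_zeta). Qed.

(** The trees at the children of the root are i.i.d. copies of the tree and
    independent of the innovations at the root: a generation more is one
    application of the operator. *)
Lemma tree_image2 n (m : probability SS R) : has_law Q (outU n \o zeta) m ->
  rde_image2 rho g m (law Q (mout n.+1)).
Proof.
move=> Hm.
exists _, W, Q, (fun b => pack (mIc b)), (fun j => pack (mXc n j)).
have mt := measurable_tuple_of mI.
have mroot : measurable_fun setT (fun w => I [::] w) by exact: mI.
have mXs : measurable_fun setT (fun u : U => (fun j => outU n (shiftU [:: j] u)) : fam nat SS).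
  apply: measurable_fam => j.
  exact: (measurableT_comp (measurable_outU n) (measurable_shiftU _)).
have mIs : measurable_fun setT (fun u : U => (fun b => rootI b u) : fam bool Inn).
  by apply: measurable_fam => b; exact: measurable_rootI.
split.
- split.
    move=> b A mA; rewrite -(lI [::] mA).
    have m' : measurable_fun setT (I [::] \o (if b then snd else fst) : O * O -> _).
      by case: b; [exact: (measurableT_comp mroot measurable_snd)|
        exact: (measurableT_comp mroot measurable_fst)].
    have := same_law_snd Pnu (P \x P)%E m' mA.
    case: b {m'} => /= e.
      exact: (etrans e (same_law_snd P P mroot mA)).
    exact: (etrans e (same_law_fst P P mroot mA)).
  apply: mutually_indep_bool.
  apply: (@indep2_snd _ _ _ _ _ Pnu (P \x P)%E _ _ _ _ (I [::] \o fst) (I [::] \o snd)).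
  + exact: (measurableT_comp mroot measurable_fst).
  + exact: (measurableT_comp mroot measurable_snd).
  + exact: indep2_fst_snd.
- move=> j A mA; rewrite -(Hm A mA).
  exact: (same_law_comp (measurable_outU n) (zeta_shift [:: j]) mA).
- have := @block_indep _ _ _ _ Q _ _ (fun D => maskU D \o zeta) maskU _ _ _
    nat child _ _ (fun j => outU n \o shiftU [:: j]).
  rewrite (_ : (fun j => _) = Xc n); last first.
    by apply/funext => j; apply/funext => w /=; rewrite shiftU_maskU.
  apply.
  + exact: measurable_maskU.
  + by move=> D E w DE /=; rewrite /maskU /mapU /= !mask_mask.
  + by move=> D E; exact: zeta_indep.
  + by move=> j; exact: (measurableT_comp (measurable_outU n) (measurable_shiftU _)).
  + move=> i j ij; apply/seteqP; split => // k [[u ->] [v []]] ji _.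
    by rewrite ji eqxx in ij.
- apply: indep2_indep_sigma.
  have dr : nonroot `&` [set [::]] = set0.
    by apply/seteqP; split => // i [/= /eqP].
  apply: (indep2_ext (indep2_comp mXs mIs (zeta_indep dr))) => w.
    apply/funext => j; rewrite /= shiftU_maskU//.
    by move=> i [u ->].
  by apply/funext => -[]; rewrite /= /mask mem_set.
- by [].
Qed.

Lemma iter_rde_op2_law n :
  has_law Q (outU n \o zeta) (iter n (rde_op2 rho g) nu).
Proof.
elim: n => [|n IH].
  move=> A mA; rewrite /= -(lnu [::] mA).
  rewrite -(same_law_fst Pnu (P \x P)%E (@measurable_coord _ _ SS ([::] : vertex)) mA).
  congr (Q _); apply/seteqP; split => w /=; rewrite /outU /=;
    by case: (w.1 [::]).
have im := tree_image2 IH.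
have im' : rde_image2 rho g (iter n (rde_op2 rho g) nu)
    (rde_op2 rho g (iter n (rde_op2 rho g) nu)).
  by apply: getPex; exists (law Q (mout n.+1)).
have e := rde_image2_unique im im' (fun _ _ => erefl).
by move=> A mA; exact: (e A mA).
Qed.

End bivariate_tree.

End operator.

(** * Integrals of bounded functions *)

Lemma indic_le1 (R : realType) T (A : set T) w : \1_A w <= 1 :> R.
Proof. by rewrite indicE; case: (w \in A). Qed.

(** With [b] the event that [x] exceeds [c + delta]: either the deviation is upward
    and at most [delta], or [b] holds, or it is downward and the last term pays
    for it. The mean of that term vanishes when [c] is the mean of [x]. *)
Lemma sqr_deviation_le (R : realType) (x c delta : R) (b : bool) :
  0 <= x -> x <= 1 -> 0 <= c -> c <= 1 -> 0 < delta ->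
  (~~ b -> x <= c + delta) ->
  (x - c) ^+ 2 <= 2 * delta + 2 * b%:R - (x - c).
Proof.
move=> x0 x1 c0 c1 d0 xb.
have [y0|y0] := lerP 0 (x - c).
  have h : 0 <= (x - c) * (1 - (x - c)) by apply: mulr_ge0 => //; lra.
  case: b xb => [_|/(_ isT) h1]; rewrite /=; nra.
have h : 0 <= (c - x) * (1 + (x - c)) by apply: mulr_ge0; lra.
have : 0 <= 2 * b%:R :> R by rewrite mulr_ge0.
move: (2 * b%:R) => z z0; nra.
Qed.

Section bounded_functions.
Context (R : realType) d (O : measurableType d) (P : probability O R).
Implicit Types h k : O -> R.

(** Bounded measurable functions: integrable for every probability, and closed
    under all operations that occur below. *)
Definition bmf h := measurable_fun setT h /\ exists M, forall w, `|h w| <= M.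

Lemma bmf_measurable h : bmf h -> measurable_fun setT h. Proof. by case. Qed.

Lemma bmf_integrable h : bmf h -> P.-integrable setT (EFin \o h).
Proof.
move=> [mh [M hM]]; apply: measurable_bounded_integrable => //.
  by rewrite (le_lt_trans (probability_le1 _ _))// ltry.
by exists M; split; [exact: num_real|move=> x Mx w _; exact: le_trans (hM w) (ltW Mx)].
Qed.

Lemma bmf_cst c : bmf (fun=> c).
Proof. by split; [exact: measurable_cst|exists `|c|]. Qed.

Lemma bmf_indic A : measurable A -> bmf (\1_A).
Proof.
move=> mA; split; first exact: measurable_indic.
by exists 1 => w; rewrite indicE; case: (_ \in _); rewrite ?normr1 ?normr0.
Qed.

Lemma bmfD h k : bmf h -> bmf k -> bmf (fun w => h w + k w).
Proof.
move=> [mh [M hM]] [mk [N kN]]; split; first exact: measurable_funD.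
by exists (M + N) => w; rewrite (le_trans (ler_normD _ _))// lerD.
Qed.

Lemma bmfN h : bmf h -> bmf (fun w => - h w).
Proof.
move=> [mh [M hM]]; split; first exact: measurableT_comp.
by exists M => w; rewrite normrN.
Qed.

Lemma bmfB h k : bmf h -> bmf k -> bmf (fun w => h w - k w).
Proof. by move=> bh bk; apply: bmfD => //; exact: bmfN. Qed.

Lemma bmfM h k : bmf h -> bmf k -> bmf (fun w => h w * k w).
Proof.
move=> [mh [M hM]] [mk [N kN]]; split; first exact: measurable_funM.
by exists (M * N) => w; rewrite normrM ler_pM.
Qed.

Lemma bmf_norm h : bmf h -> bmf (fun w => `|h w|).
Proof.
move=> [mh [M hM]]; split; first exact: measurableT_comp.
by exists M => w; rewrite normr_id.
Qed.

Lemma bmfX h n : bmf h -> bmf (fun w => h w ^+ n).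
Proof.
move=> bh; elim: n => [|n IH]; first exact: bmf_cst.
rewrite (_ : (fun w => _) = (fun w => h w * h w ^+ n)); first exact: bmfM.
by apply/funext => w; rewrite exprS.
Qed.

Lemma Rint_cst c : \int[P]_w c = c.
Proof. by rewrite Rintegral_cst// [X in fine X]probability_setT mulr1. Qed.

Lemma RintD h k : bmf h -> bmf k ->
  \int[P]_w (h w + k w) = \int[P]_w h w + \int[P]_w k w.
Proof. by move=> bh bk; apply: RintegralD => //; exact: bmf_integrable. Qed.

Lemma RintB h k : bmf h -> bmf k ->
  \int[P]_w (h w - k w) = \int[P]_w h w - \int[P]_w k w.
Proof. by move=> bh bk; apply: RintegralB => //; exact: bmf_integrable. Qed.

Lemma RintZl c h : bmf h -> \int[P]_w (c * h w) = c * \int[P]_w h w.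
Proof. by move=> bh; apply: RintegralZl => //; exact: bmf_integrable. Qed.

Lemma le_Rint h k : bmf h -> bmf k -> (forall w, h w <= k w) ->
  \int[P]_w h w <= \int[P]_w k w.
Proof. by move=> bh bk hk; apply: le_Rintegral => //; exact: bmf_integrable. Qed.

Lemma Rint_ge0 h : (forall w, 0 <= h w) -> 0 <= \int[P]_w h w.
Proof. by move=> h0; apply: Rintegral_ge0. Qed.

Lemma le_norm_Rint h : bmf h -> `|\int[P]_w h w| <= \int[P]_w `|h w|.
Proof. by move=> bh; apply: le_normr_Rintegral => //; exact: bmf_integrable. Qed.

Lemma Rint_indic A : measurable A -> \int[P]_w \1_A w = fine (P A).
Proof. by move=> mA; rewrite /Rintegral integral_indic// setIT. Qed.

Lemma EFin_Rint h : bmf h -> (\int[P]_w h w)%:E = (\int[P]_w (h w)%:E)%E.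
Proof.
by move=> bh; rewrite /Rintegral fineK//; apply: integrable_fin_num => //;
  exact: bmf_integrable.
Qed.

Lemma Rint_sqr_le h : bmf h -> (\int[P]_w h w) ^+ 2 <= \int[P]_w (h w ^+ 2).
Proof.
move=> bh; set m := \int[P]_w h w.
have H : 0 <= \int[P]_w ((h w - m) ^+ 2) by apply: Rint_ge0 => w; exact: sqr_ge0.
have e : \int[P]_w ((h w - m) ^+ 2) = \int[P]_w (h w ^+ 2) - m ^+ 2.
  rewrite (_ : (fun w => _) = (fun w => h w ^+ 2 - ((2 * m) * h w - m ^+ 2))).
    rewrite RintB//; last 2 first.
    - exact: bmfX.
    - apply: bmfB; last exact: bmf_cst.
      by apply: bmfM => //; exact: bmf_cst.
    rewrite RintB//; last 2 first.
    - by apply: bmfM => //; exact: bmf_cst.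
    - exact: bmf_cst.
    by rewrite RintZl// Rint_cst -/m; ring.
  by apply/funext => w; ring.
by rewrite -subr_ge0 -e.
Qed.

Lemma L1_sqr_le h : bmf h -> (\int[P]_w `|h w|) ^+ 2 <= \int[P]_w (h w ^+ 2).
Proof.
move=> bh; apply: (le_trans (Rint_sqr_le (bmf_norm bh))).
by under eq_Rintegral do rewrite real_normK ?num_real//.
Qed.

End bounded_functions.

Lemma bmf_comp (R : realType) d1 (O1 : measurableType d1) d2
  (O2 : measurableType d2) (f : O1 -> O2) (h : O2 -> R) :
  measurable_fun setT f -> bmf h -> bmf (h \o f).
Proof.
move=> mf [mh [M hM]]; split; first exact: (measurableT_comp mh mf).
by exists M => w; exact: hM.
Qed.

Section integral_laws.
Context (R : realType) d1 (O1 : measurableType d1) d2 (O2 : measurableType d2)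
  (P1 : probability O1 R) (P2 : probability O2 R) d (T : measurableType d)
  (f1 : O1 -> T) (f2 : O2 -> T).
Hypotheses (mf1 : measurable_fun setT f1) (mf2 : measurable_fun setT f2)
  (e : same_law P1 f1 P2 f2).

Lemma same_law_integral (h : T -> \bar R) : measurable_fun setT h ->
  (forall y, 0 <= h y)%E -> (\int[P1]_w h (f1 w) = \int[P2]_w h (f2 w))%E.
Proof.
move=> mh h0.
have -> : (\int[P1]_w h (f1 w) = \int[law P1 mf1]_y h y)%E.
  by rewrite (ge0_integral_distribution (pack mf1)).
have -> : (\int[P2]_w h (f2 w) = \int[law P2 mf2]_y h y)%E.
  by rewrite (ge0_integral_distribution (pack mf2)).
by apply: eq_measure_integral => A mA _; exact: e.
Qed.

Lemma same_law_Rint (h : T -> R) : bmf h ->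
  \int[P1]_w h (f1 w) = \int[P2]_w h (f2 w).
Proof.
move=> bh.
have -> : \int[P1]_w h (f1 w) = \int[law P1 mf1]_y h y.
  rewrite /Rintegral (integral_distribution (X := pack mf1))//.
    by apply/measurable_EFinP; exact: bmf_measurable.
  exact: (bmf_integrable P1 (bmf_comp mf1 bh)).
have -> : \int[P2]_w h (f2 w) = \int[law P2 mf2]_y h y.
  rewrite /Rintegral (integral_distribution (X := pack mf2))//.
    by apply/measurable_EFinP; exact: bmf_measurable.
  exact: (bmf_integrable P2 (bmf_comp mf2 bh)).
by congr fine; apply: eq_measure_integral => A mA _; exact: e.
Qed.

End integral_laws.

(** The joint law is a product: [f] can be frozen and [g] integrated first. *)
Lemma indep2_tonelli (R : realType) d1 (O1 : measurableType d1)
  d2 (O2 : measurableType d2) (P1 : probability O1 R) (P2 : probability O2 R)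
  d3 (T : measurableType d3) d4 (U : measurableType d4)
  (f : O1 -> T) (g : O1 -> U) (g' : O2 -> U) (F : T * U -> \bar R) :
  measurable_fun setT f -> measurable_fun setT g -> measurable_fun setT g' ->
  indep2 P1 f g -> same_law P1 g P2 g' ->
  measurable_fun setT F -> (forall y, 0 <= F y)%E ->
  (\int[P1]_w F (f w, g w) = \int[P1]_w \int[P2]_y F (f w, g' y))%E.
Proof.
move=> mf mg mg' fg e mF F0.
pose PP : probability (O1 * O2)%type R := (P1 \x P2)%E.
have mf1 : measurable_fun setT (f \o @fst O1 O2).
  by apply: measurableT_comp => //; exact: measurable_fst.
have mg2 : measurable_fun setT (g' \o @snd O1 O2).
  by apply: measurableT_comp => //; exact: measurable_snd.
have h := @same_law_pair R _ _ _ _ P1 PP _ _ _ _ f g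
  (f \o @fst O1 O2) (g' \o @snd O1 O2) mf mg mf1 mg2 fg
  (indep2_fst_snd _ _ mf mg').
have mfg : measurable_fun setT (fun w => (f w, g w)) by exact: measurable_fun_pair.
have mfg' : measurable_fun setT (fun w => ((f \o @fst O1 O2) w, (g' \o @snd O1 O2) w)).
  exact: measurable_fun_pair.
rewrite (same_law_integral mfg mfg' (h _ _) mF F0).
- by rewrite fubini_tonelli1//; exact: (measurableT_comp mF mfg').
- by move=> B mB; rewrite same_law_fst.
- by move=> B mB; rewrite same_law_snd// e.
Qed.

Section almost_everywhere.
Context (R : realType) d (O : measurableType d) (P : probability O R).

Lemma ae_eq_prob (A B : set O) : measurable A -> measurable B ->
  {ae P, forall w, A w <-> B w} -> P A = P B.
Proof.
move=> mA mB [N [mN N0 H]].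
have sub C D : measurable C -> measurable D ->
    (forall w, ~ N w -> C w -> D w) -> (P C <= P D)%E.
  move=> mC mD CD; rewrite -[leRHS]adde0 -N0.
  rewrite (le_trans _ (measureU2 _ mD mN))// le_measure ?inE//.
    exact: measurableU.
  by move=> w Cw; have [Nw|Nw] := pselect (N w); [right|left; exact: CD].
have AB w : ~ N w -> (A w <-> B w).
  by move=> Nw; apply: contrapT => nAB; apply: Nw; apply: H.
by apply/eqP; rewrite eq_le !sub// => w /AB[].
Qed.

End almost_everywhere.

(** * The conditional law of a vertex given its descendants *)

Section conditional.
Context (R : realType) (S : ptopologicalType) dT (Theta : measurableType dT).
Variable rho : probability (Theta * enat)%type R.
Variable g : {mfun (Theta * families (borel S))%type >-> borel S}.
Local Notation Inn := (Theta * enat)%type.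
Local Notation SS := (borel S * borel S)%type.
Context d (O : measurableType d) (P : probability O R) (I : vertex -> O -> Inn).
Hypotheses (mI : forall i, measurable_fun setT (I i))
  (lI : forall i, has_law P (I i) rho) (iI : mutually_indep P setT I).

(** The innovations above generation [n] are independent of its values, so that
    this is the conditional probability of the event [A] for the root. *)
Definition phi n (A : set (borel S)) (x : fam vertex (borel S)) : R :=
  fine (P [set w | A (tree_eval g n (tuple_of I w) x)]).

Lemma measurable_phi_event n A x : measurable A ->
  measurable [set w | A (tree_eval g n (tuple_of I w) x)].
Proof.
move=> mA; have m : measurable_fun setT (fun w => tree_eval g n (tuple_of I w) x).
  apply: measurable_tree_eval_comp; last exact: measurable_cst.
  exact: measurable_tuple_of.
exact: (measurable_preimage m mA).
Qed.

Lemma phiE n A x : measurable A ->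
  (phi n A x)%:E = P [set w | A (tree_eval g n (tuple_of I w) x)].
Proof.
by move=> mA; rewrite /phi fineK// fin_num_measure//; exact: measurable_phi_event.
Qed.

Lemma phi_ge0 n A x : 0 <= phi n A x. Proof. exact: fine_ge0. Qed.

Lemma phi_le1 n A x : measurable A -> phi n A x <= 1.
Proof.
move=> mA; rewrite -lee_fin phiE//; apply: probability_le1.
exact: measurable_phi_event.
Qed.

Lemma measurable_phi n A : measurable A -> measurable_fun setT (phi n A).
Proof.
move=> mA.
have m : measurable_fun setT (fun z : fam vertex (borel S) * O =>
    tree_eval g n (tuple_of I z.2) z.1).
  apply: measurable_tree_eval_comp; last exact: measurable_fst.
  exact: (measurableT_comp (measurable_tuple_of mI) measurable_snd).
have := measurable_fun_xsection P (measurable_preimage m mA).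
move=> h; rewrite /phi; apply: (measurableT_comp (fine_measurable measurableT)).
apply: eq_measurable_fun h => x _; congr (P _).
by apply/seteqP; split=> y; rewrite /xsection/= inE.
Qed.

Lemma bmf_phi n A : measurable A -> bmf (phi n A).
Proof.
move=> mA; split; first exact: measurable_phi.
by exists 1 => x; rewrite ger0_norm ?phi_ge0// phi_le1.
Qed.

Lemma phi_local n A x x' : (forall i, size i = n -> x i = x' i) ->
  phi n A x = phi n A x'.
Proof.
move=> xx; rewrite /phi; congr (fine (P _)); apply/seteqP.
by split => w /=; rewrite (@tree_eval_local _ _ _ g n _ (tuple_of I w) _ x').
Qed.

Lemma phi_mask n A D x : level n `<=` D -> phi n A (mask D x) = phi n A x.
Proof.
by move=> nD; apply: phi_local => i si; rewrite /mask mem_set//; exact: nD.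
Qed.

Lemma tuple_shift_law v :
  same_law P (shift v \o tuple_of I) P (tuple_of I).
Proof.
apply: (same_law_tuple (X1 := fun i => I (v ++ i))) => //.
  apply: (@mutually_indep_reindex _ _ _ _ _ _ P I vertex (cat v) (drop (size v)) setT _ iI).
  by move=> i; rewrite drop_size_cat.
by move=> i A mA; rewrite (lI (v ++ i))// (lI i).
Qed.

Lemma phi_shift n A v x : measurable A ->
  P [set w | A (tree_eval g n (shift v (tuple_of I w)) x)] = (phi n A x)%:E.
Proof.
move=> mA; rewrite phiE//.
have m : measurable_fun setT (fun xi => tree_eval g n xi x).
  by apply: measurable_tree_eval_comp; [exact: measurable_id|exact: measurable_cst].
exact: (tuple_shift_law v (measurable_preimage m mA)).
Qed.

(** Given the pairs of generation [n], the two roots are independent. *)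
Lemma iter_rde_op2E (nu : probability SS R) (Pnu : probability (fam vertex SS) R) :
  (forall i : vertex, same_law Pnu (fun x : fam vertex SS => x i) nu id) ->
  mutually_indep Pnu setT (fun (i : vertex) (x : fam vertex SS) => x i) ->
  forall n A B, measurable A -> measurable B ->
  fine (iter n (rde_op2 rho g) nu (A `*` B)) =
  \int[Pnu]_x (phi n A (fst \o x) * phi n B (snd \o x)).
Proof.
move=> lnu inu n A B mA mB.
rewrite /Rintegral; congr fine.
rewrite -(iter_rde_op2_law g mI lI iI lnu inu n (measurableX mA mB)).
rewrite -[LHS]/(product_measure1 Pnu (P \x P)%E
  ((outU g n \o zeta I) @^-1` (A `*` B))) /product_measure1; apply: eq_integral => x _.
rewrite EFinM !phiE//.
have := @product_measure1E _ _ O O R P P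
  [set w | A (tree_eval g n (tuple_of I w) (fst \o x))]
  [set w | B (tree_eval g n (tuple_of I w) (snd \o x))]
  (measurable_phi_event _ _ mA) (measurable_phi_event _ _ mB).
move=> <-; congr (product_measure1 _ _ _).
by apply/seteqP; split=> y; rewrite /xsection/= inE.
Qed.

End conditional.

(** * Probabilities on a Polish space *)

Section probability_bounds.
Context (R : realType) d (T : measurableType d) (P : probability T R).

Lemma fine_probability_le A B : measurable A -> measurable B -> A `<=` B ->
  fine (P A) <= fine (P B).
Proof.
move=> mA mB AB; apply: fine_le; rewrite ?fin_num_measure//.
by apply: le_measure; rewrite ?inE.
Qed.

Lemma fine_probability_setU_le A B : measurable A -> measurable B ->
  fine (P (A `|` B)) <= fine (P A) + fine (P B).
Proof.
move=> mA mB; rewrite -fineD ?fin_num_measure//.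
apply: fine_le; rewrite ?fin_numD ?fin_num_measure//; first exact: measurableU.
exact: measureU2.
Qed.

Lemma probability_bigcup_le e (F : nat -> set T) : 0 <= e ->
  (forall k, measurable (F k)) ->
  (forall k, fine (P (F k)) <= e / (2 ^ k.+1)%:R) ->
  fine (P (\bigcup_k F k)) <= e.
Proof.
move=> e0 mF Fe; have mU : measurable (\bigcup_k F k) by exact: bigcup_measurable.
rewrite -lee_fin fineK ?fin_num_measure//.
apply: (le_trans (measure_sigma_subadditive P mF mU (@subset_refl _ _))).
apply: (le_trans _ (epsilon_trick0 xpredT e0)).
apply: lee_nneseries => // k _.
by have := Fe k; rewrite -lee_fin fineK ?fin_num_measure.
Qed.

Lemma probability_exhaust e (F : nat -> set T) : 0 < e ->
  (forall k, measurable (F k)) -> {homo F : n m / (n <= m)%N >-> n `<=` m} ->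
  exists n, fine (P (\bigcup_k F k `\` F n)) <= e.
Proof.
move=> e0 mF hF; have mU : measurable (\bigcup_k F k) by exact: bigcup_measurable.
have mD n : measurable (\bigcup_k F k `\` F n) by exact: measurableD.
have h : P (\bigcup_k F k `\` F n) @[n --> \oo] --> 0%E.
  have -> : 0%E = P (\bigcap_n (\bigcup_k F k `\` F n)).
    rewrite (_ : \bigcap_n _ = set0) ?measure0//.
    apply/seteqP; split => // x Hx; have [[k _ Fk] _] := Hx 0%N I.
    by have [_] := Hx k I.
  apply: (nonincreasing_cvg_mu (F := fun n => \bigcup_k F k `\` F n)) => //.
  - by rewrite (le_lt_trans (probability_le1 _ _))// ltry.
  - exact: bigcap_measurable.
  - by move=> n m nm; apply/subsetPset; apply: setDS; exact: hF.
have /fine_cvgP[_ /cvgrPdist_le/(_ _ e0)[n _ /(_ n (leqnn n))]] := h.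
rewrite sub0r normrN => hn; exists n; apply: le_trans hn; exact: ler_norm.
Qed.

End probability_bounds.

Section urysohn_base.
Context (R : realType) (S : ptopologicalType).

(** A countable base given by functions: it provides continuous approximations of
    open sets and a countable base of the product. *)
Record urysohn_base (f : nat -> S -> R) : Prop := {
  urysohn_continuous : forall n, continuous (f n) ;
  urysohn_ge0 : forall n x, 0 <= f n x ;
  urysohn_le1 : forall n x, f n x <= 1 ;
  urysohn_separates : forall U x, open U -> U x ->
    exists2 n, f n x = 1 & [set y | f n y != 0] `<=` U }.

Section metric.
Variable dist : S -> S -> R.
Hypotheses (dm : is_metric dist) (dt : metric_induces_topology dist).

Lemma dist_continuous c : continuous (fun x => dist x c).
Proof.
have [_ _ ds tri] := dm.
move=> x; apply/cvgrPdist_lt => e e0; apply/dt; exists e => // y /= xy.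
rewrite ltr_norml; apply/andP; split.
  have := tri y x c; rewrite (ds y x); lra.
have := tri x y c; lra.
Qed.

Lemma dense_sequence : separable_space S ->
  exists x : nat -> S, forall (y : S) e, 0 < e -> exists i, dist y (x i) < e.
Proof.
have [d0 d1 ds tri] := dm.
move=> [D /pcard_surjP[x xD] dD]; exists x => y e e0.
have oB : open [set z | dist z y < e].
  apply: (@open_comp _ _ (fun z => dist z y) [set r | r < e]) => [z _|].
    exact: dist_continuous.
  exact: open_lt.
have [] := dD _ _ oB.
  by exists y => /=; have /d1 -> := erefl y.
by move=> z [/= zy /xD[i _ xi]]; exists i; rewrite xi ds.
Qed.

Lemma metric_urysohn_base : separable_space S ->
  exists f : nat -> S -> R, urysohn_base f.
Proof.
have [d0 d1 ds tri] := dm.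
move=> /dense_sequence[x xd].
(* [h i k] is at least 1 on the ball of radius [k.+1%:R^-1] around [x i] and
   vanishes off the ball of twice this radius; [unpickle] enumerates the pairs *)
pose h (i k : nat) (y : S) : R := Num.max 0 (2 - k.+1%:R * dist y (x i)).
pose f (n : nat) : S -> R := let z := odflt (0, 0)%N (choice.unpickle n : option (nat * nat)) in
  fun y => Num.min 1 (h z.1 z.2 y).
have hc i k : continuous (h i k).
  move=> y; apply: (@continuous_max _ _ (fun=> 0) (fun y => 2 - k.+1%:R * dist y (x i))).
    exact: cst_continuous.
  apply: continuousB; first exact: cst_continuous.
  by apply: continuousM; [exact: cst_continuous|exact: dist_continuous].
exists f; split.
- move=> n y; apply: (@continuous_min _ _ (fun=> 1)); [exact: cst_continuous|exact: hc].
- by move=> n y; rewrite /f /h le_min ler01 le_max lexx.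
- by move=> n y; rewrite /f ge_min lexx.
move=> U y oU Uy.
have /dt[e e0 eU] : nbhs y U by exact: open_nbhs_nbhs.
(* [y] is at distance less than one radius from [x i], the support two radii *)
have [k ke] : exists k : nat, 3 < k.+1%:R * e.
  exists (Num.truncn (3 / e)); rewrite -ltr_pdivrMr//; exact: truncnS_gt.
have [i yi] : exists i, dist y (x i) < k.+1%:R^-1 by apply: xd; rewrite invr_gt0.
have k0 : 0 < k.+1%:R :> R by [].
have yi1 : k.+1%:R * dist y (x i) < 1 by rewrite -ltr_pdivlMl ?mulr1.
exists (choice.pickle (i, k)); rewrite /f choice.pickleK /= /h.
  by apply/min_idPl; rewrite le_max; apply/orP; right; lra.
move=> z /= hz; apply: eU => /=.
have zi : k.+1%:R * dist z (x i) < 2.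
  rewrite ltNge; apply/negP => zi; move/negP: hz; apply.
  by rewrite (max_idPl _) ?subr_le0// (min_idPr _) ?ler01.
have := tri y (x i) z; rewrite (ds (x i) z) => t.
rewrite -(ltr_pM2l k0); apply: le_lt_trans ke.
apply: (le_trans (ler_wpM2l (ltW k0) t)); rewrite mulrDr; lra.
Qed.

End metric.
End urysohn_base.

Section regularity.
Context (R : realType) (S : ptopologicalType) (f : nat -> S -> R)
  (fb : urysohn_base f).
Let B := borel S.

Lemma open_measurable_borel (U : set S) : open U -> measurable (U : set B).
Proof. by move=> oU; exact: sub_sigma_algebra. Qed.

Lemma closed_measurable_borel (F : set S) : closed F -> measurable (F : set B).
Proof.
move=> cF; rewrite -[F]setCK; apply: measurableC.
by apply: open_measurable_borel; exact: closed_openC.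
Qed.

Lemma continuous_measurable_borel (h : S -> R) : continuous h ->
  measurable_fun setT (h : B -> R).
Proof.
move=> hc; apply: (measurability _ (RGenOpens.measurableE R)).
move=> _ [_ [a [b ->]] <-]; rewrite setTI; apply: open_measurable_borel.
apply: open_comp; [by move=> x _; exact: hc|exact: interval_open].
Qed.

(** Maxima of finitely many base functions supported in an open set increase to
    its indicator, and each point of the set is eventually given the value 1. *)
Lemma open_approximation (U : set S) : open U ->
  exists h : nat -> S -> R,
    [/\ forall m, continuous (h m), forall m x, 0 <= h m x <= 1,
        forall m x, ~ U x -> h m x = 0,
        forall x, {homo h^~ x : m n / (m <= n)%N >-> m <= n} &
        forall x, U x -> exists m, h m x = 1].
Proof.
move=> oU; have [fc f0 f1 fs] := fb.
pose g k : S -> R := if `[< [set y | f k y != 0] `<=` U >] then f k else fun=> 0.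
pose h := fix h m : S -> R := if m is k.+1 then h k \max g k else fun=> 0.
have g01 k x : 0 <= g k x <= 1 by rewrite /g; case: asboolP; rewrite ?lexx ?ler01// f0 f1.
have h01 m x : 0 <= h m x <= 1.
  elim: m => [|m /andP[IH0 IH1]] /=; first by rewrite lexx ler01.
  by have /andP[? ?] := g01 m x; rewrite le_max IH0 /= ge_max IH1.
exists h; split => //.
- elim => [|m IH]; first by move=> x; exact: cst_continuous.
  move=> x; apply: continuous_max; first exact: IH.
  by rewrite /g; case: asboolP => _; [exact: fc|exact: cst_continuous].
- elim => [//|m IH] x Ux /=; rewrite (IH x Ux) /g; case: asboolP => fU.
    by have [->|/eqP fx] := eqVneq (f m x) 0; rewrite ?maxxx//; exfalso; apply/Ux/fU/eqP.
  by rewrite maxxx.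
- move=> x; apply: homo_leq => [//|? ? ?|m]; first exact: le_trans.
  by rewrite /= le_max lexx.
move=> x Ux; have [k fk ksub] := fs U x oU Ux.
exists k.+1; apply/le_anti; have /andP[_ ->] := h01 k.+1 x; rewrite /= le_max.
by apply/orP; right; rewrite /g asboolT ?fk.
Qed.

Section inner_outer.
Variable mu : probability B R.

Definition closed_open_regular (A : set S) := forall e : R, 0 < e ->
  exists F U : set S, [/\ closed F, open U, F `<=` A, A `<=` U &
    fine (mu (U `\` F)) <= e].

Lemma open_exhaustion (U : set S) e : open U -> 0 < e ->
  exists h : S -> R, [/\ continuous h, forall x, 0 <= h x <= 1,
    forall x, ~ U x -> h x = 0, closed [set x | 1 <= h x] &
    fine (mu (U `\` [set x | 1 <= h x])) <= e].
Proof.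
move=> oU e0; have [h [hc h01 h0 hm h1]] := open_approximation oU.
pose F n := [set x | 1 <= h n x].
have cF n : closed (F n).
  apply: (@preimage_closed _ _ (h n) [set r | 1 <= r]) => [x _|]; first exact: hc.
  exact: closed_ge.
have FU : \bigcup_n F n = U.
  apply/seteqP; split => [x [n _ /= hn]|x /h1[n hn]].
    by apply: contrapT => /(h0 n) hn0; move: hn; rewrite /F /= hn0 ler10.
  by exists n => //; rewrite /F /= hn.
have mF n : measurable (F n : set B) by exact: closed_measurable_borel.
have [n m nm x /= hn|n] := probability_exhaust mu e0 mF.
  exact: le_trans hn (hm x _ _ nm).
rewrite FU => hn; exists (h n); split.
- exact: hc.
- exact: h01.
- exact: h0.
- exact: cF.
- exact: hn.
Qed.

Lemma open_regular (U : set S) : open U -> closed_open_regular U.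
Proof.
move=> oU e e0; have [h [hc h01 h0 cF hF]] := open_exhaustion oU e0.
exists [set x | 1 <= h x], U; split => // x /= hx.
by apply: contrapT => /h0 hx0; move: hx; rewrite hx0 ler10.
Qed.

Lemma regular_setC A : closed_open_regular A -> closed_open_regular (~` A).
Proof.
move=> rA e e0; have [F [U [cF oU FA AU UFe]]] := rA e e0.
exists (~` U), (~` F); split.
- exact: open_closedC.
- exact: closed_openC.
- exact: subsetC.
- exact: subsetC.
by rewrite setDE setCK setIC -setDE.
Qed.

(** Only finitely many of the closed sets are kept, as their countable union need
    not be closed. *)
Lemma regular_bigcup (A : nat -> set S) :
  (forall n, closed_open_regular (A n)) -> closed_open_regular (\bigcup_n A n).
Proof.
move=> rA e e0; have e2 : 0 < e / 2 by rewrite divr_gt0.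
have ek k : 0 < e / 2 / (2 ^ k.+1)%:R by rewrite divr_gt0// ltr0n expn_gt0.
have [F HF] := @choice _ _ (fun k F => exists U, [/\ closed F, open U, F `<=` A k, A k `<=` U &
  fine (mu (U `\` F)) <= e / 2 / (2 ^ k.+1)%:R]) (fun k => rA k _ (ek k)).
have [U HU] := choice HF.
pose G n := \bigcup_(k in `I_n) F k.
have cG n : closed (G n).
  by apply: closed_bigcup => [|k _]; [exact: finite_II|have [] := HU k].
have oV : open (\bigcup_k U k) by apply: bigcup_open => k _; have [] := HU k.
have mF k : measurable (F k : set B) by have [/closed_measurable_borel] := HU k.
have mU k : measurable (U k : set B) by have [_ /open_measurable_borel] := HU k.
have mG n : measurable (G n : set B) by exact: closed_measurable_borel.
have GF : \bigcup_n G n = \bigcup_k F k.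
  apply/seteqP; split => [x [n _ [k _ Fk]]|x [k _ Fk]]; first by exists k.
  by exists k.+1 => //; exists k => /=.
have [n m nm x [k /= kn Fk]|n hn] := probability_exhaust mu e2 mG.
  by exists k => //=; exact: leq_trans kn nm.
exists (G n), (\bigcup_k U k); split => //.
- by move=> x [k _ Fk]; exists k => //; have [_ _ + _ _] := HU k; exact.
- by move=> x [k _ Ak]; exists k => //; have [_ _ _ + _] := HU k; exact.
have m1 k : measurable (U k `\` F k : set B) by exact: measurableD.
have m2 : measurable (\bigcup_k (U k `\` F k) : set B) by exact: bigcup_measurable.
have m3 : measurable (\bigcup_k G k `\` G n : set B).
  by apply: measurableD => //; exact: bigcup_measurable.
apply: (@le_trans _ _ (fine (mu (\bigcup_k (U k `\` F k) `|` (\bigcup_k G k `\` G n))))).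
  apply: fine_probability_le.
  - by apply: measurableD => //; exact: bigcup_measurable.
  - exact: measurableU.
  move=> x [[k _ Uk] Gn]; have [Fx|nFx] := pselect ((\bigcup_k F k) x).
    by right; rewrite GF.
  by left; exists k => //; split => // Fk; apply: nFx; exists k.
rewrite (le_trans (fine_probability_setU_le mu m2 m3))//.
rewrite [leRHS]splitr lerD// probability_bigcup_le//; first exact: ltW.
by move=> k; have [_ _ _ _] := HU k.
Qed.

Lemma borel_regular (A : set B) : measurable A -> closed_open_regular A.
Proof.
move: A; apply: smallest_sub; last by move=> U; exact: open_regular.
split; first exact/open_regular/open0.
  by move=> A rA; rewrite setTD; exact: regular_setC.
exact: regular_bigcup.
Qed.

(** An open set around [A] of almost the same measure is approximated from
    inside. *)
Lemma continuous_approximation (A : set B) e : measurable A -> 0 < e ->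
  exists h : S -> R, [/\ continuous h, forall x, 0 <= h x <= 1 &
    \int[mu]_x `|h x - \1_A x| <= e].
Proof.
move=> mA e0; have e2 : 0 < e / 2 by rewrite divr_gt0.
have [F [U [cF oU FA AU UFe]]] := borel_regular mA e2.
have [h [hc h01 h0 /closed_measurable_borel mG hn]] := open_exhaustion oU e2.
exists h; split => //; pose G := [set x | 1 <= h x].
have mU : measurable (U : set B) by exact: open_measurable_borel.
have mF : measurable (F : set B) by exact: closed_measurable_borel.
have m1 : measurable (U `\` F : set B) by exact: measurableD.
have m2 : measurable (U `\` G : set B) by exact: measurableD.
have bh : bmf (h : B -> R).
  split; first exact: continuous_measurable_borel.
  by exists 1 => x; have /andP[h0x h1x] := h01 x; rewrite ger0_norm.
apply: (@le_trans _ _ (\int[mu]_x (\1_(U `\` F) x + \1_(U `\` G) x))); last first.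
  rewrite RintD; [|exact: bmf_indic|exact: bmf_indic].
  by rewrite !Rint_indic// [leRHS]splitr lerD.
apply: le_Rint.
- by apply: bmf_norm; apply: bmfB => //; exact: bmf_indic.
- by apply: bmfD; exact: bmf_indic.
move=> x; have /andP[h0x h1x] := h01 x.
have [Ux|nUx] := pselect (U x); last first.
  rewrite h0// indicE memNset ?subrr ?normr0; last by move=> /AU.
  by rewrite addr_ge0.
have [Gx|nGx] := pselect (G x).
  have -> : h x = 1 by apply/le_anti; rewrite h1x.
  have [Ax|nAx] := pselect (A x).
    by rewrite indicE mem_set// subrr normr0 addr_ge0.
  rewrite !indicE (memNset nAx) mem_set; last by split => // /FA.
  by rewrite subr0 normr1 lerDl.
have UGx : (U `\` G) x by [].
rewrite [X in _ <= _ + X]indicE (mem_set UGx).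
rewrite (@le_trans _ _ 1)// ?lerDr//.
have i1 : \1_A x <= 1 :> R := indic_le1 _ _ _.
have i0 : 0 <= \1_A x :> R by rewrite indicE.
by rewrite ler_norml; apply/andP; split; lra.
Qed.

End inner_outer.
End regularity.

Section tightness.
Context (R : realType) (S : ptopologicalType) (dist : S -> S -> R)
  (dm : is_metric dist) (dt : metric_induces_topology dist)
  (dc : metric_complete dist).

Let cball (c : S) (r : R) := [set y | dist y c <= r].

Lemma closed_cball c r : closed (cball c r).
Proof.
apply: (@preimage_closed _ _ (fun y => dist y c) [set t | t <= r]) => [x _|].
  exact: dist_continuous.
exact: closed_le.
Qed.

Lemma ultra_bigcup T (F : set_system T) (G : nat -> set T) n : UltraFilter F ->
  F (\bigcup_(i in `I_n) G i) -> exists2 i, (i < n)%N & F (G i).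
Proof.
move=> UF; elim: n => [|n IH].
  by rewrite II0 bigcup_set0 => /filter_ex[].
move=> FU; have [Gn|Gn] := in_ultra_setVsetC (G n) UF; first by exists n.
have [|i ni Gi] := IH; last by exists i => //; exact: ltnW.
apply: filterS (filterI FU Gn) => x [[i /= ni Gi] nGn].
exists i => //=; move: ni; rewrite ltnS leq_eqVlt => /predU1P[ni|//].
by case: nGn; rewrite -ni.
Qed.

(** Closed and totally bounded sets are compact: an ultrafilter containing the
    set contains balls of arbitrarily small radii, hence is Cauchy. *)
Lemma totally_bounded_compact (x : nat -> S) (n : nat -> nat) (r : nat -> R) :
  (forall e, 0 < e -> exists k, r k < e) ->
  compact (\bigcap_k \bigcup_(i in `I_(n k)) cball (x i) (r k)).
Proof.
have [d0 d1 ds tri] := dm.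
move=> r0; set K := \bigcap_k _; rewrite compact_ultra => F UF FK.
have cK : closed K.
  apply: closed_bigI => k _; apply: closed_bigcup; first exact: finite_II.
  by move=> i _; exact: closed_cball.
have Fball k : exists i, F (cball (x i) (r k)).
  have [|i _ Fi] := @ultra_bigcup _ F (fun i => cball (x i) (r k)) (n k) UF.
    by apply: filterS FK => y /(_ k I).
  by exists i.
have [i Fi] := choice Fball.
have FI k : F (\bigcap_(j in `I_k) cball (x (i j)) (r j)).
  elim: k => [|k IH]; first by rewrite II0 bigcap_set0; exact: filterT.
  apply: filterS (filterI IH (Fi k)) => y [h1 h2] j /=.
  by rewrite ltnS leq_eqVlt => /predU1P[->//|]; exact: h1.
have Fne k : exists y, (\bigcap_(j in `I_k.+1) cball (x (i j)) (r j)) y.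
  by have /filter_ex[y] := FI k.+1; exists y.
have [u Hu] := choice Fne.
have near_x N m : (N <= m)%N -> dist (u m) (x (i N)) <= r N.
  by move=> Nm; apply: (Hu m).
have [l ul] : exists l : S, u @ \oo --> l.
  apply: dc => e e0; have [N rN] := r0 _ (divr_gt0 e0 (ltr0n _ 2)).
  exists N => m m' Nm Nm'; have := near_x N m Nm; have := near_x N m' Nm'.
  have := tri (u m) (x (i N)) (u m'); rewrite (ds (x (i N)) (u m')); lra.
have Fl : F --> l.
  move=> A /dt[e e0 eA]; have [N rN] := r0 _ (divr_gt0 e0 (ltr0n _ 3)).
  have e3 : 0 < e / 3 by rewrite divr_gt0.
  have [m mN um] : exists2 m, (N <= m)%N & dist l (u m) < e / 3.
    have /ul[m _ hm] : nbhs l [set y | dist l y < e / 3] by apply/dt; exists (e / 3).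
    by exists (maxn N m); [exact: leq_maxl|apply: hm; exact: leq_maxr].
  apply: filterS (Fi N) => y; rewrite /cball /= => yx; apply: eA => /=.
  have := near_x N m mN; have := tri l (u m) y; have := tri (u m) (x (i N)) y.
  rewrite (ds (x (i N)) y); lra.
exists l; split => //.
have := cK; rewrite closedE /=; apply => /Fl/= FnK.
have FN : F (~` K) := FnK.
by have [y []] := filter_ex (filterI FK FN).
Qed.

(** For each radius, finitely many balls centred in a dense sequence cover almost
    everything; the intersection over the radii [k.+1%:R^-1] is compact. *)
Lemma ulam (mu : probability (borel S) R) e : separable_space S -> 0 < e ->
  exists K : set S, [/\ closed K, compact K & fine (mu (~` K)) <= e].
Proof.
move=> /(dense_sequence dm dt)[x xd] e0.
pose r k : R := k.+1%:R^-1.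
have mcball i k : measurable (cball (x i) (r k) : set (borel S)).
  by apply: closed_measurable_borel; exact: closed_cball.
have cC k n : closed (\bigcup_(i in `I_n) cball (x i) (r k)).
  apply: closed_bigcup; first exact: finite_II.
  by move=> i _; exact: closed_cball.
have ek k : 0 < e / (2 ^ k.+1)%:R by rewrite divr_gt0// ltr0n expn_gt0.
have Hn k : exists n, fine (mu (~` \bigcup_(i in `I_n) cball (x i) (r k))) <=
    e / (2 ^ k.+1)%:R.
  have [||n Hn] := @probability_exhaust _ _ _ mu _
      (fun n => \bigcup_(i in `I_n) cball (x i) (r k)) (ek k).
  - by move=> n; exact: closed_measurable_borel.
  - move=> n m nm y [i /= ni Hi]; exists i => //=; exact: leq_trans ni nm.
  exists n; move: Hn; rewrite (_ : \bigcup_n _ = setT) ?setTD//.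
  apply/seteqP; split => // y _.
  have [i /ltW yi] := xd y (r k) (ltac:(by rewrite invr_gt0)).
  by exists i.+1 => //; exists i => /=.
have [n HN] := choice Hn.
exists (\bigcap_k \bigcup_(i in `I_(n k)) cball (x i) (r k)); split.
- by apply: closed_bigI => k _; exact: cC.
- apply: totally_bounded_compact => e1 e10.
  exists (Num.truncn e1^-1); rewrite /r -[ltRHS]invrK ltf_pV2 ?posrE ?invr_gt0//.
  exact: truncnS_gt.
rewrite setC_bigcap; apply: probability_bigcup_le => //; first exact: ltW.
by move=> k; apply: measurableC; exact: closed_measurable_borel.
Qed.

Lemma compact_inner_regular (mu : probability (borel S) R) (A : set (borel S)) e :
  separable_space S -> measurable A -> 0 < e ->
  exists K : set S, [/\ closed K, compact K, K `<=` A & fine (mu (A `\` K)) <= e].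
Proof.
move=> sS mA e0; have e2 : 0 < e / 2 by rewrite divr_gt0.
have [f fb] := metric_urysohn_base dm dt sS.
have [F [U [cF oU FA AU Fe]]] := borel_regular fb mu mA e2.
have [K [cK kK Ke]] := ulam mu sS e2.
have cFK : closed (F `&` K) by exact: closedI.
exists (F `&` K); split => //.
- by apply: (subclosed_compact cFK kK) => y [].
- by move=> y [/FA].
have mF : measurable (F : set (borel S)) by exact: closed_measurable_borel.
have mU : measurable (U : set (borel S)) by exact: open_measurable_borel.
have mK : measurable (K : set (borel S)) by exact: closed_measurable_borel.
have m1 : measurable (U `\` F : set (borel S)) by exact: measurableD.
have m2 : measurable (~` K : set (borel S)) by exact: measurableC.
apply: (@le_trans _ _ (fine (mu (U `\` F `|` ~` K)))); last first.
  by rewrite (le_trans (fine_probability_setU_le mu m1 m2))// [leRHS]splitr lerD.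
apply: fine_probability_le.
- by apply: measurableD => //; exact: measurableI.
- exact: measurableU.
move=> y [Ay nFK]; have [Ky|] := pselect (K y); last by right.
by left; split; [exact: AU|move=> Fy; exact: nFK].
Qed.

End tightness.

(** * Weak convergence of couplings *)

Section weak_convergence.
Context (R : realType) (S : ptopologicalType) (f : nat -> S -> R)
  (fb : urysohn_base f).
Let B := borel S.

Lemma continuous_pair (h k : S -> R) : continuous h -> continuous k ->
  continuous (fun z : S * S => h z.1 * k z.2).
Proof.
move=> hc kc z; apply: continuousM.
  by apply: (@continuous_comp _ _ _ fst h); [exact: cvg_fst|exact: hc].
by apply: (@continuous_comp _ _ _ snd k); [exact: cvg_snd|exact: kc].
Qed.

Let e n : set S := [set x | f n x != 0].

Lemma open_base n : open (e n).
Proof.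
apply: (@open_comp _ _ (f n) [set r | r != 0]) => [x _|].
  exact: urysohn_continuous.
exact: open_neq.
Qed.

Lemma open_pair_base (U : set (S * S)) z : open U -> U z ->
  exists i j, [/\ e i z.1, e j z.2 & e i `*` e j `<=` U].
Proof.
move=> oU Uz; have /= : nbhs z U by exact: open_nbhs_nbhs.
case: z Uz => x y Uz [[A C] /= [Ax Cy] AC].
have [i fi iA] := urysohn_separates fb (open_interior A) Ax.
have [j fj jC] := urysohn_separates fb (open_interior C) Cy.
exists i, j; rewrite /e /= fi fj oner_neq0; split => // -[x' y'] /= [xi yj].
by apply: AC; split => /=; apply: interior_subset; [exact: iA|exact: jC].
Qed.

(** The product sigma-algebra contains the open sets of the product because the
    topology has a countable base. *)
Lemma open_pair_measurable (U : set (S * S)) : open U -> measurable (U : set (B * B)).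
Proof.
move=> oU.
pose r k : set (B * B) := let z := odflt (0, 0)%N (choice.unpickle k : option (nat * nat)) in
  if `[< e z.1 `*` e z.2 `<=` U >] then e z.1 `*` e z.2 else set0.
rewrite (_ : U = \bigcup_k r k).
  apply: bigcup_measurable => k _; rewrite /r; case: asboolP => // _.
  by apply: measurableX; apply: open_measurable_borel; exact: open_base.
apply/seteqP; split => [z /(open_pair_base oU)[i [j [zi zj ijU]]]|z [k _]].
  by exists (choice.pickle (i, j)) => //; rewrite /r choice.pickleK /= asboolT.
by rewrite /r; case: asboolP => // + z'; exact.
Qed.

Lemma continuous_bmf2 (F : S * S -> R) : continuous F -> bounded_fun F ->
  bmf (F : B * B -> R).
Proof.
move=> Fc [M [Mr HM]]; split; last first.
  by exists (M + 1) => z; apply: HM => //; rewrite ltrDl.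
apply: (measurability _ (RGenOpens.measurableE R)).
move=> _ [_ [a [b ->]] <-]; rewrite setTI; apply: open_pair_measurable.
apply: open_comp; [by move=> x _; exact: Fc|exact: interval_open].
Qed.

Variable mu : probability B R.

Lemma Rint_fst (nu : probability (B * B)%type R) h : both_marginals mu nu -> bmf h ->
  \int[nu]_z h z.1 = \int[mu]_x h x.
Proof. by move=> [n1 _] bh; apply: (same_law_Rint (f2 := id)). Qed.

Lemma Rint_snd (nu : probability (B * B)%type R) h : both_marginals mu nu -> bmf h ->
  \int[nu]_z h z.2 = \int[mu]_x h x.
Proof. by move=> [_ n2] bh; apply: (same_law_Rint (f2 := id)). Qed.

(** With the marginals prescribed, an approximation in mean of the two sides of
    a rectangle is one of its indicator, uniformly over the couplings. *)
Lemma rectangle_approximation (nu : probability (B * B)%type R) (h k : B -> R)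
    (A C : set B) : both_marginals mu nu -> measurable A -> measurable C ->
  measurable_fun setT h -> measurable_fun setT k ->
  (forall x, 0 <= h x <= 1) -> (forall x, 0 <= k x <= 1) ->
  `|fine (nu (A `*` C)) - \int[nu]_z (h z.1 * k z.2)| <=
  \int[mu]_x `|h x - \1_A x| + \int[mu]_x `|k x - \1_C x|.
Proof.
move=> mn mA mC mh mk h01 k01.
have bh : bmf h by split => //; exists 1 => x; have /andP[? ?] := h01 x; rewrite ger0_norm.
have bk : bmf k by split => //; exists 1 => x; have /andP[? ?] := k01 x; rewrite ger0_norm.
have bA : bmf (\1_A : B -> R) by exact: bmf_indic.
have bC : bmf (\1_C : B -> R) by exact: bmf_indic.
have c1 (h' : B -> R) : bmf h' -> bmf (fun z : B * B => h' z.1).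
  by move=> bh'; exact: (bmf_comp measurable_fst bh').
have c2 (h' : B -> R) : bmf h' -> bmf (fun z : B * B => h' z.2).
  by move=> bh'; exact: (bmf_comp measurable_snd bh').
have bhA : bmf (fun x => `|h x - \1_A x|) by apply: bmf_norm; exact: bmfB.
have bkC : bmf (fun x => `|k x - \1_C x|) by apply: bmf_norm; exact: bmfB.
rewrite -(Rint_fst mn bhA) -(Rint_snd mn bkC) -RintD; [|exact: (c1 _ bhA)|exact: (c2 _ bkC)].
have mAC : measurable (A `*` C) by exact: measurableX.
rewrite -Rint_indic// -RintB; [|exact: bmf_indic|by apply: bmfM; [exact: c1|exact: c2]].
have b0 : bmf (fun z : B * B => \1_(A `*` C) z - h z.1 * k z.2).
  by apply: bmfB; [exact: bmf_indic|apply: bmfM; [exact: c1|exact: c2]].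
apply: (le_trans (le_norm_Rint nu b0)); apply: le_Rint.
- exact: bmf_norm.
- by apply: bmfD; [exact: (c1 _ bhA)|exact: (c2 _ bkC)].
move=> [x y] /=.
have -> : \1_(A `*` C) (x, y) = \1_A x * \1_C y :> R.
  by rewrite !indicE in_setX /=; case: (x \in A); case: (y \in C); rewrite /= ?mulr1 ?mulr0 ?mul0r.
have -> : \1_A x * \1_C y - h x * k y = (\1_A x - h x) * \1_C y + h x * (\1_C y - k y).
  by ring.
apply: (le_trans (ler_normD _ _)); rewrite !normrM lerD//.
  by rewrite distrC ler_piMr// ger0_norm ?indic_le1.
have /andP[h0 h1] := h01 x.
by rewrite [X in _ * X]distrC ler_piMl// ger0_norm.
Qed.

Section sequence.
Variables (nu_ : nat -> probability (B * B)%type R) (nu : probability (B * B)%type R).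
Hypotheses (nun : forall n, both_marginals mu (nu_ n)) (nuoo : both_marginals mu nu).

Definition cvg_on (E : set (B * B)) := fine (nu_ n E) @[n --> \oo] --> fine (nu E).

Lemma weak_cvg_rectangle (A C : set B) : weak_cvg2 nu_ nu ->
  measurable A -> measurable C -> cvg_on (A `*` C).
Proof.
move=> w mA mC; apply/cvgrPdist_le => eps eps0.
have e5 : 0 < eps / 5 by rewrite divr_gt0.
have [h [hc h01 hA]] := continuous_approximation fb mu mA e5.
have [k [kc k01 kC]] := continuous_approximation fb mu mC e5.
have mh := continuous_measurable_borel hc.
have mk := continuous_measurable_borel kc.
have hkb : bounded_fun (fun z : S * S => h z.1 * k z.2).
  exists 1; split => // M M1 z _; apply: le_trans (ltW M1).
  have /andP[? ?] := h01 z.1; have /andP[? ?] := k01 z.2.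
  by rewrite normrM !ger0_norm// mulr_ile1.
have /cvgrPdist_le/(_ _ e5) := w _ (continuous_pair hc kc) hkb.
apply: filterS => n Hn.
have H0 := rectangle_approximation nuoo mA mC mh mk h01 k01.
have H1 := rectangle_approximation (nun n) mA mC mh mk h01 k01.
move: Hn H0 H1; set a := fine (nu _); set b := fine (nu_ n _).
set x := Rintegral nu _ _; set y := Rintegral (nu_ n) _ _ => Hn H0 H1.
have -> : a - b = (a - x) + (x - y) - (b - y) by ring.
rewrite (le_trans (ler_normB _ _))// (le_trans (lerD (ler_normD _ _) (lexx _)))//.
lra.
Qed.

Section converse.
Hypothesis rect : forall A C, measurable A -> measurable C -> cvg_on (A `*` C).

(** By inclusion and exclusion; the intersection with a rectangle makes the
    induction go through. *)
Lemma cvg_on_bigcup (r : nat -> set (B * B)) m E :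
  (forall k, rectangles (r k)) -> rectangles E ->
  cvg_on ((\bigcup_(k in `I_m) r k) `&` E).
Proof.
move=> rr; have mr := @rectangles_measurable _ B _ B.
elim: m E => [|m IH] E rE.
  rewrite II0 bigcup_set0 set0I /cvg_on measure0.
  rewrite (_ : (fun n => _) = fun=> 0); first exact: cvg_cst.
  by apply/funext => n; rewrite measure0.
set D := \bigcup_(k in `I_m) r k.
have mD : measurable D by apply: bigcup_measurable => k _; exact: mr.
have mE : measurable E by exact: mr.
have rmE : rectangles (r m `&` E) by exact: rectangles_setI.
have F (P : probability (B * B)%type R) : fine (P ((\bigcup_(k in `I_m.+1) r k) `&` E)) =
    fine (P (D `&` E)) + fine (P (r m `&` E)) - fine (P (D `&` (r m `&` E))).
  rewrite IIS bigcup_setU bigcup_set1 -/D setIUl.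
  have mDE : measurable (D `&` E) by exact: measurableI.
  have mRE : measurable (r m `&` E) by exact: mr.
  rewrite measureUfinr// ?ltey_eq ?fin_num_measure//.
  rewrite setIACA setIid -setIA fineB ?fineD ?fin_numD ?fin_num_measure//.
  by apply: measurableI => //; exact: measurableI.
rewrite /cvg_on F; under eq_fun do rewrite F.
apply: cvgB; [apply: cvgD|]; [exact: IH| |exact: IH].
by case: rmE => A1 mA1 [A2 mA2 <-]; exact: rect.
Qed.

(** A continuous function is nearly constant on each of countably many open
    rectangles that cover the space. Finitely many of them have almost full
    measure for the limit, hence for the sequence from some index on, and on
    their union the function is uniformly close to a step function. *)
Lemma rectangle_weak_cvg : weak_cvg2 nu_ nu.
Proof.
move=> F Fc Fb; have bF := continuous_bmf2 Fc Fb.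
have [_ [M HM]] := bF.
have M0 : 0 <= M by apply: le_trans (HM point).
apply/cvgrPdist_le => eps eps0.
(* the errors are [d + M * d] for the limit, [d + 2 * M * d] along the sequence
   and [d] for the step function *)
pose d : R := eps / (3 * (1 + M)).
have d0 : 0 < d by rewrite divr_gt0// mulr_gt0// ltr_pwDl.
pose R0 (z : nat * nat) : set (B * B) := e z.1 `*` e z.2.
pose good z := exists c, forall x, R0 z x -> `|F x - c| <= d.
pose r k : set (B * B) := let z := odflt (0, 0)%N (choice.unpickle k : option (nat * nat)) in
  if `[< good z >] then R0 z else set0.
have rr k : rectangles (r k).
  rewrite /r; case: asboolP => _.
    by exists (e (odflt (0, 0)%N (choice.unpickle k : option (nat * nat))).1);
      [|eexists; last reflexivity]; apply: open_measurable_borel; exact: open_base.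
  by exists set0 => //; exists set0 => //; rewrite setX0.
have mr k := rectangles_measurable (rr k).
have /choice[c Hc] k : exists c : R, forall x, r k x -> `|F x - c| <= d.
  by rewrite /r; case: asboolP => // _; exists 0.
have cover : \bigcup_k r k = setT.
  apply/seteqP; split => // z _.
  have oU : open [set x | `|F x - F z| < d].
    apply: (@open_comp _ _ (fun x => `|F x - F z|) [set t | t < d]) => [x _|].
      apply: (@continuous_comp _ _ _ (fun x => F x - F z) (fun t => `|t|)).
        by apply: continuousB; [exact: Fc|exact: cst_continuous].
      exact: norm_continuous.
    exact: open_lt.
  have Uz : [set x | `|F x - F z| < d] z by rewrite /= subrr normr0.
  have [i [j [zi zj ij]]] := open_pair_base oU Uz.
  exists (choice.pickle (i, j)) => //; rewrite /r choice.pickleK /= asboolT//.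
  by exists (F z) => x /ij/ltW.
pose E m := \bigcup_(k in `I_m) r k.
have mE m : measurable (E m) by exact: bigcup_measurable.
have hE : {homo E : n m / (n <= m)%N >-> n `<=` m}.
  by move=> n m nm x [k /= kn rk]; exists k => //=; exact: leq_trans kn nm.
have ES m : E m.+1 = E m `|` r m by rewrite /E IIS bigcup_setU bigcup_set1.
have cE m : cvg_on (E m).
  by rewrite -[E m]setIT; apply: cvg_on_bigcup => //; exact: rectangles_setT.
(* the value [c k] on what [r k] adds to the rectangles before it *)
pose s := fix s m : B * B -> R := if m is k.+1
  then fun z => s k z + c k * (\1_(E k.+1) z - \1_(E k) z) else fun=> 0.
have bs m : bmf (s m).
  elim: m => [|m IH] /=; first exact: bmf_cst.
  by apply: bmfD => //; apply: bmfM; [exact: bmf_cst|apply: bmfB; exact: bmf_indic].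
have s0 m z : ~ E m z -> s m z = 0.
  elim: m => [//|m IH] nE /=; have nE' : ~ E m z.
    by move=> h; apply: nE; apply: hE h.
  by rewrite IH// !indicE !memNset// subrr mulr0 addr0.
have sF m z : E m z -> `|F z - s m z| <= d.
  elim: m => [|m IH]; first by move=> [].
  move=> h /=; have [Em|nEm] := pselect (E m z).
    by rewrite !indicE !mem_set// subrr mulr0 addr0; exact: IH.
  rewrite s0// add0r !indicE mem_set// memNset// subr0 mulr1.
  by move: h; rewrite ES => -[//|]; exact: Hc.
have scvg m : \int[nu_ n]_z s m z @[n --> \oo] --> \int[nu]_z s m z.
  have I (P : probability (B * B)%type R) k : \int[P]_z s k.+1 z =
      \int[P]_z s k z + c k * (fine (P (E k.+1)) - fine (P (E k))).
    have b1 : bmf (fun z : B * B => \1_(E k.+1) z - \1_(E k) z : R).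
      by apply: bmfB; exact: bmf_indic.
    rewrite -!Rint_indic// -RintB; [|exact: bmf_indic|exact: bmf_indic].
    by rewrite -RintZl// -RintD//; apply: bmfM => //; exact: bmf_cst.
  elim: m => [|m IH].
    rewrite /= Rint_cst; under eq_fun do rewrite Rint_cst; exact: cvg_cst.
  rewrite I; under eq_fun do rewrite I.
  apply: cvgD => //; apply: cvgM; first exact: cvg_cst.
  by apply: cvgB; exact: cE.
have close (P : probability (B * B)%type R) m :
    `|\int[P]_z F z - \int[P]_z s m z| <= d + M * (1 - fine (P (E m))).
  rewrite -RintB//; apply: (le_trans (le_norm_Rint P (bmfB bF (bs m)))).
  have b1 : bmf (fun z : B * B => 1 - \1_(E m) z : R).
    by apply: bmfB; [exact: bmf_cst|exact: bmf_indic].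
  have b2 : bmf (fun z : B * B => M * (1 - \1_(E m) z)).
    by apply: bmfM => //; exact: bmf_cst.
  apply: (@le_trans _ _ (\int[P]_z (d + M * (1 - \1_(E m) z)))); last first.
    rewrite RintD; [|exact: bmf_cst|exact: b2].
    by rewrite Rint_cst RintZl// RintB ?Rint_cst ?Rint_indic//; [exact: bmf_cst|exact: bmf_indic].
  apply: le_Rint; [by apply: bmf_norm; exact: bmfB|by apply: bmfD => //; exact: bmf_cst|].
  move=> z; have [Em|nEm] := pselect (E m z).
    by rewrite indicE mem_set// subrr mulr0 addr0; exact: sF.
  rewrite s0// subr0 indicE memNset// subr0 mulr1 (le_trans (HM z))// lerDr; exact: ltW.
have [//|m Hm] := @probability_exhaust _ _ _ nu d E d0 mE.
have {}Hm : 1 - fine (nu (E m)) <= d.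
  have coverE : \bigcup_k E k = setT.
    apply/seteqP; split => // z _; have [k _ rk] : (\bigcup_k r k) z by rewrite cover.
    by exists k.+1 => //; exists k => /=.
  move: Hm; rewrite coverE setTD probability_setC// fineB ?fin_num_measure//.
near=> n.
have H1 := close nu m; have H2 := close (nu_ n) m.
have H3 : `|\int[nu]_z s m z - \int[nu_ n]_z s m z| <= d.
  by near: n; have /cvgrPdist_le := scvg m; exact.
have H4 : `|fine (nu (E m)) - fine (nu_ n (E m))| <= d.
  by near: n; have /cvgrPdist_le := cE m; exact.
have H5 : M * (1 - fine (nu (E m))) <= M * d by rewrite ler_wpM2l.
have H6 : M * (1 - fine (nu_ n (E m))) <= M * (2 * d).
  rewrite ler_wpM2l//; move: H4; rewrite ler_norml => /andP[_ H4].
  by clear -Hm H4; lra.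
have de : 3 * (1 + M) * d = eps by rewrite mulrC divfK// mulf_neq0// gt_eqF// ltr_pwDl.
have -> : \int[nu]_z F z - \int[nu_ n]_z F z =
  (\int[nu]_z F z - \int[nu]_z s m z) + (\int[nu]_z s m z - \int[nu_ n]_z s m z)
  - (\int[nu_ n]_z F z - \int[nu_ n]_z s m z) by ring.
rewrite (le_trans (ler_normB _ _))// (le_trans (lerD (ler_normD _ _) (lexx _)))//.
rewrite -de; clear -H1 H2 H3 H5 H6; lra.
Unshelve. all: by end_near. Qed.

End converse.
End sequence.
End weak_convergence.

(** * Limits of couplings *)

Section coupling_limit.
Context (R : realType) (S : ptopologicalType).
Hypothesis polishS : polish_space R S.
Let B := borel S.
Variable mu : probability B R.

Lemma rectangles_semiring d1 (T1 : measurableType d1) d2 (T2 : measurableType d2) :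
  is_semiring (@rectangles _ T1 _ T2).
Proof.
split.
- by exists set0 => //; exists set0 => //; rewrite setX0.
- exact: rectangles_setI.
move=> _ _ [A mA [C mC <-]] [A' mA' [C' mC' <-]].
exists [set (A `\` A') `*` C; (A `&` A') `*` (C `\` C')]; split.
- exact: finite_set2.
- move=> _ [->|->].
    by exists (A `\` A'); [exact: measurableD|exists C].
  by exists (A `&` A'); [exact: measurableI|exists (C `\` C') => //; exact: measurableD].
- rewrite bigcup_setU !bigcup_set1; apply/seteqP; split => -[x y] /=.
    move=> [[Ax Cy] H]; have [A'x|nA'x] := pselect (A' x); last by left.
    by right; split => //; split => // C'y; apply: H.
  by move=> [[[Ax nA'x] Cy]|[[Ax A'x] [Cy nC'y]]]; split => // -[].
by move=> _ _ [->|->] [->|->] // -[[x y] /=] H; exfalso; tauto.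
Qed.

Lemma probability_bigcup_sum d (T : measurableType d) (P : probability T R)
    (G : nat -> set T) N : (forall k, measurable (G k)) ->
  fine (P (\bigcup_(k in `I_N) G k)) <= \sum_(k < N) fine (P (G k)).
Proof.
move=> mG; elim: N => [|N IH].
  by rewrite II0 bigcup_set0 measure0 big_ord0.
rewrite IIS bigcup_setU bigcup_set1 big_ord_recr /=.
apply: (le_trans (fine_probability_setU_le P _ (mG N))).
  exact: bigcup_measurable.
by rewrite lerD2r.
Qed.

Lemma sum_halves_le (e : R) N : 0 <= e -> \sum_(k < N) e / (2 ^ k.+1)%:R <= e.
Proof.
move=> e0; suff -> : \sum_(k < N) e / (2 ^ k.+1)%:R = e - e / (2 ^ N)%:R.
  by rewrite gerBl divr_ge0.
elim: N => [|N IH]; first by rewrite big_ord0 expn0 divr1 subrr.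
rewrite big_ord_recr /= IH expnS natrM; field.
by rewrite pnatr_eq0 expn_eq0.
Qed.

(** What a rectangle loses when its sides shrink is controlled by the marginals
    alone. *)
Lemma rectangle_le (nu : probability (B * B)%type R) (A A' C C' : set B) :
  both_marginals mu nu -> measurable A -> measurable A' -> measurable C -> measurable C' ->
  fine (nu (A `*` C)) <=
  fine (nu (A' `*` C')) + (fine (mu (A `\` A')) + fine (mu (C `\` C'))).
Proof.
move=> [m1 m2] mA mA' mC mC'.
have mDA : measurable (A `\` A') by exact: measurableD.
have mDC : measurable (C `\` C') by exact: measurableD.
have mR : measurable (A' `*` C') by exact: measurableX.
have mF := measurable_preimage (@measurable_fst _ _ B B) mDA.
have mS := measurable_preimage (@measurable_snd _ _ B B) mDC.
rewrite -(m1 _ mDA) -(m2 _ mDC).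
apply: (@le_trans _ _ (fine (nu (A' `*` C' `|` (fst @^-1` (A `\` A') `|` snd @^-1` (C `\` C')))))).
  apply: fine_probability_le; first exact: measurableX.
    by apply: measurableU => //; exact: measurableU.
  move=> [x y] [/= Ax Cy].
  have [A'x|nA'x] := pselect (A' x); last by right; left.
  by have [C'y|nC'y] := pselect (C' y); [left|right; right].
apply: (le_trans (fine_probability_setU_le nu mR _)); first exact: measurableU.
by rewrite lerD2l; exact: fine_probability_setU_le.
Qed.

Variable nu_ : nat -> probability (B * B)%type R.
Hypothesis nun : forall n, both_marginals mu (nu_ n).
Hypothesis cvgR : forall A C, measurable A -> measurable C ->
  cvgn (fun n => fine (nu_ n (A `*` C))).

Let q (E : set (B * B)) : R := lim (fine (nu_ n E) @[n --> \oo]).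
(* meant for rectangles; the value 0 makes it nonnegative everywhere *)
Let p (E : set (B * B)) : \bar R := if `[< rectangles E >] then (q E)%:E else 0%E.

Let q_cvg (E : set (B * B)) : rectangles E -> fine (nu_ n E) @[n --> \oo] --> q E.
Proof. by move=> [A mA [C mC <-]]; exact: cvgR. Qed.

Let q_ge0 (E : set (B * B)) : rectangles E -> 0 <= q E.
Proof.
move=> rE; apply: limr_ge; first by apply/cvg_ex; exists (q E); exact: q_cvg.
by apply: nearW => n; exact: fine_ge0.
Qed.

Let p_ge0 E : (0 <= p E)%E.
Proof. by rewrite /p; case: asboolP => // /q_ge0. Qed.

Let p_lim (E : set (B * B)) : rectangles E -> nu_ n E @[n --> \oo] --> p E.
Proof.
move=> rE; rewrite /p asboolT//; apply/fine_cvgP; split; last exact: q_cvg.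
by apply: nearW => n; rewrite fin_num_measure//; exact: rectangles_measurable.
Qed.

(** A compact rectangle inside the covered one meets finitely many of the open
    rectangles around the covering ones, and the measure lost or gained is
    bounded by the marginals, uniformly along the sequence. *)
Let q_sub (E : set (B * B)) (F : nat -> set (B * B)) (e : R) :
  0 < e -> rectangles E -> (forall n, rectangles (F n)) ->
  E `<=` \bigcup_n F n -> exists N, q E <= \sum_(k < N) q (F k) + e.
Proof.
have [sS [dist [dm dt dc]]] := polishS.
have [f fb] := metric_urysohn_base dm dt sS.
move=> e0 rE rF; have [A mA [C mC <-]] := rE.
have /choice[a Ha] n : exists AC : set B * set B,
    [/\ measurable AC.1, measurable AC.2 & F n = AC.1 `*` AC.2].
  by have [A' mA' [C' mC' <-]] := rF n; exists (A', C').
(* shrinking the two sides of [E] costs half of [e], enlarging those of all the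
   [F n] the other half *)
move=> sub; have e4 : 0 < e / 4 by rewrite divr_gt0.
have ek k : 0 < e / 4 / (2 ^ k.+1)%:R by rewrite divr_gt0// ltr0n expn_gt0.
have outer (A0 : set B) k : measurable A0 -> exists U : set S,
    [/\ open U, A0 `<=` U & fine (mu (U `\` A0)) <= e / 4 / (2 ^ k.+1)%:R].
  move=> mA0; have [F0 [U [cF oU FA AU H]]] := borel_regular fb mu mA0 (ek k).
  exists U; split => //; apply: le_trans H; apply: fine_probability_le.
  - by apply: measurableD => //; exact: open_measurable_borel.
  - by apply: measurableD; [exact: open_measurable_borel|exact: closed_measurable_borel].
  - by apply: setDS.
have /choice[U HU] k := outer (a k).1 k (let: And3 h _ _ := Ha k in h).
have /choice[V HV] k := outer (a k).2 k (let: And3 _ h _ := Ha k in h).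
have [K1 [cK1 kK1 K1A K1e]] := compact_inner_regular dm dt dc mu sS mA e4.
have [K2 [cK2 kK2 K2C K2e]] := compact_inner_regular dm dt dc mu sS mC e4.
have [N _ /(_ N (leqnn N)) cov] : \forall N \near \oo,
    K1 `*` K2 `<=` \bigcup_(k in `I_N) (U k `*` V k).
  have /compact_near_coveringP := compact_setX kK1 kK2; apply => -[x y] [/= K1x K2y].
  have [k _] := sub (x, y) (conj (K1A _ K1x) (K2C _ K2y)).
  have [_ _ ->] := Ha k => -[/= ax ay].
  have [oU aU _] := HU k; have [oV aV _] := HV k.
  exists (U k `*` V k, [set N | (k < N)%N]).
    split; last by exists k.+1.
    by exists (U k, V k) => //; split; apply: open_nbhs_nbhs; split => //; [exact: aU|exact: aV].
  by move=> [z N] [/= UVz kN]; exists k.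
exists N.
have mU k : measurable (U k : set B) by apply: open_measurable_borel; have [] := HU k.
have mV k : measurable (V k : set B) by apply: open_measurable_borel; have [] := HV k.
have mK1 : measurable (K1 : set B) by exact: closed_measurable_borel.
have mK2 : measurable (K2 : set B) by exact: closed_measurable_borel.
have bound n : fine (nu_ n (A `*` C)) <= \sum_(k < N) fine (nu_ n (F k)) + e.
  apply: (le_trans (rectangle_le (nun n) mA mK1 mC mK2)).
  apply: (@le_trans _ _ (\sum_(k < N) (fine (nu_ n (F k)) + e / 2 / (2 ^ k.+1)%:R) + e / 2)); last first.
    rewrite big_split /= -addrA lerD2l [leRHS]splitr lerD2r.
    by apply: sum_halves_le; rewrite divr_ge0// ltW.
  apply: lerD; last by rewrite (le_trans (lerD K1e K2e))//; lra.
  apply: (@le_trans _ _ (fine (nu_ n (\bigcup_(k in `I_N) (U k `*` V k))))).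
    apply: fine_probability_le; first exact: measurableX.
      by apply: bigcup_measurable => k _; exact: measurableX.
    exact: cov.
  apply: (le_trans (probability_bigcup_sum (nu_ n) N _)).
    by move=> k; exact: measurableX.
  apply: ler_sum => k _; have [ma1 ma2 ->] := Ha k.
  apply: (le_trans (rectangle_le (nun n) (mU k) ma1 (mV k) ma2)); rewrite lerD2l.
  have [_ _ h1] := HU k; have [_ _ h2] := HV k.
  apply: (le_trans (lerD h1 h2)); rewrite -mulrDl ler_wpM2r// ?invr_ge0//; lra.
have h : \sum_(k < N) fine (nu_ n (F k)) + e @[n --> \oo] --> \sum_(k < N) q (F k) + e.
  apply: cvgD; last exact: cvg_cst.
  elim: (N : nat) => [|M IH].
    rewrite big_ord0; under eq_fun do rewrite big_ord0; exact: cvg_cst.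
  rewrite big_ord_recr; under eq_fun do rewrite big_ord_recr.
  by apply: cvgD => //; exact: q_cvg.
have rAC : rectangles (A `*` C) by exists A => //; exists C.
by apply: (ler_cvg_to (q_cvg rAC) h); apply: nearW.
Qed.

Let p_sub (E : set (B * B)) (F : nat -> set (B * B)) : rectangles E -> (forall n, rectangles (F n)) ->
  E `<=` \bigcup_n F n -> (p E <= \sum_(n <oo) p (F n))%E.
Proof.
move=> rE rF sub; apply/lee_addgt0Pr => e e0.
have [N HN] := q_sub e0 rE rF sub.
rewrite {1}/p asboolT//.
apply: (@le_trans _ _ (\sum_(0 <= k < N) p (F k) + e%:E)%E); last first.
  by rewrite leeD2r// nneseries_lim_ge.
rewrite big_mkord (eq_bigr (fun k : 'I_N => (q (F k))%:E)) => [|k _]; last first.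
  by rewrite /p asboolT.
by rewrite sumEFin -EFinD lee_fin.
Qed.

(** No mass escapes because the marginals are tight, so the limits of the masses
    of rectangles are those of a probability. *)
Lemma coupling_limit : exists nu : probability (B * B)%type R,
  both_marginals mu nu /\
  forall A C, measurable A -> measurable C -> cvg_on nu_ nu (A `*` C).
Proof.
have [nu Hnu] := limit_extension (@rectangles_semiring _ B _ B)
  (@rectangles_setT _ _ _ _) (measurable_prod_measurableType _ _) p_ge0 p_lim p_sub.
have rect A C : measurable A -> measurable C -> rectangles (A `*` C : set (B * B)).
  by move=> mA mC; exists A => //; exists C.
exists nu; split; last first.
  move=> A C mA mC; have rAC := rect _ _ mA mC.
  by rewrite /cvg_on Hnu// /p asboolT//; exact: q_cvg.
split => A mA; [rewrite -setXT_fst|rewrite -setTX_snd].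
  have rA := rect _ _ mA (@measurableT _ B).
  rewrite Hnu//; apply: (cvg_unique _ (p_lim rA)) => //.
  rewrite (_ : (fun n => _) = fun=> mu A); first exact: cvg_cst.
  by apply/funext => n; rewrite setXT_fst (nun n).1.
have rA := rect _ _ (@measurableT _ B) mA.
rewrite Hnu//; apply: (cvg_unique _ (p_lim rA)) => //.
rewrite (_ : (fun n => _) = fun=> mu A); first exact: cvg_cst.
by apply/funext => n; rewrite setTX_snd (nun n).2.
Qed.

End coupling_limit.

(** * Recursive tree processes *)

Section rtp.
Context (R : realType) (S : ptopologicalType) dT (Theta : measurableType dT).
Variable rho : probability (Theta * enat)%type R.
Variable g : {mfun (Theta * families (borel S))%type >-> borel S}.
Local Notation Inn := (Theta * enat)%type.
Local Notation SS := (borel S * borel S)%type.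
Variable mu : probability (borel S) R.
Context d (O : measurableType d) (P : probability O R) (I : vertex -> O -> Inn)
  (X : vertex -> O -> borel S).
Hypotheses (mI : forall i, measurable_fun setT (I i))
  (lI : forall i, has_law P (I i) rho) (iI : mutually_indep P setT I).
Hypotheses (mX : forall i, measurable_fun setT (X i))
  (lX : forall i, has_law P (X i) mu)
  (iX : forall n, mutually_indep P (level n) X)
  (recX : forall i,
    {ae P, forall w, X i w = rde_map g (I i w) (fun j => X (rcons i j) w)})
  (XI : forall n, indep_sigma P (sigma_of (level n) X) (sigma_of (below n) I)).

Let tI := tuple_of I.
Let tX := tuple_of X.
Let mtI : measurable_fun setT tI. Proof. exact: measurable_tuple_of. Qed.
Let mtX : measurable_fun setT tX. Proof. exact: measurable_tuple_of. Qed.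
Local Notation phi := (phi g P I).

Lemma rtp_unfold m v :
  {ae P, forall w, X v w = tree_eval g m (shift v (tI w)) (shift v (tX w))}.
Proof.
elim: m v => [|m IH] v.
  by apply: aeW => w; rewrite /= /shift cats0.
have := ae_foralln (fun j => IH (rcons v j)).
apply: filterS2 (recX v) => w -> H /=.
rewrite {1}/shift cats0; congr (rde_map g _ _); apply/funext => j.
by rewrite H !shift_cat -cats1.
Qed.

(** The vertices of the generations before that of [v] are in neither of the two
    sets. *)
Definition subtree (v : vertex) m : set vertex :=
  [set i | exists2 u, i = v ++ u & (size u < m)%N].
Definition outside v m : set vertex :=
  [set i | (size v <= size i)%N /\ ~ subtree v m i].

Lemma fset_vertex_bound (J : {fset vertex}) :
  exists n, forall i, i \in J -> (size i < n)%N.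
Proof.
have [n Hn] := fset_nat_bound [fset size i | i in J]%fset.
by exists n => i iJ; apply: Hn; exact: in_imfset.
Qed.

(** The vertices of [K] are unfolded down to the same generation [M]. *)
Lemma cyl_unfold (K : {fset vertex}) B M (E : set vertex) :
  (forall i, measurable (B i)) -> (forall i, i \in K -> (size i <= M)%N) ->
  (forall i u, i \in K -> (size u < M - size i)%N -> E (i ++ u)) ->
  exists2 H, measurable H & {ae P, forall w, cyl K B (tX w) <->
    H (mask (level M) (tX w), mask E (tI w))}.
Proof.
move=> mB KM KE.
pose H := [set z : fam vertex (borel S) * fam vertex Inn |
  forall i, i \in K -> B i (tree_eval g (M - size i) (shift i z.2) (shift i z.1))].
exists H.
  rewrite (_ : H = \bigcap_(i in [set` K]) [set z |
    B i (tree_eval g (M - size i) (shift i z.2) (shift i z.1))])//.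
  apply: fin_bigcap_measurable => [|i _]; first exact: finite_fset.
  have ms : measurable_fun setT (fun z : fam vertex (borel S) * fam vertex Inn =>
      tree_eval g (M - size i) (shift i z.2) (shift i z.1)).
    apply: measurable_tree_eval_comp.
      exact: (measurableT_comp (measurable_shift i) measurable_snd).
    exact: (measurableT_comp (measurable_shift i) measurable_fst).
  exact: (measurable_preimage ms (mB i)).
have : {ae P, forall w, forall n, forall v,
    X v w = tree_eval g n (shift v (tI w)) (shift v (tX w))}.
  apply: ae_foralln => n.
  (* one null set serves for all vertices, as they are countable *)
  have := ae_foralln (fun k => (fun u => rtp_unfold n u) (odflt [::] (choice.unpickle k))).
  apply: filterS => w Hw u; have := Hw (choice.pickle u).
  by rewrite choice.pickleK.
apply: filterS => w Hw.
have e i : i \in K -> tX w i = tree_eval g (M - size i)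
    (shift i (mask E (tI w))) (shift i (mask (level M) (tX w))).
  move=> iK; rewrite /tX /tuple_of (Hw (M - size i)%N i).
  apply: tree_eval_local => u su; rewrite /shift /mask mem_set//.
    exact: KE.
  by rewrite /level /= size_cat su subnKC// KM.
split => [HB i iK|HH i /= iK].
  by rewrite -e//; exact: HB.
by rewrite e//; exact: HH.
Qed.

Lemma subtree_below v m M : (size v + m <= M)%N -> subtree v m `<=` below M.
Proof.
move=> vM _ [u -> um]; rewrite /below /= size_cat.
by rewrite (leq_trans _ vM)// ltn_add2l.
Qed.

Lemma outside_descent v m i u : outside v m i -> ~ subtree v m (i ++ u).
Proof.
move=> [vi nsub] [u' iu su']; apply: nsub; exists (drop (size v) i).
  by rewrite -[LHS](cat_take_drop (size v)); congr (_ ++ _);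
    rewrite -(takel_cat u vi) iu take_size_cat.
by have := congr1 size iu; rewrite !size_cat size_drop; lia.
Qed.

(** By [cyl_unfold], values outside of the subtree are functions of a generation
    beyond it and of innovations off the subtree. The former is independent of
    all innovations before it, the latter are independent of those in the
    subtree. *)
Lemma outside_indep v m :
  indep2 P (mask (outside v m) \o tX) (mask (subtree v m) \o tI).
Proof.
apply: (@indep2_generated_l _ _ _ _ _ _ _ _ _ _ (@cylinders vertex _ (borel S))).
- exact: measurable_mask_tuple.
- exact: measurable_mask_tuple.
- exact: cylinders_pi.
move=> _ F [J [B [mB ->]]] mF.
rewrite comp_preimage.
have [->|->] := mask_cyl (outside v m) J B.
  by rewrite preimage_set0 set0I !measure0 mul0e.
set K := [fset i in J | i \in outside v m]%fset.
have KD i : i \in K -> outside v m i.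
  by rewrite !inE => /andP[_ /set_mem].
have [M0 HM0] := fset_vertex_bound K.
pose M := maxn M0 (size v + m).
have HM i : i \in K -> (size i <= M)%N.
  by move=> /HM0/ltnW; rewrite /M leq_max => ->.
pose E' := below M `\` subtree v m.
have [|H mH ae_HE] := @cyl_unfold K B M E' mB HM.
  move=> i u iK su; split; first by rewrite /below /= size_cat -ltn_subRL.
  exact: outside_descent (KD i iK).
pose Z w := ((mask (level M) \o tX) w, (mask E' \o tI) w).
have mZ : measurable_fun setT Z.
  by apply: measurable_fun_pair; exact: measurable_mask_tuple.
have indZ : indep2 P Z (mask (subtree v m) \o tI).
  have subM : subtree v m `<=` below M by apply: subtree_below; exact: leq_maxr.
  have sE' : E' `<=` below M by move=> i [].
  apply: indep2_pairA.
  - exact: measurable_mask_tuple.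
  - exact: measurable_mask_tuple.
  - exact: measurable_mask_tuple.
  - have mU : measurable_fun setT (fun y : fam vertex Inn =>
        (mask E' y, mask (subtree v m) y)).
      by apply: measurable_fun_pair; exact: measurable_mask.
    rewrite (_ : (fun w => _) = (fun y => (mask E' y, mask (subtree v m) y)) \o
      (mask (below M) \o tI)); last by apply/funext => w /=; rewrite !mask_mask.
    move=> A C mA mC.
    exact: (indep_sigma_masks (@XI M) mA (measurable_preimage mU mC)).
  - apply: indep2_masks => //.
    by apply/seteqP; split => // i [[]].
have mG : measurable ((mask (subtree v m) \o tI) @^-1` F).
  by apply: measurable_preimage mF; exact: measurable_mask_tuple.
have mK : measurable (tX @^-1` cyl K B).
  by apply: measurable_preimage => //; exact: measurable_cyl.
have mZH : measurable (Z @^-1` H) by exact: measurable_preimage.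
rewrite (ae_eq_prob mK mZH ae_HE) -(indZ H F mH mF).
apply: ae_eq_prob; [exact: measurableI|exact: measurableI|].
by apply: filterS ae_HE => w [h1 h2]; split => -[? ?]; split => //; [exact: h1|exact: h2].
Qed.

(** [X v] is a function of the values of the [m]-th generation of its descendants,
    which are outside of the subtree, and of the innovations in the subtree,
    which are independent of the outside: they can be averaged out. *)
Lemma freeze v m A (h : fam vertex (borel S) -> R) : measurable A -> bmf h ->
  (forall x, 0 <= h x) ->
  \int[P]_w (h (mask (outside v m) (tX w)) * \1_A (X v w)) =
  \int[P]_w (h (mask (outside v m) (tX w)) * phi m A (shift v (tX w))).
Proof.
move=> mA bh h0.
pose ev (z : fam vertex (borel S) * fam vertex Inn) :=
  tree_eval g m (shift v z.2) (shift v z.1).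
have mev : measurable_fun setT ev.
  apply: measurable_tree_eval_comp.
    exact: (measurableT_comp (measurable_shift v) measurable_snd).
  exact: (measurableT_comp (measurable_shift v) measurable_fst).
pose F (z : fam vertex (borel S) * fam vertex Inn) : \bar R := (h z.1 * \1_A (ev z))%:E.
have mF : measurable_fun setT F.
  apply/measurable_EFinP; apply: measurable_funM.
    exact: (measurableT_comp (bmf_measurable bh) measurable_fst).
  exact: (measurableT_comp (measurable_indic mA) mev).
have F0 z : (0 <= F z)%E by rewrite lee_fin mulr_ge0.
pose fX := mask (outside v m) \o tX; pose fI := mask (subtree v m) \o tI.
have mfX : measurable_fun setT fX by exact: measurable_mask_tuple.
have mfI : measurable_fun setT fI by exact: measurable_mask_tuple.
have evE x xi : ev (mask (outside v m) x, mask (subtree v m) xi) = ev (x, xi).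
  apply: tree_eval_local => u su; rewrite /shift /= /mask mem_set//.
    by exists u.
  split => /=; first by rewrite size_cat leq_addr.
  move=> [u' /eqP]; rewrite eqseq_cat// => /andP[_ /eqP <-].
  by rewrite su ltnn.
have := indep2_tonelli mfX mfI mfI (outside_indep v m) (fun _ _ => erefl) mF F0.
have -> : (\int[P]_w F (fX w, fI w) = \int[P]_w (h (fX w) * \1_A (X v w))%:E)%E.
  apply: ae_eq_integral => //.
  - by apply: (measurableT_comp mF); exact: measurable_fun_pair.
  - apply/measurable_EFinP; apply: measurable_funM.
      exact: (measurableT_comp (bmf_measurable bh) mfX).
    exact: (measurableT_comp (measurable_indic mA) (mX v)).
  apply: filterS (rtp_unfold m v) => w /= -> _.
  by rewrite /F/= evE.
move=> E; rewrite /Rintegral E; congr fine.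
apply: eq_integral => w _.
rewrite EFinM -(@phi_shift _ _ _ _ rho g _ _ P I mI lI iI m A v)//.
rewrite (_ : (fun y => F (fX w, fI y)) =
  (fun y => (h (fX w))%:E * (\1_[set y | A (tree_eval g m (shift v (tI y))
    (shift v (tX w)))] y)%:E)%E); last first.
  apply/funext => y; rewrite /F/= evE EFinM !indicE.
  have -> : (y \in [set y0 | A (tree_eval g m (shift v (tI y0)) (shift v (tX w)))]) =
      (ev (tX w, tI y) \in A) by apply/idP/idP; rewrite !inE.
  by [].
have mAe : measurable [set y | A (tree_eval g m (shift v (tI y)) (shift v (tX w)))].
  have mm : measurable_fun setT (fun y => tree_eval g m (shift v (tI y)) (shift v (tX w))).
    apply: measurable_tree_eval_comp; last exact: measurable_cst.
    exact: (measurableT_comp (measurable_shift v) mtI).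
  exact: (measurable_preimage mm mA).
rewrite ge0_integralZl//; last 2 first.
- exact/measurable_EFinP/measurable_indic.
- by rewrite lee_fin.
by rewrite integral_indic// setIT.
Qed.

(** * Energies *)

Let a A : R := fine (mu A).

Lemma prob_X v A : measurable A -> fine (P (X v @^-1` A)) = a A.
Proof. by move=> mA; rewrite (lX v mA). Qed.

Lemma outside_nil n i : outside [::] n i <-> (n <= size i)%N.
Proof.
split => [[_ /= H]|ni].
  by rewrite leqNgt; apply/negP => lt; apply: H; exists i.
by split => // -[u iu un]; move: ni; rewrite iu leqNgt un.
Qed.

Lemma level_outside_nil n m : (n <= m)%N -> level m `<=` outside [::] n.
Proof. by move=> nm i /= im; apply/outside_nil; rewrite im. Qed.

Definition energy A n : R := \int[P]_w (phi n A (tX w) ^+ 2).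

Lemma bmf_phiX n A : measurable A -> bmf (fun w => phi n A (tX w)).
Proof. by move=> mA; apply: (bmf_comp mtX); exact: bmf_phi. Qed.

Lemma bmf_1X v A : measurable A -> bmf (fun w => \1_A (X v w) : R).
Proof. by move=> mA; apply: (bmf_comp (mX v)); exact: bmf_indic. Qed.

Lemma Rint_1X v A : measurable A -> \int[P]_w (\1_A (X v w) : R) = a A.
Proof.
move=> mA; rewrite -(prob_X v mA) -Rint_indic//.
exact: (measurable_preimage (mX v) mA).
Qed.

Lemma Rint_phi n A : measurable A -> \int[P]_w phi n A (tX w) = a A.
Proof.
move=> mA; rewrite -(Rint_1X [::] mA).
have := @freeze [::] n A (fun=> 1) mA (bmf_cst _ 1) (fun=> ler01).
under eq_Rintegral do rewrite mul1r.
by under [X in _ = X -> _]eq_Rintegral do rewrite mul1r.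
Qed.

(** Freezing at generation [n] or [m], either side is the mean of [phi m A] on the
    event that the root is in [A]. Thus [phi n A (tX w)] is a reversed
    martingale, and its increments are orthogonal. *)
Lemma Rint_phiM n m A : measurable A -> (n <= m)%N ->
  \int[P]_w (phi m A (tX w) * phi n A (tX w)) = energy A m.
Proof.
move=> mA nm.
have F k : (k <= m)%N -> \int[P]_w (phi m A (tX w) * \1_A (X [::] w)) =
    \int[P]_w (phi m A (tX w) * phi k A (tX w)).
  move=> km; have b : bmf (phi m A) by exact: bmf_phi.
  have := @freeze [::] k A (phi m A) mA b (phi_ge0 _ _ _ _ _).
  have e w : phi m A (mask (outside [::] k) (tX w)) = phi m A (tX w).
    by rewrite phi_mask//; exact: level_outside_nil.
  under eq_Rintegral do rewrite e.
  by under [X in _ = X -> _]eq_Rintegral do rewrite e.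
by rewrite -(F n)// (F m)// /energy; apply: eq_Rintegral => w _.
Qed.

Lemma Rint_sqrB_le n m A : measurable A -> (n <= m)%N ->
  \int[P]_w ((phi n A (tX w) - phi m A (tX w)) ^+ 2) = energy A n - energy A m.
Proof.
move=> mA nm; rewrite (_ : (fun w => _) = (fun w => phi n A (tX w) ^+ 2 -
  (2 * (phi m A (tX w) * phi n A (tX w)) - phi m A (tX w) ^+ 2))); last first.
  by apply/funext => w; ring.
have bn := bmf_phiX n mA; have bm := bmf_phiX m mA.
have b2 : bmf (fun w => 2 * (phi m A (tX w) * phi n A (tX w))).
  by apply: bmfM; [exact: bmf_cst|exact: bmfM].
rewrite RintB; [|exact: bmfX|by apply: bmfB => //; exact: bmfX].
rewrite RintB//; last exact: bmfX.
rewrite RintZl; last exact: bmfM.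
by rewrite Rint_phiM// -/(energy A n) -/(energy A m); ring.
Qed.

Lemma energy_nonincreasing A n m : measurable A -> (n <= m)%N ->
  energy A m <= energy A n.
Proof.
move=> mA nm; rewrite -subr_ge0 -Rint_sqrB_le//; apply: Rint_ge0 => w.
exact: sqr_ge0.
Qed.

Lemma L1_phiB_le n m A : measurable A ->
  (\int[P]_w `|phi n A (tX w) - phi m A (tX w)|) ^+ 2 <= `|energy A n - energy A m|.
Proof.
move=> mA.
have b : bmf (fun w => phi n A (tX w) - phi m A (tX w)).
  by apply: bmfB; exact: bmf_phiX.
apply: (le_trans (L1_sqr_le P b)).
have [nm|/ltnW mn] := leqP n m; first by rewrite Rint_sqrB_le// ler_norm.
rewrite distrC (_ : (fun w => _) = (fun w => (phi m A (tX w) - phi n A (tX w)) ^+ 2)); last first.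
  by apply/funext => w; rewrite -sqrrN opprB.
by rewrite Rint_sqrB_le// ler_norm.
Qed.

Lemma energy_variance A n : measurable A ->
  \int[P]_w ((phi n A (tX w) - a A) ^+ 2) = energy A n - a A ^+ 2.
Proof.
move=> mA; have bn := bmf_phiX n mA.
rewrite (_ : (fun w => _) = (fun w => phi n A (tX w) ^+ 2 -
  (2 * a A * phi n A (tX w) - a A ^+ 2))); last first.
  by apply/funext => w; ring.
have b2 : bmf (fun w => 2 * a A * phi n A (tX w)).
  by apply: bmfM => //; exact: bmf_cst.
rewrite RintB; [|exact: bmfX|by apply: bmfB => //; exact: bmf_cst].
rewrite RintB//; last exact: bmf_cst.
by rewrite RintZl// Rint_cst Rint_phi// -/(energy A n); ring.
Qed.

Lemma energy_ge A n : measurable A -> a A ^+ 2 <= energy A n.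
Proof.
move=> mA; rewrite -subr_ge0 -energy_variance//; apply: Rint_ge0 => w.
exact: sqr_ge0.
Qed.

Lemma L1_phi_le A n : measurable A ->
  (\int[P]_w `|phi n A (tX w) - a A|) ^+ 2 <= energy A n - a A ^+ 2.
Proof.
move=> mA; rewrite -energy_variance//.
by apply: L1_sqr_le; apply: bmfB; [exact: bmf_phiX|exact: bmf_cst].
Qed.

Lemma L1_phi_cvg A : measurable A -> energy A n @[n --> \oo] --> a A ^+ 2 ->
  \int[P]_w `|phi n A (tX w) - a A| @[n --> \oo] --> 0.
Proof.
move=> mA en; apply/cvgrPdist_le => e e0; have e2 : 0 < e ^+ 2 by rewrite exprn_gt0.
have /cvgrPdist_le/(_ _ e2) := en; apply: filterS => n Hn.
have i0 : 0 <= \int[P]_w `|phi n A (tX w) - a A| by apply: Rint_ge0.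
rewrite sub0r normrN ger0_norm// -ler_sqr ?nnegrE ?(ltW e0)//.
apply: (le_trans (L1_phi_le n mA)); apply: le_trans Hn; rewrite distrC; exact: ler_norm.
Qed.

(** * From a trivial tail to the limit of the energies *)

Definition from n : set vertex := [set i | (n <= size i)%N].

Lemma sigma_of_preimage D (C : set O) : sigma_of D X C <->
  exists2 A, measurable A & C = (mask D \o tX) @^-1` A.
Proof.
rewrite sigma_of_mask; split => [[A mA <-]|[A mA ->]].
  by exists A; rewrite ?setTI.
by exists A; rewrite ?setTI.
Qed.

Lemma sigma_of_mono D E : D `<=` E -> sigma_of D X `<=` sigma_of E X.
Proof.
move=> DE; apply: sub_sigma_algebra2 => _ [i Di [A mA <-]].
by exists i; [exact: DE|exists A].
Qed.

Lemma sigma_of_measurable D : sigma_of D X `<=` measurable.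
Proof.
move=> C /sigma_of_preimage[A mA ->].
by apply: measurable_preimage mA; exact: measurable_mask_tuple.
Qed.

Lemma freeze_set v m A (C : set O) : measurable A ->
  sigma_of (outside v m) X C ->
  \int[P]_w (\1_C w * \1_A (X v w)) =
  \int[P]_w (\1_C w * phi m A (shift v (tX w))).
Proof.
move=> mA /sigma_of_preimage[B mB ->].
have e w : \1_((mask (outside v m) \o tX) @^-1` B) w =
    \1_B (mask (outside v m) (tX w)) :> R.
  by rewrite !indicE; congr (_%:R); apply/idP/idP; rewrite !inE.
under eq_Rintegral do rewrite e.
under [RHS]eq_Rintegral do rewrite e.
by apply: (@freeze v m A (\1_B : fam vertex (borel S) -> R)) => //; exact: bmf_indic.
Qed.

Lemma tail_from n C : tail_sigma X C -> sigma_of (from n) X C.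
Proof. by apply. Qed.

Lemma tail_measurable C : tail_sigma X C -> measurable C.
Proof. by move=> /(@tail_from 0); exact: sigma_of_measurable. Qed.

Section trivial_tail_energy.
Variable A : set (borel S).
Hypothesis mA : measurable A.
Hypothesis triv : trivial_tail P X.

Let l : R := lim (energy A n @[n --> \oo]).

Let cvg_energy : energy A n @[n --> \oo] --> l.
Proof.
apply: nonincreasing_is_cvgn.
  by apply/nonincreasing_seqP => n; apply: energy_nonincreasing.
by exists (a A ^+ 2) => _ [n _ <-]; exact: energy_ge.
Qed.

Let l_le n : l <= energy A n.
Proof.
apply: nonincreasing_cvgn_ge; last by apply/cvg_ex; exists l; exact: cvg_energy.
by apply/nonincreasing_seqP => k; apply: energy_nonincreasing.
Qed.

(* the bound is a square because [L1_phiB_le] bounds that of a distance *)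
Let fast k : exists n, (k <= n)%N /\ forall m, (n <= m)%N ->
  energy A m <= l + ((2 : R) ^- k) ^+ 2.
Proof.
have e0 : 0 < ((2 : R) ^- k) ^+ 2 by rewrite exprn_gt0// invr_gt0 exprn_gt0.
move/cvgrPdist_le: cvg_energy => /(_ _ e0)[N _ HN].
exists (maxn k N); split; first exact: leq_maxl.
move=> m; rewrite geq_max => /andP[_ Nm].
have := HN m Nm; rewrite ler_norml => /andP[h _].
by move: h; rewrite -subr_ge0 => h; rewrite -subr_ge0; lra.
Qed.

Let nk k := sval (cid (fast k)).
Let u k w : R := phi (nk k) A (tX w).
Let dd k w : R := `|u k.+1 w - u k w|.

Let nk_ge k : (k <= nk k)%N. Proof. by rewrite /nk; case: cid => ? []. Qed.

Let energy_nk k : energy A (nk k) <= l + ((2 : R) ^- k) ^+ 2.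
Proof. by rewrite /nk; case: cid => ? [/= _]; exact. Qed.

Let Rint_dd k : \int[P]_w dd k w <= (2 : R) ^- k.
Proof.
have p0 : 0 <= (2 : R) ^- k by rewrite invr_ge0 exprn_ge0.
have i0 : 0 <= \int[P]_w dd k w by apply: Rint_ge0 => w; exact: normr_ge0.
rewrite -ler_sqr ?nnegrE//.
apply: (le_trans (L1_phiB_le (nk k.+1) (nk k) mA)).
have h1 := l_le (nk k); have h2 := l_le (nk k.+1).
have h3 := energy_nk k; have h4 := energy_nk k.+1.
have h5 : ((2 : R) ^- k.+1) ^+ 2 <= ((2 : R) ^- k) ^+ 2.
  rewrite ler_pXn2r ?nnegrE ?invr_ge0 ?exprn_ge0// lef_pV2 ?posrE ?exprn_gt0//.
  by rewrite ler_eXn2l ?ltr1n.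
by rewrite ler_norml; apply/andP; split; lra.
Qed.

Let bu k : bmf (u k). Proof. exact: bmf_phiX. Qed.
Let bdd k : bmf (dd k). Proof. by apply: bmf_norm; apply: bmfB; exact: bu. Qed.

Let DD k w : \bar R := (\sum_(i <oo) (dd (k + i) w)%:E)%E.

(* [DD k] bounds all increments after the [k]-th term at once *)
Let u_chain k j w : ((u (k + j) w)%:E <= (u k w)%:E + DD k w)%E.
Proof.
apply: (@le_trans _ _ ((u k w)%:E + \sum_(0 <= i < j) (dd (k + i) w)%:E)%E); last first.
  by rewrite leeD2l// nneseries_lim_ge// => i _ _; rewrite lee_fin; exact: normr_ge0.
elim: j => [|j IH]; first by rewrite addn0 big_nil adde0.
rewrite big_nat_recr//= addeA (@le_trans _ _ ((u (k + j) w)%:E + (dd (k + j) w)%:E)%E)//.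
  rewrite -EFinD lee_fin -lerBlDl addnS; exact: ler_norm.
by rewrite leeD2r.
Qed.

Let int_DD k : (\int[P]_w DD k w <= (2 * 2 ^- k)%:E)%E.
Proof.
rewrite integral_nneseries//; last 2 first.
- by move=> i; apply/measurable_EFinP; exact: bmf_measurable.
- by move=> i w _; rewrite lee_fin; exact: normr_ge0.
apply: (@le_trans _ _ (\sum_(i <oo) (2 * 2 ^- k / (2 ^ i.+1)%:R)%:E)%E).
  apply: lee_nneseries => [i _ _|i _].
    by apply: integral_ge0 => w _; rewrite lee_fin; exact: normr_ge0.
  rewrite -EFin_Rint// lee_fin (le_trans (Rint_dd _))//.
  rewrite natrX exprD exprS [leRHS](_ : _ = (2 ^+ k * 2 ^+ i)^-1)//.
  by field; rewrite !expf_neq0.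
by apply: epsilon_trick0; rewrite mulr_ge0// invr_ge0 exprn_ge0.
Qed.

Let measurable_DD k : measurable_fun setT (DD k).
Proof.
apply: ge0_emeasurable_sum => [i w _ _|i _]; first by rewrite lee_fin; exact: normr_ge0.
by apply/measurable_EFinP; exact: bmf_measurable.
Qed.

Let DD_ge0 k w : (0 <= DD k w)%E.
Proof. by apply: nneseries_ge0 => i _ _; rewrite lee_fin; exact: normr_ge0. Qed.

Section above.
Variable delta : R.
Hypothesis delta0 : 0 < delta.

Let F k : set O := [set w | a A + delta < u k w].
Let C := lim_sup_set F.

Let mG k : measurable [set x | a A + delta < phi (nk k) A x].
Proof.
have b : bmf (phi (nk k) A) by exact: bmf_phi.
rewrite -[X in measurable X]setTI.
exact: (measurable_fun_ltr (measurable_cst _) (bmf_measurable b)).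
Qed.

Let mF k : measurable (F k).
Proof. exact: (measurable_preimage mtX (mG k)). Qed.

Let C_tail : tail_sigma X C.
Proof.
move=> N _; apply/sigma_of_preimage.
pose G k : set (fam vertex (borel S)) := [set x | a A + delta < phi (nk k) A x].
(* an upper limit does not depend on its first [N] terms *)
exists (\bigcap_n \bigcup_(j >= n + N) G j).
  by apply: bigcapT_measurable => n; apply: bigcup_measurable => j _; exact: mG.
apply/seteqP; split => w Cw n _.
  have [j /= nj Fj] := Cw (n + N)%N Logic.I.
  exists j => //=; rewrite /G /= phi_mask// => i /= si.
  by rewrite /from /= si (leq_trans _ (nk_ge j))// (leq_trans _ nj)// leq_addl.
have [j /= nj Gj] := Cw n Logic.I.
exists j; first by rewrite /= (leq_trans _ nj)// leq_addr.
move: Gj; rewrite /G /= phi_mask// => i /= si.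
by rewrite /from /= si (leq_trans _ (nk_ge j))// (leq_trans _ nj)// leq_addl.
Qed.

Let mC : measurable C.
Proof. exact: tail_measurable. Qed.

Let p : R := fine (P C).

Let C_outside n : sigma_of (outside [::] n) X C.
Proof.
move: (@tail_from n C C_tail); apply: sigma_of_mono => i /= ni.
exact/outside_nil.
Qed.

(* the mean of [u k] on a tail event is the probability that the root is in [A] on
   it, and a tail event has probability 0 or 1 *)
Let int_C k : \int[P]_w (\1_C w * u k w) <= a A * p.
Proof.
have h : \int[P]_w (\1_C w * \1_A (X [::] w)) = \int[P]_w (\1_C w * u k w).
  exact: (@freeze_set [::] (nk k) A C mA (@C_outside (nk k))).
rewrite -h.
have b1 := bmf_indic R mC; have b2 := bmf_1X [::] mA.
have [C0|C1] := triv C_tail.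
  rewrite /p C0 mulr0 -[leRHS](_ : \int[P]_w \1_C w = 0); last first.
    by rewrite Rint_indic// C0.
  apply: le_Rint => //; first exact: bmfM.
  by move=> w; rewrite ler_piMr// indic_le1.
rewrite /p C1 mulr1 -(Rint_1X [::] mA).
apply: le_Rint => //; first exact: bmfM.
by move=> w; rewrite ler_piMl// indic_le1.
Qed.

Let p_bound k : delta * p <= 2 * 2 ^- k.
Proof.
have a0 : 0 <= a A by apply: fine_ge0.
have b1 := bmf_indic R mC.
have buk := bu k.
have b2 : bmf (fun w => \1_C w * u k w) by exact: bmfM.
have H : (((a A + delta) * p)%:E <= (a A * p)%:E + (2 * 2 ^- k)%:E)%E.
  apply: (@le_trans _ _ (\int[P]_w ((\1_C w * u k w)%:E + DD k w))%E).
    have -> : ((a A + delta) * p)%:E = (\int[P]_w ((a A + delta) * \1_C w)%:E)%E.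
      by rewrite -EFin_Rint ?RintZl// ?Rint_indic//; apply: bmfM => //; exact: bmf_cst.
    apply: ge0_le_integral => //.
    - by move=> w _; rewrite lee_fin mulr_ge0// addr_ge0// ltW.
    - by apply/measurable_EFinP; apply: measurable_funM => //; exact: bmf_measurable.
    - apply: emeasurable_funD => //.
      by apply/measurable_EFinP; exact: bmf_measurable.
    move=> w _; rewrite indicE; have [Cw|Cw] := pselect (C w); last first.
      by rewrite memNset//= mulr0 mul0r add0e.
    rewrite mem_set//= mulr1 mul1r.
    (* on [C] some later term exceeds the level, and [DD k] bounds the way to it *)
    have [j /= kj Fj] := Cw k Logic.I.
    rewrite (le_trans _ (u_chain k (j - k) w))// subnKC// lee_fin ltW//.
  rewrite ge0_integralD//; last 2 first.
  - by move=> w _; rewrite lee_fin mulr_ge0// phi_ge0.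
  - by apply/measurable_EFinP; exact: bmf_measurable.
  apply: leeD; last exact: int_DD.
  by rewrite -EFin_Rint// lee_fin.
by move: H; rewrite -EFinD lee_fin mulrDl lerD2l.
Qed.

Let PC0 : P C = 0%E.
Proof.
have PCfin : P C \is a fin_num by exact: fin_num_measure.
suff p0 : p = 0 by rewrite -(fineK PCfin) -/p p0.
apply/eqP; rewrite eq_le fine_ge0// andbT.
apply/ler_addgt0Pl => e e0; rewrite addr0.
rewrite -(ler_pM2l delta0).
have ed : 0 < delta * e / 2 by rewrite divr_gt0// mulr_gt0.
have [k Hk] : exists k, 2 ^- k < delta * e / 2.
  have : (2 : R)^-1 ^+ n @[n --> \oo] --> 0.
    by apply: cvg_expr; rewrite ger0_norm ?invr_ge0// invf_lt1// ltr1n.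
  move=> /cvgrPdist_lt/(_ _ ed)[k _ /(_ k (leqnn k))].
  rewrite sub0r normrN ger0_norm ?exprn_ge0 ?invr_ge0// exprVn => h.
  by exists k.
by rewrite (le_trans (p_bound k))// mulrC -ler_pdivlMr// ltW.
Qed.

Lemma above_energy : l - a A ^+ 2 <= 2 * delta.
Proof.
have cP : P (\bigcup_(j >= n) F j) @[n --> \oo] --> 0%E.
  rewrite -PC0; apply: lim_sup_set_cvg => //.
  by rewrite (le_lt_trans (probability_le1 _ _))// ?ltry//; exact: bigcup_measurable.
have bound k : (((l - a A ^+ 2 - 2 * delta) / 2)%:E <= P (\bigcup_(j >= k) F j))%E.
  apply: (@le_trans _ _ (P (F k))); last first.
    rewrite le_measure ?inE//; first exact: bigcup_measurable.
    by move=> w Fw; exists k => /=.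
  rewrite -[leRHS]fineK ?fin_num_measure// lee_fin ler_pdivrMr// lerBlDr.
  have buk := bu k.
  apply: (@le_trans _ _ (energy A (nk k) - a A ^+ 2)); first by rewrite lerD2r.
  (* the variance is at least [l - a A ^+ 2], and [sqr_deviation_le] makes [F k]
     responsible for it *)
  rewrite -energy_variance//.
  have b1 := bmf_indic R (mF k).
  have bB : bmf (fun w => u k w - a A) by apply: bmfB => //; exact: bmf_cst.
  have bF : bmf (fun w => 2 * delta + 2 * \1_(F k) w).
    by apply: bmfD; [exact: bmf_cst|apply: bmfM => //; exact: bmf_cst].
  apply: (@le_trans _ _ (\int[P]_w (2 * delta + 2 * \1_(F k) w - (u k w - a A)))).
    apply: le_Rint; [exact: bmfX|exact: bmfB|].
    move=> w; rewrite -/(u k w).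
    have a1 : a A <= 1 by rewrite -lee_fin fineK ?fin_num_measure//; exact: probability_le1.
    rewrite indicE; apply: sqr_deviation_le => //.
    - exact: phi_ge0.
    - exact: phi_le1.
    - exact: fine_ge0.
    - by move=> /negP; rewrite inE => /negP; rewrite -leNgt.
  have b2 : bmf (fun w => 2 * \1_(F k) w : R) by apply: bmfM => //; exact: bmf_cst.
  rewrite RintB// (RintD P (bmf_cst O (2 * delta)) b2) Rint_cst RintZl// Rint_indic//.
  rewrite (RintB P buk (bmf_cst O (a A))) Rint_cst Rint_phi// subrr subr0.
  by rewrite addrC mulrC.
have : (((l - a A ^+ 2 - 2 * delta) / 2)%:E <= (0 : \bar R))%E.
  rewrite -(cvg_lim _ cP)//; apply: lime_ge; first by apply: cvgP cP.
  exact: nearW.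
by rewrite lee_fin ler_pdivrMr// mul0r subr_le0.
Qed.

End above.

Lemma trivial_tail_energy : energy A n @[n --> \oo] --> a A ^+ 2.
Proof.
suff <- : l = a A ^+ 2 by exact: cvg_energy.
apply/eqP; rewrite eq_le; apply/andP; split.
  rewrite -subr_le0; apply/ler_addgt0Pl => e e0; rewrite addr0.
  have e2 : 0 < e / 2 by rewrite divr_gt0.
  by rewrite (le_trans (above_energy e2))// mulrC divfK.
apply: limr_ge; first by apply/cvg_ex; exists l; exact: cvg_energy.
by apply: nearW => n; exact: energy_ge.
Qed.

End trivial_tail_energy.

(** * From the limit of the energies to a trivial tail *)

Lemma level_law v n :
  same_law P (mask (level n) \o (shift v \o tX)) P (mask (level n) \o tX).
Proof.
apply: (same_law_masks (X1 := fun i => X (v ++ i))) => //.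
  apply: (@mutually_indep_sub _ _ _ _ _ _ _ _ _ (cat v @^-1` level (size v + n))).
    by move=> i /= si; rewrite /level /= size_cat si.
  apply: (@mutually_indep_reindex _ _ _ _ _ _ _ _ _ (cat v) (drop (size v))) => //.
  by move=> i; rewrite drop_size_cat.
by move=> i _ A mA; rewrite (lX (v ++ i) mA) (lX i mA).
Qed.

Lemma L1_phi_shift v n A : measurable A ->
  \int[P]_w `|phi n A (shift v (tX w)) - a A| = \int[P]_w `|phi n A (tX w) - a A|.
Proof.
move=> mA.
have b : bmf (fun x => `|phi n A x - a A|).
  by apply: bmf_norm; apply: bmfB; [exact: bmf_phi|exact: bmf_cst].
have m1 : measurable_fun setT (mask (level n) \o (shift v \o tX)).
  apply: (measurableT_comp (measurable_mask _)).
  exact: (measurableT_comp (measurable_shift v) mtX).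
have m2 : measurable_fun setT (mask (level n) \o tX) by exact: measurable_mask_tuple.
have := same_law_Rint m1 m2 (@level_law v n) b.
have e x : phi n A (mask (level n) x) = phi n A x by rewrite phi_mask.
under eq_Rintegral do rewrite /= e.
by under [X in _ = X -> _]eq_Rintegral do rewrite /= e.
Qed.

Section energy_trivial_tail.
Hypothesis en : forall A, measurable A -> energy A n @[n --> \oo] --> a A ^+ 2.

Lemma L1_phi_small A e : measurable A -> 0 < e ->
  exists n, \int[P]_w `|phi n A (tX w) - a A| <= e.
Proof.
move=> mA e0; have /cvgrPdist_le/(_ _ e0)[n _ /(_ n (leqnn n)) h] := L1_phi_cvg mA (en mA).
by exists n; apply: le_trans h; rewrite sub0r normrN; exact: ler_norm.
Qed.

(** Freezing [X v], the joint probability is the mean of [phi n A] on [C], and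
    [phi n A] is close to [mu A] in mean. *)
Lemma independent_of_vertex v A C : measurable A ->
  (forall m, sigma_of (outside v m) X C) ->
  P (C `&` X v @^-1` A) = (P C * P (X v @^-1` A))%E.
Proof.
move=> mA HC.
have mC : measurable C by have := HC 0%N; exact: sigma_of_measurable.
have mXA : measurable (X v @^-1` A) by exact: (measurable_preimage (mX v)).
have mI' : measurable (C `&` X v @^-1` A) by exact: measurableI.
suff E : fine (P (C `&` X v @^-1` A)) = fine (P C) * fine (P (X v @^-1` A)).
  have f B : measurable B -> P B = (fine (P B))%:E.
    by move=> mB; rewrite fineK// fin_num_measure.
  by rewrite (f _ mI') E EFinM -!f.
apply/eqP; rewrite -subr_eq0 -normr_eq0 eq_le normr_ge0 andbT.
apply/ler_addgt0Pl => e e0; rewrite addr0.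
have [n Hn] := L1_phi_small mA e0.
have bC := bmf_indic R mC.
have bphi : bmf (fun w => phi n A (shift v (tX w))).
  by apply: (bmf_comp (measurableT_comp (measurable_shift v) mtX)); exact: bmf_phi.
have := freeze_set mA (HC n).
have -> : \int[P]_w (\1_C w * \1_A (X v w)) = fine (P (C `&` X v @^-1` A)).
  rewrite -Rint_indic//; apply: eq_Rintegral => w _.
  by rewrite indicI.
move=> ->; rewrite (prob_X v mA).
have -> : fine (P C) * a A = \int[P]_w (a A * \1_C w).
  by rewrite RintZl// Rint_indic// mulrC.
rewrite -RintB; [|exact: bmfM|by apply: bmfM => //; exact: bmf_cst].
have bd : bmf (fun w => phi n A (shift v (tX w)) - a A).
  by apply: bmfB => //; exact: bmf_cst.
rewrite (_ : (fun w => _) = (fun w => \1_C w * (phi n A (shift v (tX w)) - a A))); last first.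
  by apply/funext => w; ring.
apply: (le_trans (le_norm_Rint P (bmfM bC bd))).
rewrite (le_trans _ Hn)// -(L1_phi_shift v n mA).
apply: le_Rint; [by apply: bmf_norm; exact: bmfM|exact: bmf_norm|].
by move=> w; rewrite normrM ler_piMl// ger0_norm ?indic_le1.
Qed.

(** One vertex is added at a time: the tail event and the vertices before it are
    all outside of the subtree of the new one. *)
Lemma tail_indep_level C n (s : seq vertex) B : tail_sigma X C -> uniq s ->
  (forall i, i \in s -> size i = n) -> (forall i, measurable (B i)) ->
  P (C `&` \bigcap_(i in [set` s]) X i @^-1` B i) =
  (P C * P (\bigcap_(i in [set` s]) X i @^-1` B i))%E.
Proof.
move=> tC + + mB; elim: s => [_ _|v s IH /= /andP[vs us] sn].
  by rewrite set_nil bigcap_set0 setIT probability_setT mule1.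
have sn' i : i \in s -> size i = n by move=> iS; apply: sn; rewrite inE iS orbT.
have vn : size v = n by apply: sn; rewrite mem_head.
set D := \bigcap_(i in [set` s]) X i @^-1` B i.
have -> : \bigcap_(i in [set` v :: s]) X i @^-1` B i = D `&` X v @^-1` B v.
  apply/seteqP; split => w.
    move=> H; split; last by apply: (H v); rewrite /= mem_head.
    by move=> i /= iS; apply: (H i); rewrite /= inE iS orbT.
  by move=> [HD Hv] i /=; rewrite inE => /predU1P[->//|iS]; exact: HD.
have Ds m : sigma_of (outside v m) X D.
  apply/sigma_of_preimage.
  exists (\bigcap_(i in [set` s]) [set x | B i (x i)]).
    apply: fin_bigcap_measurable => [|i _]; first exact: finite_seq.
    exact: (measurable_preimage (measurable_coord i) (mB i)).
  have out i : i \in s -> i \in outside v m.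
    move=> iS; apply/mem_set; split; first by rewrite vn (sn' i iS).
    move=> [u iu _]; have := sn' i iS; rewrite iu size_cat vn.
    move=> /eqP; rewrite -[X in _ == X]addn0 eqn_add2l => /nilP u0.
    by move: vs; rewrite -(cats0 v) -u0 -iu iS.
  by apply/seteqP; split => w H i /= iS; have := H i iS; rewrite /= /mask out.
have Cs m : sigma_of (outside v m) X C.
  have := @tail_from (size v + m) C tC; apply: sigma_of_mono => i /= im.
  split; first by rewrite (leq_trans _ im)// leq_addr.
  by move=> /(subtree_below (leqnn _)); rewrite /below /= ltnNge im.
have CDs m : sigma_of (outside v m) X (C `&` D).
  have /sigma_of_preimage[A1 mA1 ->] := Cs m.
  have /sigma_of_preimage[A2 mA2 ->] := Ds m.
  apply/sigma_of_preimage; exists (A1 `&` A2); first exact: measurableI.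
  by rewrite preimage_setI.
rewrite setIA (independent_of_vertex (mB v) CDs) (independent_of_vertex (mB v) Ds).
by rewrite IH// muleA.
Qed.

Lemma tail_indep_level_law C n A : tail_sigma X C -> measurable A ->
  P (C `&` (mask (level n) \o tX) @^-1` A) =
  (P C * P ((mask (level n) \o tX) @^-1` A))%E.
Proof.
move=> tC mA.
have mC := tail_measurable tC.
apply: (indep_set_generated (G := @cylinders vertex _ (borel S))) => //.
- exact: measurable_mask_tuple.
- exact: cylinders_pi.
move=> _ [J [B [mB ->]]]; rewrite comp_preimage.
have [->|->] := mask_cyl (level n) J B.
  by rewrite preimage_set0 setI0 !measure0 mule0.
rewrite /cyl preimage_bigcap.
apply: (@tail_indep_level C n _ B tC (fset_uniq _) _ mB) => i /=.
by rewrite !inE => /andP[_ /set_mem].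
Qed.

(** The generation [n] and the tail are independent of the innovations before [n],
    and of each other by [tail_indep_level_law]. *)
Lemma tail_indep_pair C n A : tail_sigma X C -> measurable A ->
  P (C `&` (fun w => (mask (level n) (tX w), mask (below n) (tI w))) @^-1` A) =
  (P C * P ((fun w => (mask (level n) (tX w), mask (below n) (tI w))) @^-1` A))%E.
Proof.
move=> tC mA.
have mC := tail_measurable tC.
apply: (indep_set_generated (G := @rectangles _ (fam vertex (borel S)) _ (fam vertex Inn))) => //.
- by apply: measurable_fun_pair; exact: measurable_mask_tuple.
- exact: rectangles_pi.
move=> _ [A1 mA1 [A2 mA2 <-]].
set fX := mask (level n) \o tX; set fI := mask (below n) \o tI.
have -> : (fun w => (mask (level n) (tX w), mask (below n) (tI w))) @^-1` (A1 `*` A2) =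
  fX @^-1` A1 `&` fI @^-1` A2 by [].
have subn : subtree [::] n = below n.
  by apply/seteqP; split => [i [u ->]|i ni]//; exists i.
have i0 := outside_indep [::] n; rewrite subn in i0.
have [C' mC' CE] : exists2 C', measurable C' & C = (mask (outside [::] n) \o tX) @^-1` C'.
  apply/sigma_of_preimage; have := @tail_from n C tC.
  by apply: sigma_of_mono => i ni; apply/outside_nil.
have lev : fX = mask (level n) \o (mask (outside [::] n) \o tX).
  by apply/funext => w; rewrite /= mask_mask//; exact: level_outside_nil.
have mlev : measurable (C' `&` (@mask vertex _ (borel S) (level n)) @^-1` A1).
  apply: measurableI => //.
  exact: (measurable_preimage (measurable_mask _) mA1).
have e1 := i0 _ _ mlev mA2.
have e2 := @tail_indep_level_law C n A1 tC mA1.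
have e3 := indep_sigma_masks (@XI n) mA1 mA2.
have E : (mask (outside [::] n) \o tX) @^-1` (C' `&` (@mask vertex _ (borel S) (level n)) @^-1` A1) =
    C `&` fX @^-1` A1 by rewrite CE lev.
rewrite E in e1; rewrite setIA; apply: (etrans e1).
by rewrite e2 -muleA; congr (_ * _)%E; exact: esym e3.
Qed.

(** A tail event is independent of a generation together with the innovations
    before it, of which any finitely many values of the process are functions.
    It is then independent of the process, and so of itself. *)
Lemma energy_trivial_tail : trivial_tail P X.
Proof.
move=> C tC.
have mC := tail_measurable tC.
have H A : measurable A -> P (C `&` tX @^-1` A) = (P C * P (tX @^-1` A))%E.
  apply: (indep_set_generated (G := @cylinders vertex _ (borel S))) => //.
  - exact: cylinders_pi.
  move=> _ [J [B [mB ->]]].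
  have [n Jn] := fset_vertex_bound J.
  have [||H0 mH0 aeH] := @cyl_unfold J B n (below n) mB.
  - by move=> i /Jn/ltnW.
  - by move=> i u iJ su; rewrite /below /= size_cat -ltn_subRL.
  pose Z w := (mask (level n) (tX w), mask (below n) (tI w)).
  have mZ : measurable_fun setT Z.
    by apply: measurable_fun_pair; exact: measurable_mask_tuple.
  have mZH : measurable (Z @^-1` H0) by exact: measurable_preimage.
  have mK : measurable (tX @^-1` cyl J B).
    by apply: measurable_preimage => //; exact: measurable_cyl.
  rewrite (ae_eq_prob mK mZH aeH) -(@tail_indep_pair C n H0 tC mH0).
  apply: ae_eq_prob; [exact: measurableI|exact: measurableI|].
  by apply: filterS aeH => w [h1 h2]; split => -[? ?]; split => //; [exact: h1|exact: h2].
have [A mA CE] : exists2 A, measurable A & C = tX @^-1` A.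
  have /sigma_of_preimage[A mA ->] := @tail_from 0 C tC.
  exists (mask (from 0) @^-1` A) => //.
  exact: (measurable_preimage (measurable_mask _) mA).
have := H A mA; rewrite -CE setIid => E.
have PCfin : P C \is a fin_num by exact: fin_num_measure.
move: E; rewrite -(fineK PCfin) -EFinM => -[] E.
have /eqP : fine (P C) * (1 - fine (P C)) = 0 by rewrite mulrBr mulr1 -E subrr.
rewrite mulf_eq0 => /orP[/eqP ->|]; first by left.
by rewrite subr_eq0 => /eqP <-; right.
Qed.

End energy_trivial_tail.

(** * Iterating the bivariate operator *)

Lemma indep2_RintM d1 (O1 : measurableType d1) (P1 : probability O1 R)
    d3 (T : measurableType d3) d4 (U : measurableType d4)
    (f : O1 -> T) (k : O1 -> U) (F : T -> R) (K : U -> R) :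
  measurable_fun setT f -> measurable_fun setT k -> indep2 P1 f k ->
  bmf F -> bmf K -> (forall x, 0 <= F x) -> (forall y, 0 <= K y) ->
  \int[P1]_w (F (f w) * K (k w)) = \int[P1]_w F (f w) * \int[P1]_w K (k w).
Proof.
move=> mf mk fk bF bK F0 K0.
have bFf : bmf (fun w => F (f w)) by exact: (bmf_comp mf).
have bKk : bmf (fun w => K (k w)) by exact: (bmf_comp mk).
apply: EFin_inj; rewrite EFin_Rint; last exact: bmfM.
pose H (z : T * U) : \bar R := (F z.1 * K z.2)%:E.
have mH : measurable_fun setT H.
  apply/measurable_EFinP; apply: measurable_funM.
    exact: (measurableT_comp (bmf_measurable bF) measurable_fst).
  exact: (measurableT_comp (bmf_measurable bK) measurable_snd).
have H0 z : (0 <= H z)%E by rewrite lee_fin mulr_ge0.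
have := indep2_tonelli mf mk mk fk (fun _ _ => erefl) mH H0.
rewrite /H /= => ->; rewrite mulrC -RintZl// EFin_Rint; last first.
  by apply: bmfM => //; exact: bmf_cst.
apply: eq_integral => w _; rewrite -EFin_Rint; last first.
  by apply: bmfM => //; exact: bmf_cst.
by rewrite RintZl// mulrC.
Qed.

Section couplings.
Variables (nu : probability SS R) (nm : both_marginals mu nu)
  (Pnu : probability (fam vertex SS) R).
Hypotheses (lnu : forall i : vertex, same_law Pnu (fun x : fam vertex SS => x i) nu id)
  (inu : mutually_indep Pnu setT (fun (i : vertex) (x : fam vertex SS) => x i)).

Let side (b : bool) (z : SS) : borel S := if b then z.2 else z.1.

Let measurable_side b : measurable_fun setT (side b).
Proof. by case: b; [exact: measurable_snd|exact: measurable_fst]. Qed.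

Let sideX b (i : vertex) (x : fam vertex SS) : borel S := side b (x i).

Let msideX b i : measurable_fun setT (sideX b i).
Proof. exact: (measurableT_comp (measurable_side b) (measurable_coord i)). Qed.

Let law_sideX b i : has_law Pnu (sideX b i) mu.
Proof.
move=> A mA; have := lnu i (measurable_preimage (measurable_side b) mA).
by move=> /[dup] + ->; case: b => _; [exact: nm.2|exact: nm.1].
Qed.

Let level_side b n :
  same_law Pnu (mask (level n) \o tuple_of (sideX b)) P (mask (level n) \o tX).
Proof.
apply: same_law_masks => //.
  by apply: (@mutually_indep_sub _ _ _ _ _ _ _ _ _ setT) => //;
    exact: (mutually_indep_comp (measurable_side b) inu).
by move=> i _ A mA; rewrite (law_sideX b i mA) (lX i mA).
Qed.

Let Rint_side b n (F : fam vertex (borel S) -> R) : bmf F ->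
  (forall x, F (mask (level n) x) = F x) ->
  \int[Pnu]_x F (tuple_of (sideX b) x) = \int[P]_w F (tX w).
Proof.
move=> bF FE.
have m1 : measurable_fun setT (mask (level n) \o tuple_of (sideX b)).
  exact: measurable_mask_tuple.
have m2 : measurable_fun setT (mask (level n) \o tX) by exact: measurable_mask_tuple.
have := same_law_Rint m1 m2 (@level_side b n) bF.
under eq_Rintegral do rewrite /= FE.
by under [X in _ = X -> _]eq_Rintegral do rewrite /= FE.
Qed.

Let Phi b n A x := phi n A (tuple_of (sideX b) x).

Let bPhi b n A : measurable A -> bmf (Phi b n A).
Proof. by move=> mA; apply: (bmf_comp (measurable_tuple_of (msideX b))); exact: bmf_phi. Qed.

Let Rint_Phi b n A : measurable A -> \int[Pnu]_x Phi b n A x = a A.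
Proof.
move=> mA; rewrite -(Rint_phi n mA); apply: (@Rint_side b n (phi n A)).
  exact: bmf_phi.
by move=> x; rewrite phi_mask.
Qed.

Let iterE n A C : measurable A -> measurable C ->
  fine (iter n (rde_op2 rho g) nu (A `*` C)) =
  \int[Pnu]_x (Phi false n A x * Phi true n C x).
Proof. by move=> mA mC; rewrite (iter_rde_op2E g mI lI iI lnu inu n mA mC). Qed.

Lemma phi_full n x : phi n setT x = 1.
Proof. by rewrite /phi [X in fine (P X)](_ : _ = setT) ?probability_setT. Qed.

Lemma iter_rde_op2_marginals n : both_marginals mu (iter n (rde_op2 rho g) nu).
Proof.
have fE (m1 m2 : \bar R) : m1 \is a fin_num -> m2 \is a fin_num ->
  fine m1 = fine m2 -> m1 = m2 by move=> f1 f2 e; rewrite -(fineK f1) -(fineK f2) e.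
split => A mA; [rewrite -setXT_fst|rewrite -setTX_snd].
  apply: fE; rewrite ?fin_num_measure//; first exact: measurableX.
  rewrite iterE// -[RHS]/(a A) -(Rint_Phi false n mA).
  by apply: eq_Rintegral => x _; rewrite /Phi phi_full mulr1.
apply: fE; rewrite ?fin_num_measure//; first exact: measurableX.
rewrite iterE// -[RHS]/(a A) -(Rint_Phi true n mA).
by apply: eq_Rintegral => x _; rewrite /Phi phi_full mul1r.
Qed.

(** [phi n C] has mean [mu C] and is at most 1, so the error is that of replacing
    the other factor by its mean. *)
Lemma iter_rde_op2_product_bound n A C : measurable A -> measurable C ->
  `|fine (iter n (rde_op2 rho g) nu (A `*` C)) - a A * a C| <=
  \int[P]_w `|phi n A (tX w) - a A|.
Proof.
move=> mA mC; rewrite iterE// -{1}(Rint_Phi true n mC).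
have b1 := bPhi false n mA; have b2 := bPhi true n mC.
have bA : bmf (fun x => `|phi n A x - a A|).
  by apply: bmf_norm; apply: bmfB; [exact: bmf_phi|exact: bmf_cst].
rewrite -(@Rint_side false n _ bA); last by move=> x; rewrite phi_mask.
rewrite -RintZl// -RintB; [|exact: bmfM|by apply: bmfM => //; exact: bmf_cst].
have bd : bmf (fun x => Phi false n A x - a A) by apply: bmfB => //; exact: bmf_cst.
rewrite (_ : (fun x => _) = (fun x => (Phi false n A x - a A) * Phi true n C x)); last first.
  by apply/funext => x; ring.
apply: (le_trans (le_norm_Rint Pnu (bmfM bd b2))).
apply: le_Rint; [by apply: bmf_norm; exact: bmfM|exact: bmf_norm|].
move=> x; rewrite normrM ler_piMr// ger0_norm ?phi_ge0//; exact: phi_le1.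
Qed.

Lemma rde_op2_ext (nu' : probability SS R) : nu ≡μ nu' -> rde_op2 rho g nu ≡μ rde_op2 rho g nu'.
Proof.
move=> e A mA.
have lnu' (i : vertex) : same_law Pnu (fun x : fam vertex SS => x i) nu' id.
  by move=> C mC; rewrite (lnu i mC) (e _ mC).
exact: (etrans (esym (iter_rde_op2_law g mI lI iI lnu inu 1%N mA))
  (iter_rde_op2_law g mI lI iI lnu' inu 1%N mA)).
Qed.

Hypothesis nuE : nu ≡μ (mu \x mu)%E.

Let sides_indep : indep2 Pnu (tuple_of (sideX false)) (tuple_of (sideX true)).
Proof.
have mt b := measurable_tuple_of (msideX b).
have cylE b (L : {fset vertex}) B : (forall i, measurable (B i)) ->
    Pnu (tuple_of (sideX b) @^-1` cyl L B) = (\prod_(i <- L) mu (B i))%E.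
  move=> mB; rewrite /cyl preimage_bigcap.
  have := mutually_indep_comp (measurable_side b) inu (J := L) (B := B) (fun _ _ => Logic.I) mB.
  move=> ->; apply: eq_bigr => i _; exact: law_sideX.
apply: (indep2_generated (mt false) (mt true)
  (@cylinders_pi _ _ _) (@cylinders_pi _ _ _)).
move=> _ _ [J [B [mB ->]]] [K [C [mC ->]]].
(* both cylinders are extended to the same vertices *)
pose L := (J `|` K)%fset.
pose ext (J : {fset vertex}) (B : vertex -> set (borel S)) i := if i \in J then B i else setT.
have mext J0 B0 : (forall i, measurable (B0 i)) -> forall i, measurable (ext J0 B0 i).
  by move=> mB0 i; rewrite /ext; case: ifP.
have extE (J0 : {fset vertex}) B0 : (J0 `<=` L)%fset -> cyl J0 B0 = cyl L (ext J0 B0).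
  move=> /fsubsetP JL; apply/seteqP; split => x H i /= iL.
    by rewrite /ext; case: ifP => // iJ; exact: H.
  by have := H i (JL _ iL); rewrite /= /ext iL.
rewrite (extE J)// ?fsubsetUl// (extE K)// ?fsubsetUr//.
have mB' := mext J B mB; have mC' := mext K C mC.
rewrite !cylE// -big_split /=.
have := inu (J := L) (B := fun i => ext J B i `*` ext K C i) (fun _ _ => Logic.I)
  (fun i => measurableX (mB' i) (mC' i)).
rewrite (_ : \bigcap_(i in _) _ = tuple_of (sideX false) @^-1` cyl L (ext J B) `&`
    tuple_of (sideX true) @^-1` cyl L (ext K C)); last first.
  apply/seteqP; split => x H.
    by split => i /= iL; have [] := H i iL.
  by move=> i /= iL; have [H1 H2] := H; split; [exact: (H1 i iL)|exact: (H2 i iL)].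
move=> ->; apply: eq_bigr => i _.
rewrite (lnu i (measurableX (mB' i) (mC' i))).
have := nuE (measurableX (mB' i) (mC' i)); rewrite preimage_id => ->.
exact: product_measure1E.
Qed.

(** For i.i.d. pairs with independent components, the two families of components
    are independent, and so are the two roots. *)
Lemma product_fixed_rectangle A C : measurable A -> measurable C ->
  fine (rde_op2 rho g nu (A `*` C)) = a A * a C.
Proof.
move=> mA mC; have := iterE 1 mA mC; rewrite /= => ->.
rewrite -(Rint_Phi false 1 mA) -(Rint_Phi true 1 mC).
apply: (indep2_RintM (measurable_tuple_of (msideX false))
  (measurable_tuple_of (msideX true)) sides_indep).
- exact: bmf_phi.
- exact: bmf_phi.
- by move=> x; exact: phi_ge0.
- by move=> x; exact: phi_ge0.
Qed.

End couplings.

Lemma diag_marginals : both_marginals mu (diag_law mu).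
Proof. by split => A mA; rewrite /diag_law /distribution /pushforward. Qed.

(** At the diagonal law the two trees are grown from one family, which has the law
    of a generation of the process. *)
Lemma iter_diagE n A C : measurable A -> measurable C ->
  fine (iter n (rde_op2 rho g) (diag_law mu) (A `*` C)) =
  \int[P]_w (phi n A (tX w) * phi n C (tX w)).
Proof.
move=> mA mC.
have [Q [lQ iQ]] := iid_family_exists mu vertex.
pose dbl (x : fam vertex (borel S)) : fam vertex SS := fun i => diag (x i).
have md : measurable_fun setT (@diag S) by exact: measurable_fun_pair.
have mdbl : measurable_fun setT dbl.
  by apply: measurable_fam => i; exact: (measurableT_comp md (measurable_coord i)).
pose Pd := law Q mdbl.
have ld (i : vertex) : same_law Pd (fun x : fam vertex SS => x i) (diag_law mu) id.
  by move=> D mD; exact: (lQ i _ (measurable_preimage md mD)).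
have id0 : mutually_indep Pd setT (fun (i : vertex) (x : fam vertex SS) => x i).
  exact: (mutually_indep_comp md iQ).
rewrite (iter_rde_op2E g mI lI iI ld id0 n mA mC).
have b2 : bmf (fun x => phi n A x * phi n C x) by apply: bmfM; exact: bmf_phi.
have b1 : bmf (fun x : fam vertex SS => phi n A (fst \o x) * phi n C (snd \o x)).
  apply: bmfM.
    apply: (@bmf_comp _ _ _ _ _ (fun x : fam vertex SS => fst \o x : fam vertex (borel S))); last exact: bmf_phi.
    by apply: measurable_fam => i; exact: (measurableT_comp measurable_fst (measurable_coord i)).
  apply: (@bmf_comp _ _ _ _ _ (fun x : fam vertex SS => snd \o x : fam vertex (borel S))); last exact: bmf_phi.
  by apply: measurable_fam => i; exact: (measurableT_comp measurable_snd (measurable_coord i)).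
rewrite -(same_law_Rint mdbl (@measurable_id _ _ setT) (P1 := Q) (P2 := Pd) (fun _ _ => erefl) b1).
have m1 : measurable_fun setT (mask (level n) \o tuple_of (fun i (x : fam vertex (borel S)) => x i)).
  by apply: measurable_mask_tuple => i; exact: measurable_coord.
have m2 : measurable_fun setT (mask (level n) \o tX) by exact: measurable_mask_tuple.
have e : same_law Q (mask (level n) \o tuple_of (fun i (x : fam vertex (borel S)) => x i))
    P (mask (level n) \o tX).
  apply: same_law_masks => //.
  - by move=> i; exact: measurable_coord.
  - exact: (@mutually_indep_sub _ _ _ _ _ _ _ _ _ setT).
  - by move=> i _ D mD; rewrite (lQ i _ mD) (lX i mD).
have := same_law_Rint m1 m2 e b2.
under eq_Rintegral do rewrite /= !phi_mask//.
by under [X in _ = X -> _]eq_Rintegral do rewrite /= !phi_mask//.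
Qed.

Lemma energy_diag n A : measurable A ->
  energy A n = fine (iter n (rde_op2 rho g) (diag_law mu) (A `*` A)).
Proof.
by move=> mA; rewrite iter_diagE//; apply: eq_Rintegral => w _; rewrite expr2.
Qed.

Lemma iter_diag_marginals n :
  both_marginals mu (iter n (rde_op2 rho g) (diag_law mu)).
Proof.
have [Q [lQ iQ]] := iid_family_exists (diag_law mu) vertex.
exact: (iter_rde_op2_marginals diag_marginals lQ iQ).
Qed.

Lemma eq_on_rectangles (m1 m2 : probability SS R) :
  (forall A C, measurable A -> measurable C -> fine (m1 (A `*` C)) = fine (m2 (A `*` C))) ->
  m1 ≡μ m2.
Proof.
move=> H; apply: (@finite_measure_unique _ _ _ (@rectangles _ (borel S) _ (borel S))).
- exact: rectangles_pi.
- by rewrite (le_lt_trans (probability_le1 _ _))// ltry.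
move=> _ [A mA [C mC <-]]; have mAC : measurable (A `*` C) by exact: measurableX.
by rewrite -[LHS]fineK ?fin_num_measure// H// fineK// fin_num_measure.
Qed.

Lemma fine_product A C : measurable A -> measurable C ->
  fine ((mu \x mu)%E (A `*` C)) = a A * a C.
Proof.
by move=> mA mC; rewrite product_measure1E// fineM ?fin_num_measure.
Qed.

Lemma product_marginals : both_marginals mu (mu \x mu)%E.
Proof.
split => A mA; first exact: (same_law_fst mu mu (@measurable_id _ _ setT) mA).
exact: (same_law_snd mu mu (@measurable_id _ _ setT) mA).
Qed.

Lemma rde_op2_product : rde_op2 rho g (mu \x mu)%E ≡μ (mu \x mu)%E.
Proof.
have [Q [lQ iQ]] := iid_family_exists ((mu \x mu)%E : probability SS R) vertex.
apply: eq_on_rectangles => A C mA mC; rewrite fine_product//.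
exact: (product_fixed_rectangle (nu := (mu \x mu)%E) product_marginals lQ iQ).
Qed.

Lemma fixed_iterates (nu : probability SS R) n :
  rde_op2 rho g nu ≡μ nu -> iter n (rde_op2 rho g) nu ≡μ nu.
Proof.
move=> fx; elim: n => [//|n IH] A mA /=.
have [Q [lQ iQ]] := iid_family_exists (iter n (rde_op2 rho g) nu) vertex.
by rewrite (rde_op2_ext lQ iQ IH mA) fx.
Qed.

Lemma iter_rde_op2_product_cvg (nu : probability SS R) A C :
  both_marginals mu nu -> measurable A -> measurable C ->
  energy A n @[n --> \oo] --> a A ^+ 2 ->
  fine (iter n (rde_op2 rho g) nu (A `*` C)) @[n --> \oo] --> a A * a C.
Proof.
move=> nm mA mC en; have [Q [lQ iQ]] := iid_family_exists nu vertex.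
apply/cvgrPdist_le => e e0.
have /cvgrPdist_le/(_ _ e0) := L1_phi_cvg mA en; apply: filterS => n Hn.
rewrite distrC (le_trans (iter_rde_op2_product_bound nm lQ iQ n mA mC))//.
by apply: le_trans Hn; rewrite sub0r normrN; exact: ler_norm.
Qed.

Lemma trivial_tail_uniqueness : trivial_tail P X -> bivariate_uniqueness2 rho g mu.
Proof.
move=> triv; split; first exact: rde_op2_product.
move=> nu nm fx; apply: eq_on_rectangles => A C mA mC; rewrite fine_product//.
have := iter_rde_op2_product_cvg nm mA mC (trivial_tail_energy mA triv).
rewrite (_ : (fun n => _) = fun=> fine (nu (A `*` C))); last first.
  by apply/funext => n; rewrite (fixed_iterates n fx (measurableX mA mC)).
by move=> h; apply: (cvg_unique _ _ h) => //; exact: cvg_cst.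
Qed.

Hypothesis polishS : polish_space R S.
Local Notation nu_ n := (iter n (rde_op2 rho g) (diag_law mu)).

Lemma trivial_tail_weak_cvg :
  trivial_tail P X <-> weak_cvg2 (fun n => nu_ n) (mu \x mu)%E.
Proof.
have [sS [dist [dm dt dc]]] := polishS.
have [f fb] := metric_urysohn_base dm dt sS.
split => [triv|w].
  apply: (rectangle_weak_cvg fb) => A C mA mC.
  rewrite /cvg_on fine_product//.
  exact: (iter_rde_op2_product_cvg diag_marginals mA mC (trivial_tail_energy mA triv)).
apply: energy_trivial_tail => A mA.
have := weak_cvg_rectangle fb iter_diag_marginals product_marginals w mA mA.
rewrite /cvg_on fine_product// expr2.
by under eq_fun do rewrite -energy_diag//.
Qed.

(** The energies converge, as they decrease, so that [phi n A] and [phi n C] are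
    Cauchy in mean by [L1_phiB_le]. *)
Lemma diag_iterates_cvg A C : measurable A -> measurable C ->
  cvgn (fun n => fine (nu_ n (A `*` C))).
Proof.
move=> mA mC.
have en D : measurable D -> cvgn (energy D).
  move=> mD; apply: nonincreasing_is_cvgn.
    by apply/nonincreasing_seqP => n; exact: energy_nonincreasing.
  by exists (a D ^+ 2) => _ [n _ <-]; exact: energy_ge.
have L1 n m : `|fine (nu_ n (A `*` C)) - fine (nu_ m (A `*` C))| <=
    \int[P]_w `|phi n A (tX w) - phi m A (tX w)| +
    \int[P]_w `|phi n C (tX w) - phi m C (tX w)|.
  have b k D : measurable D -> bmf (fun w => phi k D (tX w)) by exact: bmf_phiX.
  have bA := bmfB (b n A mA) (b m A mA); have bC := bmfB (b n C mC) (b m C mC).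
  rewrite !iter_diagE// -RintB; [|exact: bmfM (b _ _ _) (b _ _ _)..].
  rewrite -RintD; [|exact: bmf_norm|exact: bmf_norm].
  apply: (le_trans (le_norm_Rint P (bmfB (bmfM (b n A mA) (b n C mC)) (bmfM (b m A mA) (b m C mC))))).
  apply: le_Rint.
  - by apply: bmf_norm; apply: bmfB; apply: bmfM; exact: b.
  - by apply: bmfD; exact: bmf_norm.
  move=> w.
  rewrite (_ : _ - _ = (phi n A (tX w) - phi m A (tX w)) * phi n C (tX w) +
    phi m A (tX w) * (phi n C (tX w) - phi m C (tX w))); last by ring.
  rewrite (le_trans (ler_normD _ _))// !normrM lerD//.
    by rewrite ler_piMr// ger0_norm ?phi_ge0//; exact: phi_le1.
  by rewrite ler_piMl// ger0_norm ?phi_ge0//; exact: phi_le1.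
have small D e : measurable D -> 0 < e -> \forall n & m \near \oo,
    \int[P]_w `|phi n D (tX w) - phi m D (tX w)| <= e.
  move=> mD e0; have e2 : 0 < e ^+ 2 by rewrite exprn_gt0.
  have /cauchy_cvgP/cauchy_ballP/(_ _ e2) := en D mD; rewrite near_map2.
  apply: filterS => -[n m] /= Hnm.
  have i0 : 0 <= \int[P]_w `|phi n D (tX w) - phi m D (tX w)| by apply: Rint_ge0.
  rewrite -ler_sqr ?nnegrE ?(ltW e0)// (le_trans (L1_phiB_le n m mD))// ltW//.
apply/cauchy_cvgP/cauchy_ballP => e e0.
have e3 : 0 < e / 3 by rewrite divr_gt0.
rewrite near_map2; apply: filterS (filterI (small A _ mA e3) (small C _ mC e3)) => -[n m] /= [h1 h2].
rewrite /ball /= (le_lt_trans (L1 n m))// (le_lt_trans (lerD h1 h2))//; lra.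
Qed.

(** The limit of the iterates from the diagonal law is a fixed point: applied to
    the convergent sequence, the continuous operator only shifts it. *)
Lemma uniqueness_trivial_tail : bivariate_uniqueness2 rho g mu ->
  rde_op2_continuous rho g mu -> trivial_tail P X.
Proof.
have [sS [dist [dm dt dc]]] := polishS.
have [f fb] := metric_urysohn_base dm dt sS.
move=> [_ uniq] cont.
have [nu [nm nucvg]] := coupling_limit polishS iter_diag_marginals diag_iterates_cvg.
have w : weak_cvg2 (fun n => nu_ n) nu.
  exact: (rectangle_weak_cvg fb nucvg).
have w1 := cont _ _ iter_diag_marginals nm w.
have [Q [lQ iQ]] := iid_family_exists nu vertex.
have nm1 : both_marginals mu (rde_op2 rho g nu) := iter_rde_op2_marginals nm lQ iQ 1.
have fx : rde_op2 rho g nu ≡μ nu.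
  apply: eq_on_rectangles => A C mA mC.
  have h1 := weak_cvg_rectangle fb (fun n => iter_diag_marginals n.+1) nm1 w1 mA mC.
  have h2 : fine (nu_ n.+1 (A `*` C)) @[n --> \oo] --> fine (nu (A `*` C)).
    by have := nucvg _ _ mA mC; rewrite /cvg_on -(cvg_shiftS (fun n => fine (nu_ n _))).
  by apply: (cvg_unique _ h1 h2).
have nuE := uniq nu nm fx.
apply: energy_trivial_tail => A mA.
have := nucvg A A mA mA; rewrite /cvg_on (nuE _ (measurableX mA mA)) fine_product// expr2.
by under eq_fun do rewrite -energy_diag//.
Qed.

End rtp.

Theorem theorem4 (R : realType) (S : ptopologicalType)
    (polishS : polish_space R S)
    (dT : measure_display) (Theta : measurableType dT)
    (rho : probability (Theta * enat)%type R)
    (g : {mfun (Theta * families (borel S))%type >-> borel S})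
    (mu : probability (borel S) R) (mu_sol : rde_solution rho g mu)
    (d : measure_display) (Omega : measurableType d) (P : probability Omega R)
    (I : seq nat -> {RV P >-> (Theta * enat)%type})
    (X : seq nat -> {RV P >-> borel S})
    (rtp : invariant_rtp rho g mu I X) :
  [/\ trivial_tail P X -> bivariate_uniqueness2 rho g mu,
      bivariate_uniqueness2 rho g mu -> rde_op2_continuous rho g mu ->
        trivial_tail P X &
      trivial_tail P X <->
        weak_cvg2 (fun n => iter n (rde_op2 rho g) (diag_law mu))
                  (mu \x mu)%E].
Proof.
have [lI iI lX iX recX XI] := rtp.
have mI i : measurable_fun setT (I i) by exact: measurable_funPT.
have mX i : measurable_fun setT (X i) by exact: measurable_funPT.
split.
- exact: (trivial_tail_uniqueness mI lI iI mX lX iX recX XI).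
- exact: (uniqueness_trivial_tail mI lI iI mX lX iX recX XI polishS).
- exact: (trivial_tail_weak_cvg mI lI iI mX lX iX recX XI polishS).
Qed.
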